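(* Let $(\mathcal{X},\mathcal{B},m,T)$ be an ergodic, aperiodic probability preserving system. For every $\alpha\in(0,2)$ and every $\sigma>0$ there exists a measurable function $f:\mathcal{X}\to\mathbb{R}$ such that, as $n\to\infty$, $\frac{1}{n^{1/\alpha}}S_n(f)$ (as a random variable on $(\mathcal{X},\mathcal{B},m)$) converges in distribution to an $S\alpha S(\sigma)$ random variable.
   Context: A probability preserving system $(\mathcal{X},\mathcal{B},m,T)$ consists of a standard probability space $(\mathcal{X},\mathcal{B},m)$ and a measurable map $T:\mathcal{X}\to\mathcal{X}$ with $m\circ T^{-1}=m$. It is aperiodic if the set of all periodic points of $T$ is a null set, and ergodic if every $T$-invariant set is null or co-null. For $f:\mathcal{X}\to\mathbb{R}$, $S_n(f)=\sum_{k=0}^{n-1}f\circ T^k$. For $\alpha\in(0,2)$ and $\sigma>0$, a real random variable $Y$ is $S\alpha S(\sigma)$ (symmetric $\alpha$-stable with dispersion parameter $\sigma$) if $\mathbb{E}(e^{i\theta Y})=\exp(-\sigma^\alpha|\theta|^\alpha)$ for all $\theta\in\mathbb{R}$. *)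

(* Defs.v *)
From HB Require Import structures.
From mathcomp Require Import all_boot all_order all_algebra.
From mathcomp Require Import all_classical all_reals all_analysis.
From mathcomp Require Import complex.

Set Implicit Arguments.
Unset Strict Implicit.
Unset Printing Implicit Defensive.

Import Order.TTheory GRing.Theory Num.Theory.
Import numFieldNormedType.Exports.

Local Open Scope classical_set_scope.
Local Open Scope ring_scope.

(* A Hausdorff complete pseudometric type is completely metrizable. *)
Definition polish (R : realType) (P : completePseudoMetricType R) : Prop :=
  hausdorff_space P /\ exists D : set P, countable D /\ dense D.

Definition completion d (X : measurableType d) (R : realType)
    (m : probability X R) (G : set (set X)) : set (set X) :=
  [set A | exists B N : set X,
    [/\ G B, G N, m N = 0%E, B `<=` A & A `<=` B `|` N]].

(* Up to a bijection h, X is a Polish space P, and its sigma-algebra is either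
   the Borel sigma-algebra of P or the m-completion of it: both conventions for
   "standard probability space" are in use. *)
Definition standard_probability_space d (X : measurableType d) (R : realType)
    (m : probability X R) : Prop :=
  exists (P : completePseudoMetricType R) (h : X -> P),
    let borel := [set h @^-1` B | B in <<s @open P >>] in
    [/\ polish P, bijective h &
        @measurable d X = borel \/ @measurable d X = completion m borel].

Definition measure_preserving d (X : measurableType d) (R : realType)
    (m : probability X R) (T : X -> X) : Prop :=
  measurable_fun setT T /\
  forall A : set X, measurable A -> m (T @^-1` A) = m A.

Definition periodic_points (X : Type) (T : X -> X) : set X :=
  [set x | exists n : nat, (0 < n)%N /\ iter n T x = x].

Definition aperiodic d (X : measurableType d) (R : realType)
    (m : probability X R) (T : X -> X) : Prop :=
  m.-negligible (periodic_points T).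

Definition ergodic d (X : measurableType d) (R : realType)
    (m : probability X R) (T : X -> X) : Prop :=
  forall A : set X, measurable A -> T @^-1` A = A -> m A = 0%E \/ m (~` A) = 0%E.

Definition birkhoff_sum (X : Type) (R : realType) (T : X -> X) (f : X -> R)
    (n : nat) (x : X) : R :=
  \sum_(k < n) f (iter k T x).

(* E(e^{i theta Y}), by its real and imaginary parts. *)
Definition char_fun d (W : measurableType d) (R : realType)
    (P : probability W R) (Y : W -> R) (theta : R) : R[i] :=
  Complex (fine ('E_P[fun w => cos (theta * Y w)])%E)
          (fine ('E_P[fun w => sin (theta * Y w)])%E).

Definition SaS d (W : measurableType d) (R : realType) (P : probability W R)
    (alpha sigma : R) (Y : {RV P >-> R}) : Prop :=
  forall theta : R,
    char_fun P Y theta =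
      (expR (- (sigma `^ alpha * `|theta| `^ alpha)))%:C%C.

(* Weak convergence of the laws; the variables Y_ n and Y may live on different
   probability spaces. *)
Definition cvg_in_distribution d (X : measurableType d) d' (W : measurableType d')
    (R : realType) (m : probability X R) (P : probability W R)
    (Y_ : nat -> X -> R) (Y : W -> R) : Prop :=
  forall g : R -> R, continuous g -> bounded_fun g ->
    ('E_m[g \o Y_ n])%E @[n --> \oo] --> ('E_P[g \o Y])%E.

(* Main.v *)
(* The function is f = sum_k v_k (1_{E_k} - 1_{E_k} o T^{d_k}), where E_k has
   measure about p_k ~ k^{-2}, v_k = c (k+1)^{1/alpha} and d_k = (k+1)^2.  The
   sets E_k are chosen one after the other so that the joint law of the
   indicators of T^{-i} E_k, for K <= k < N and i < 2 d_k, is dominated by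
   1 + 1/(K+1) times the law of independent Bernoulli(p_k) variables; each E_k is
   found by labelling at random the cells of a fine partition, which works since
   an aperiodic system has almost no recurrence at a fine scale.

   In S_n f the terms with d_k < n telescope into a boundary term that is
   negligible after normalization.  In the terms with d_k >= n the two copies of
   E_k do not overlap, so the characteristic function of their normalized sum is
   close to prod_k (1 - 2 p_k (1 - p_k) (1 - cos (theta v_k n^{-1/alpha})))^n.
   A Riemann sum argument shows that it tends to
   exp (-2 (c |theta|)^alpha int_0^oo (1 - cos (s^{-1/alpha})) ds), and c is chosen
   to give sigma.  The normalized sums are tight, and the limit law is obtained
   from Levy's continuity theorem. *)
Require Import Defs.
From HB Require Import structures.
From mathcomp Require Import all_boot all_order all_algebra.
From mathcomp Require Import all_classical all_reals all_analysis.
From mathcomp Require Import measurable_realfun complex ring lra zify.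

Set Implicit Arguments.
Unset Strict Implicit.
Unset Printing Implicit Defensive.

Import Order.TTheory GRing.Theory Num.Theory.
Import numFieldNormedType.Exports.

Local Open Scope classical_set_scope.
Local Open Scope ring_scope.

(** * Bernoulli products and random labellings *)

(** An aperiodic system may have zero entropy, so exact independence along whole orbits is out of
    reach: each E_k can be made almost Bernoulli only over a finite window of times. The lag in f
    answers this. If d_k < n, the telescoped sum involves only d_k visits at each end of the orbit;
    if d_k >= n, both windows of length n fit into 2 d_k times. So a window of length 2 d_k suffices
    for every n. The opposite signs of the two copies also make the limit symmetric and remove any
    centering.

    The domination is one-sided and multiplicative. Relative errors multiply along the recursive
    choice of the sets, and upper bounds for means of nonnegative functions are enough: second
    moments are of this kind, and the characteristic function is reached through 1 + cos and 1 -
    cos.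

    The lags are quadratic so that only about sqrt n of them lie below n, which makes the boundary
    term small. The condition alpha < 2 makes the variance of the jumps up to a given size governed
    by the largest of them, and makes the integral in the exponent converge. *)

Section bernoulli_product.
Variables (R : realFieldType) (I : finType) (p : I -> R).
Implicit Types (G H : {ffun I -> bool} -> R).

Definition bern (q : R) (b : bool) : R := if b then q else 1 - q.

Definition bern_weight (b : {ffun I -> bool}) : R := \prod_i bern (p i) (b i).

Definition bern_mean G : R := \sum_b bern_weight b * G b.

Lemma bern_mean_prod (F : I -> bool -> R) :
  bern_mean (fun b => \prod_i F i (b i)) =
  \prod_i (p i * F i true + (1 - p i) * F i false).
Proof.
under [RHS]eq_bigr => i _.
  rewrite (_ : _ + _ = \sum_(e : bool) bern (p i) e * F i e); last first.
    by rewrite big_bool.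
  over.
by rewrite bigA_distr_bigA; apply: eq_bigr => b _; rewrite -big_split.
Qed.

Lemma bern_mean_sum (J : Type) (s : seq J) (P : pred J)
    (G : J -> {ffun I -> bool} -> R) :
  bern_mean (fun b => \sum_(j <- s | P j) G j b) = \sum_(j <- s | P j) bern_mean (G j).
Proof.
rewrite /bern_mean exchange_big /=; apply: eq_bigr => b _.
by rewrite mulr_sumr.
Qed.

Lemma bern_meanZ (a : R) G : bern_mean (fun b => a * G b) = a * bern_mean G.
Proof. by rewrite /bern_mean mulr_sumr; apply: eq_bigr => b _; rewrite mulrCA. Qed.

Lemma bern_meanD G H : bern_mean (fun b => G b + H b) = bern_mean G + bern_mean H.
Proof. by rewrite /bern_mean -big_split; apply: eq_bigr => b _; rewrite mulrDr. Qed.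

Lemma sum_bern_weight : \sum_b bern_weight b = 1.
Proof.
transitivity (bern_mean (fun b => \prod_(i : I) 1)).
  by apply: eq_bigr => b _; rewrite big1// mulr1.
rewrite (bern_mean_prod (fun _ _ => 1)) big1// => i _.
by rewrite !mulr1 addrC subrK.
Qed.

Lemma bern_mean_cst (a : R) : bern_mean (fun=> a) = a.
Proof. by rewrite /bern_mean -mulr_suml sum_bern_weight mul1r. Qed.

(** Independence of distinct coordinates: after regrouping the factors by coordinate this is
    [bern_mean_prod], and a coordinate outside the image of [g] contributes
    [p i + (1 - p i) = 1]. *)
Lemma bern_mean_injective (J : finType) (g : J -> I) (F : J -> bool -> R) :
  injective g ->
  bern_mean (fun b => \prod_j F j (b (g j))) =
  \prod_j (p (g j) * F j true + (1 - p (g j)) * F j false).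
Proof.
move=> gI.
pose F' i (e : bool) := \prod_(j | g j == i) F j e.
have fib (H : J -> I -> R) : \prod_j H j (g j) = \prod_i \prod_(j | g j == i) H j i.
  rewrite (partition_big g xpredT)//=; apply: eq_bigr => i _.
  by apply: eq_bigr => j /eqP ->.
transitivity (bern_mean (fun b => \prod_i F' i (b i))).
  apply: eq_bigr => b _; congr (_ * _).
  exact: (fib (fun j i => F j (b i))).
rewrite bern_mean_prod.
rewrite (fib (fun j i => p i * F j true + (1 - p i) * F j false)).
apply: eq_bigr => i _; rewrite /F'.
case: (pickP (fun j => g j == i)) => [j /eqP <-|h]; last first.
  by rewrite !big_pred0// !mulr1 addrC subrK.
have e j' : (g j' == g j) = (j' == j) by rewrite (inj_eq gI).
by rewrite !(eq_bigl _ _ e) !big_pred1_eq.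
Qed.

Hypothesis p01 : forall i, 0 <= p i <= 1.

Lemma bern_weight_ge0 b : 0 <= bern_weight b.
Proof.
apply: prodr_ge0 => i _; have /andP[? ?] := p01 i.
by rewrite /bern; case: ifP => _ //; rewrite subr_ge0.
Qed.

Lemma ler_bern_mean G H : (forall b, G b <= H b) -> bern_mean G <= bern_mean H.
Proof. by move=> GH; apply: ler_sum => b _; rewrite ler_wpM2l// bern_weight_ge0. Qed.

Lemma ler_norm_bern_mean G : `|bern_mean G| <= bern_mean (fun b => `|G b|).
Proof.
apply: (le_trans (ler_norm_sum _ _ _)); apply: ler_sum => b _.
by rewrite normrM (ger0_norm (bern_weight_ge0 b)).
Qed.

Lemma bern_mean_cov (i j : I) : i != j ->
  bern_mean (fun b => ((b i)%:R - p i) * ((b j)%:R - p j)) = 0.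
Proof.
move=> ij.
have gI : injective (fun e : bool => if e then i else j).
  by move=> [] [] //= eij; move: ij; rewrite eij eqxx.
have := bern_mean_injective (fun e b => b%:R - p (if e then i else j)) gI.
rewrite big_bool/= (_ : _ * _ = 0); last by rewrite mulr0n mulr1n; ring.
by move=> <-; apply: eq_bigr => b _; rewrite big_bool.
Qed.

Lemma bern_mean_var1 (i : I) :
  bern_mean (fun b => ((b i)%:R - p i) ^+ 2) = p i * (1 - p i).
Proof.
have gI : injective (fun e : unit => i) by case=> -[].
have := bern_mean_injective (fun (e : unit) b => (b%:R - p i) ^+ 2) gI.
have u1 (F : unit -> R) : \prod_j F j = F tt.
  by rewrite (big_pred1 tt)//; case.
rewrite u1 (_ : _ + _ = p i * (1 - p i)); last by rewrite mulr0n mulr1n; ring.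
by move=> <-; apply: eq_bigr => b _; rewrite u1.
Qed.

Lemma bern_mean_var (c : I -> R) :
  bern_mean (fun b => (\sum_i c i * ((b i)%:R - p i)) ^+ 2) =
  \sum_i c i ^+ 2 * (p i * (1 - p i)).
Proof.
transitivity (\sum_i \sum_j c i * c j *
    bern_mean (fun b => ((b i)%:R - p i) * ((b j)%:R - p j))).
  under [RHS]eq_bigr do under eq_bigr do rewrite -bern_meanZ.
  under [RHS]eq_bigr do rewrite -bern_mean_sum.
  rewrite -bern_mean_sum; apply: eq_bigr => b _; congr (_ * _).
  rewrite expr2 mulr_suml; apply: eq_bigr => i _; rewrite mulr_sumr.
  by apply: eq_bigr => j _; ring.
apply: eq_bigr => i _; rewrite (bigD1 i)//= big1 => [|j ji].
  by rewrite addr0 -expr2; congr (_ * _); rewrite -bern_mean_var1.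
by rewrite bern_mean_cov ?mulr0// eq_sym.
Qed.

End bernoulli_product.

(* The second moment over a random labelling [v] of the cells: two words of
   cells without any repetition are labelled independently, so only the pairs
   of words with a repetition contribute. *)
Section random_labelling.
Variables (R : realFieldType) (C Q : finType) (L : nat) (p : R).
Hypothesis p01 : 0 <= p <= 1.

Let bern01 e : 0 <= bern p e <= 1.
Proof. by have /andP[? ?] := p01; case: e => /=; apply/andP; split; lra. Qed.

Local Notation word := {ffun 'I_L -> C}.

Definition word_pair (g h : word) (u : 'I_L + 'I_L) : C :=
  match u with inl i => g i | inr i => h i end.

Definition label_prob (s : {ffun 'I_L -> bool}) : R := \prod_i bern p (s i).

Definition labelled (g : word) (s : {ffun 'I_L -> bool}) (v : {ffun C -> bool}) : bool :=
  [forall i, v (g i) == s i].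

Let labelledE g s v : (labelled g s v)%:R = \prod_i (v (g i) == s i)%:R :> R.
Proof.
rewrite /labelled; case: forallP => h.
  by rewrite big1// => i _; rewrite h.
have /existsP[i ni] : [exists i, v (g i) != s i].
  by rewrite -negb_forall; apply/negP => /forallP.
by rewrite (bigD1 i)//= (negbTE ni) mul0r.
Qed.

Let factor (e : bool) :
  p * (true == e)%:R + (1 - p) * (false == e)%:R = bern p e :> R.
Proof. by case: e; rewrite /bern/= ?mulr0 ?mulr1 ?add0r ?addr0. Qed.

Lemma label_prob_ge0 s : 0 <= label_prob s.
Proof.
by apply: prodr_ge0 => i _; have /andP[] := bern01 (s i).
Qed.

Lemma label_prob_le1 s : label_prob s <= 1.
Proof.
by apply: prodr_ile1 => i _; exact: bern01.
Qed.

Lemma mean_labelled (g : word) s : injective g ->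
  bern_mean (fun=> p) (fun v => (labelled g s v)%:R) = label_prob s.
Proof.
move=> gI; transitivity (bern_mean (fun=> p)
    (fun v : {ffun C -> bool} => \prod_i (v (g i) == s i)%:R)).
  by apply: eq_bigr => v _; rewrite labelledE.
rewrite (bern_mean_injective _ (fun i e => (e == s i)%:R) gI).
by apply: eq_bigr => i _; rewrite factor.
Qed.

Lemma mean_labelled2 (g h : word) s : injective (word_pair g h) ->
  bern_mean (fun=> p) (fun v => (labelled g s v)%:R * (labelled h s v)%:R) =
  label_prob s ^+ 2.
Proof.
move=> gI; transitivity (bern_mean (fun=> p) (fun v : {ffun C -> bool} =>
    \prod_u (v (word_pair g h u) == s (match u with inl i => i | inr i => i end))%:R)).
  by apply: eq_bigr => v _; rewrite !labelledE big_sumType.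
rewrite (bern_mean_injective _
  (fun u e => (e == s (match u with inl i => i | inr i => i end))%:R) gI).
by rewrite big_sumType/= expr2; congr (_ * _); apply: eq_bigr => i _; rewrite factor.
Qed.

Lemma cov_labelled (g h : word) s : injective (word_pair g h) ->
  bern_mean (fun=> p) (fun v => ((labelled g s v)%:R - label_prob s) *
    ((labelled h s v)%:R - label_prob s)) = 0.
Proof.
move=> ghI.
have gI : injective g by move=> i j e; have [] := ghI (inl i) (inl j) e.
have hI : injective h by move=> i j e; have [] := ghI (inr i) (inr j) e.
transitivity (bern_mean (fun=> p) (fun v =>
    (labelled g s v)%:R * (labelled h s v)%:R +
    ((- label_prob s) * (labelled g s v)%:R +
     ((- label_prob s) * (labelled h s v)%:R + label_prob s ^+ 2)))).
  by apply: eq_bigr => v _; congr (_ * _); ring.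
rewrite !bern_meanD !bern_meanZ bern_mean_cst !mean_labelled// mean_labelled2//.
ring.
Qed.

Lemma cov_labelled_le1 g h s :
  bern_mean (fun=> p) (fun v => ((labelled g s v)%:R - label_prob s) *
    ((labelled h s v)%:R - label_prob s)) <= 1.
Proof.
rewrite -[leRHS](bern_mean_cst (fun _ : C => p)); apply: ler_bern_mean => // v.
have [l0 l1] := (label_prob_ge0 s, label_prob_le1 s).
by case: labelled; case: labelled; rewrite ?mulr1n ?mulr0n; nra.
Qed.

Variables (a : Q -> word -> R) (mu : word -> R).
Hypothesis a_ge0 : forall q g, 0 <= a q g.
Hypothesis a_le : forall q g, a q g <= mu g.

(** In the application [mu g] is the mass of the points with cell word [g] and [a q g] the part of
    it inside [A q]. This is then the chance that the words of two independent points contain some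
    cell twice. *)
Definition bad_mass : R :=
  \sum_g \sum_(h | ~~ injectiveb (word_pair g h)) mu g * mu h.

(** The squared deviations, summed over all [q] and [s], have mean at most [#|Q| * 2 ^ L * bad_mass]
    over the random labelling. Some labelling does no worse than the mean, and it then bounds every
    single deviation. *)
Lemma exists_labelling (tau : R) : 0 < tau ->
  #|Q|%:R * (2 ^ L)%:R * bad_mass <= tau ^+ 2 ->
  exists v : {ffun C -> bool}, forall q s,
    `|\sum_g a q g * (labelled g s v)%:R - (\sum_g a q g) * label_prob s| <= tau.
Proof.
move=> tau0 small.
pose dev q s v := \sum_g a q g * ((labelled g s v)%:R - label_prob s).
have devE q s v : dev q s v =
    \sum_g a q g * (labelled g s v)%:R - (\sum_g a q g) * label_prob s.
  rewrite mulr_suml -sumrB; apply: eq_bigr => g _; exact: mulrBr.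
pose tot v := \sum_q \sum_s dev q s v ^+ 2.
have tot_le : bern_mean (fun=> p) tot <= tau ^+ 2.
  apply: le_trans small.
  rewrite /tot bern_mean_sum; under eq_bigr do rewrite bern_mean_sum.
  rewrite (_ : #|Q|%:R * (2 ^ L)%:R * bad_mass =
    \sum_(q : Q) \sum_(s : {ffun 'I_L -> bool}) bad_mass); last first.
    rewrite !sumr_const card_ffun card_bool card_ord -mulrnA -[RHS]mulr_natl.
    by rewrite natrM [X in X * _ = _]mulrC.
  apply: ler_sum => q _; apply: ler_sum => s _.
  rewrite (_ : bern_mean _ _ = \sum_g \sum_h a q g * a q h *
     bern_mean (fun=> p) (fun v => ((labelled g s v)%:R - label_prob s) *
    ((labelled h s v)%:R - label_prob s))); last first.
    under [RHS]eq_bigr do under eq_bigr do rewrite -bern_meanZ.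
    under [RHS]eq_bigr do rewrite -bern_mean_sum.
    rewrite -bern_mean_sum; apply: eq_bigr => v _; congr (_ * _).
    rewrite expr2 mulr_suml; apply: eq_bigr => g _; rewrite mulr_sumr.
    by apply: eq_bigr => h _; ring.
  apply: ler_sum => g _; rewrite [leRHS]big_mkcond/=; apply: ler_sum => h _.
  case: ifPn => [bad|/negPn/injectiveP gh]; last by rewrite cov_labelled ?mulr0.
  apply: (@le_trans _ _ (a q g * a q h * 1)).
    by rewrite ler_wpM2l// ?mulr_ge0// cov_labelled_le1.
  by rewrite mulr1 ler_pM.
have [v tv] : exists v, tot v <= tau ^+ 2.
  have [/existsP[v ?]|/existsPn h] := boolP [exists v, tot v <= tau ^+ 2].
    by exists v.
  have w0 v : 0 <= bern_weight (fun=> p) v by exact: bern_weight_ge0.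
  have lt v : tau ^+ 2 < tot v by rewrite ltNge h.
  (* Weights may vanish when [p] is 0 or 1, so a labelling of positive weight is needed to make the
     comparison of means strict. *)
  have [v wv] : exists v, 0 < bern_weight (fun _ : C => p) v.
    have [/existsP[v ?]|/existsPn g] :=
        boolP [exists v, 0 < bern_weight (fun _ : C => p) v]; first by exists v.
    have := sum_bern_weight (fun _ : C => p); rewrite big1 => [/esym/eqP|v _].
      by rewrite oner_eq0.
    by apply: le_anti; rewrite w0 leNgt g.
  have : tau ^+ 2 < bern_mean (fun=> p) tot.
    rewrite -[ltLHS](bern_mean_cst (fun _ : C => p)) /bern_mean.
    rewrite (bigD1 v)//= [ltRHS](bigD1 v)//= ltr_leD ?ltr_pM2l//.
    by apply: ler_sum => u _; rewrite ler_wpM2l// ltW.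
  by rewrite ltNge tot_le.
exists v => q s; rewrite -devE -ler_sqr ?nnegrE// ?(ltW tau0)// -normrX ger0_norm ?sqr_ge0//.
apply: le_trans tv; rewrite /tot (bigD1 q)//= (bigD1 s)//= -addrA lerDl addr_ge0//.
  by apply: sumr_ge0 => ? _; exact: sqr_ge0.
by apply: sumr_ge0 => ? _; apply: sumr_ge0 => ? _; exact: sqr_ge0.
Qed.

End random_labelling.

(** * Copying independence inside an aperiodic system *)

Section probability_toolbox.
Context (R : realType) (d : measure_display) (X : measurableType d)
  (m : probability X R).

Definition mass (A : set X) : R := fine (m A).

Lemma massE A : measurable A -> m A = (mass A)%:E.
Proof. by move=> mA; rewrite fineK// fin_num_measure. Qed.

Lemma mass_ge0 A : 0 <= mass A.
Proof. by rewrite fine_ge0. Qed.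

Lemma massT : mass setT = 1.
Proof. by rewrite /mass probability_setT. Qed.

Lemma mass0 : mass set0 = 0.
Proof. by rewrite /mass measure0. Qed.

Lemma le_mass A B : measurable A -> measurable B -> A `<=` B -> mass A <= mass B.
Proof.
by move=> mA mB AB; rewrite fine_le ?fin_num_measure// le_measure ?inE.
Qed.

Lemma mass_le1 A : measurable A -> mass A <= 1.
Proof. by move=> mA; rewrite -massT le_mass. Qed.

Lemma massU2 A B : measurable A -> measurable B ->
  mass (A `|` B) <= mass A + mass B.
Proof.
move=> mA mB; rewrite -lee_fin EFinD -!massE//; last exact: measurableU.
exact: measureU2.
Qed.

Lemma bounded_integrable (f : X -> R) (K : R) : measurable_fun setT f ->
  (forall x, `|f x| <= K) -> m.-integrable setT (EFin \o f).
Proof.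
move=> mf fK; apply: measurable_bounded_integrable => //.
  by rewrite (le_lt_trans (probability_le1 _ _))// ltry.
by exists K; split; [exact: num_real|move=> M KM x _; exact: le_trans (ltW KM)].
Qed.

Lemma Rintegral_indic (A : set X) : measurable A ->
  \int[m]_x \1_A x = mass A.
Proof. by move=> mA; rewrite /Rintegral integral_indic// setIT. Qed.

Lemma Rintegral_cst_prob (c : R) : \int[m]_x c = c.
Proof. by rewrite Rintegral_cst// [X in fine X]probability_setT mulr1. Qed.

Section finite_valued.
Context (W : finType) (w : X -> W).
Hypothesis mw : forall b, measurable (w @^-1` [set b]).

Lemma measurable_preimage_fin (P : set W) : measurable (w @^-1` P).
Proof.
rewrite (_ : _ @^-1` _ = \bigcup_(b in P) w @^-1` [set b]).
  by apply: fin_bigcup_measurable.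
by apply/seteqP; split => [x Px|x [b Pb wb]]; [exists (w x)|rewrite /= wb].
Qed.

Lemma measurable_fin_fun (G : W -> R) : measurable_fun setT (G \o w).
Proof.
by move=> _ Y _; rewrite setTI comp_preimage; exact: measurable_preimage_fin.
Qed.

Lemma fin_fun_bounded (G : W -> R) x : `|G (w x)| <= \sum_b `|G b|.
Proof. by rewrite (bigD1 (w x))//= lerDl sumr_ge0. Qed.

Lemma Rintegral_fin (G : W -> R) :
  \int[m]_x G (w x) = \sum_b G b * mass (w @^-1` [set b]).
Proof.
have e x : (G (w x))%:E = (\sum_b (G b)%:E * (\1_(w @^-1` [set b]) x)%:E)%E.
  rewrite (bigD1 (w x))//= indicE mem_set// mule1 big1 ?adde0// => b bw.
  by rewrite indicE memNset ?mule0//= => wb; rewrite wb eqxx in bw.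
rewrite /Rintegral; under eq_integral do rewrite e.
rewrite integral_sum//; last first.
  move=> b; apply: integrableZl => //; exact: integrable_indic.
rewrite [LHS](_ : _ = fine (\sum_b (G b * mass (w @^-1` [set b]))%:E)%E).
  by rewrite sumEFin.
congr fine; apply: eq_bigr => b _.
rewrite integralZl//; last exact: integrable_indic.
by rewrite integral_indic// setIT EFinM -massE.
Qed.

End finite_valued.

Lemma mass_fin (W : finType) (w : X -> W) (A : set X) (P : pred W) :
  (forall b, measurable (w @^-1` [set b])) -> measurable A ->
  mass (A `&` [set x | P (w x)]) =
  \sum_b mass (A `&` w @^-1` [set b]) * (P b)%:R.
Proof.
move=> mw mA.
(* Recording membership in [A] as one more bit turns the intersection into an event of a single
   finite-valued function. *)
pose w' x := (`[< A x >], w x).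
have fibT b : w' @^-1` [set (true, b)] = A `&` w @^-1` [set b].
  apply/seteqP; rewrite /w'; split => [x [/asboolP Ax wb]|x [/asboolP Ax <-]].
    by split.
  by rewrite /= Ax.
have fibF b : w' @^-1` [set (false, b)] = ~` A `&` w @^-1` [set b].
  apply/seteqP; rewrite /w'; split => [x [/asboolPn Ax wb]|x [/asboolPn Ax <-]].
    by split.
  by rewrite /= (negbTE Ax).
have mw' b : measurable (w' @^-1` [set b]).
  case: b => -[] b; rewrite ?fibT ?fibF; apply: measurableI => //.
  exact: measurableC.
have mP : measurable (A `&` [set x | P (w x)]).
  by apply: measurableI => //; exact: (measurable_preimage_fin mw [set b | P b]).
rewrite -Rintegral_indic//.
have -> : \int[m]_x \1_(A `&` [set x | P (w x)]) x =
    \int[m]_x (fun b => (b.1 && P b.2)%:R) (w' x).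
  apply: eq_Rintegral => x _ /=; rewrite indicE; congr (_%:R).
  by rewrite in_setI; congr (_ && _) => //; rewrite ?in_setE ?mem_setE; apply/idP/idP; rewrite ?inE.
rewrite (Rintegral_fin mw' (fun b => (b.1 && P b.2)%:R)).
transitivity (\sum_(e : bool) \sum_b (e && P b)%:R * mass (w' @^-1` [set (e, b)])).
  by rewrite pair_bigA; apply: eq_bigr => -[].
rewrite big_bool/= [X in _ + X]big1 => [|b _]; last by rewrite mul0r.
by rewrite addr0; apply: eq_bigr => b _; rewrite mulrC fibT.
Qed.

End probability_toolbox.

(** Interiors of balls of radius [1 / (k + 1)] around a countable dense set separate points. They
    are open, hence measurable under either convention of [standard_probability_space]; in the
    completed case the null set is empty. *)
Lemma standard_separating (R : realType) (d : measure_display)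
    (X : measurableType d) (m : probability X R) :
  standard_probability_space m ->
  exists C : nat -> set X, (forall j, measurable (C j)) /\
    (forall x y, (forall j, C j x <-> C j y) -> x = y).
Proof.
move=> [P [h [[hsd [D [/countable_injP[f fI] dD]]] bh mX]]].
pose r (k : nat) : R := k.+1%:R^-1.
have r0 k : 0 < r k by rewrite invr_gt0.
(* Countability of [D] is an injection [f] of [D] into [nat]: the union has at most one member, and
   none if no point of [D] has code [nk.1]. *)
pose U (nk : nat * nat) : set P :=
  \bigcup_(e in [set e | D e /\ f e = nk.1]) (ball e (r nk.2))^°.
have oU nk : open (U nk) by apply: bigcup_open => e _; exact: open_interior.
pose nk (j : nat) : nat * nat := odflt (0%N, 0%N) (unpickle j).
exists (fun j => h @^-1` U (nk j)); split => [j|x y xy].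
  have B : [set h @^-1` B | B in <<s @open P >>] (h @^-1` U (nk j)).
    by exists (U (nk j)) => //; apply: sub_gen_smallest; exact: oU.
  case: mX => ->//.
  exists (h @^-1` U (nk j)), set0; split => //.
    exists set0; last by rewrite preimage_set0.
    by apply: sub_gen_smallest; exact: open0.
apply: (bij_inj bh); apply: contrapT => /eqP hxy.
move: hsd; rewrite open_hausdorff => /(_ _ _ hxy).
move=> [[A B] /= [Ax By] [oA oB /eqP AB]].
rewrite !inE in Ax By.
have [e /= e0 eA] : exists2 e : R, 0 < e & ball (h x) e `<=` A.
  have /nbhs_ballP[e /= e0 eA] := open_nbhs_nbhs (conj oA Ax).
  by exists e.
have [k rk] : exists k, r k < e / 2.
  exists (Num.truncn (e / 2)^-1); rewrite /r invf_plt ?posrE ?ltr0n ?divr_gt0//.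
  by rewrite truncnS_gt.
have r2 : 0 < r k / 2 by rewrite divr_gt0.
(* With [z] within [r k / 2] of [h x], the set [U (f z, k)] contains [h x] and stays within
   [3 r k / 2 < e] of it. So it would also put [h y] into [A], which is disjoint from [B]. *)
have [z [/interior_subset zx Dz]] : (ball (h x) (r k / 2))^° `&` D !=set0.
  apply: dD; last exact: open_interior.
  by exists (h x); exact: nbhsx_ballx.
have xz : (ball z (r k))^° (h x).
  apply/nbhs_ballP; exists (r k / 2) => //= w xw.
  rewrite [r k]splitr; apply: ball_triangle xw; exact: ball_sym.
have /(_ (pickle (f z : nat, k))) := xy; rewrite /nk pickleK/=.
move=> -[/(_ (ex_intro2 _ _ z (conj Dz erefl) xz)) [z' [Dz' fz'] /interior_subset z'y] _].
have zz' : z' = z by apply: fI; rewrite ?inE.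
move: z'y; rewrite zz' => zy.
have /eA Ay : ball (h x) e (h y).
  apply: (@le_ball _ _ _ (r k / 2 + r k)); last exact: ball_triangle zx zy.
  by have := r0 k; lra.
by have : (A `&` B) (h y) by []; rewrite AB.
Qed.

Lemma measurable_fiber_ffun (d : measure_display) (X : measurableType d)
    (I W : finType) (w : I -> X -> W) :
  (forall i b, measurable (w i @^-1` [set b])) ->
  forall g, measurable ((fun x => [ffun i => w i x]) @^-1` [set g]).
Proof.
move=> mw g; rewrite (_ : _ @^-1` _ = \bigcap_(i in setT) (w i @^-1` [set g i])).
  by apply: fin_bigcap_measurable.
apply/seteqP; split => [x /= <- i _|x xg]; first by rewrite /= ffunE.
by apply/ffunP => i; rewrite ffunE; exact: xg.
Qed.

Lemma measurable_fiber_bool (d : measure_display) (X : measurableType d)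
    (A : set X) (b : bool) :
  measurable A -> measurable ((fun x => `[< A x >]) @^-1` [set b]).
Proof.
move=> mA; case: b.
  rewrite (_ : _ @^-1` _ = A)//; apply/seteqP; split => x /=.
    by move=> /asboolP.
  by move=> Ax; apply/asboolP.
rewrite (_ : _ @^-1` _ = ~` A); first exact: measurableC.
apply/seteqP; split => x /=; first by move=> /asboolPn.
by move=> nAx; apply/asboolPn.
Qed.

(** * Fine partitions of an aperiodic system and the copying lemma *)

Section copying.
Context (R : realType) (d : measure_display) (X : measurableType d)
  (m : probability X R) (T : X -> X).
Hypotheses (hT : measure_preserving m T) (haper : aperiodic m T).
Variable C : nat -> set X.
Hypothesis mC : forall j, measurable (C j).
Hypothesis sepC : forall x y, (forall j, C j x <-> C j y) -> x = y.

Lemma measurable_iter i : measurable_fun setT (iter i T).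
Proof.
elim: i => [|i ih]; first exact: measurable_id.
rewrite (_ : iter _ _ = T \o iter i T)//; apply: measurableT_comp => //.
exact: hT.1.
Qed.

Lemma measurable_preimage_iter i A : measurable A -> measurable (iter i T @^-1` A).
Proof. by move=> mA; rewrite -[X in measurable X]setTI; exact: measurable_iter. Qed.

Lemma measure_iter i A : measurable A -> m (iter i T @^-1` A) = m A.
Proof.
elim: i A => [//|i ih] A mA.
rewrite -[RHS](hT.2 _ mA) -[RHS]ih//.
by rewrite -[X in measurable X]setTI; exact: hT.1.
Qed.

Lemma mass_iter i A : measurable A -> mass m (iter i T @^-1` A) = mass m A.
Proof. by move=> mA; rewrite /mass measure_iter. Qed.

Lemma measurable_point (x : X) : measurable [set x].
Proof.
rewrite (_ : [set x] = \bigcap_(j in setT) (if `[< C j x >] then C j else ~` C j)).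
  apply: bigcap_measurable => [|j _]; first by exists 0%N.
  by case: ifP => _ //; exact: measurableC.
apply/seteqP; split => [y -> j _|y h].
  by case: ifPn => [/asboolP|/asboolPn].
by apply: sepC => j; have := h j I; case: ifPn => [/asboolP|/asboolPn] /=.
Qed.

(** An atom moves to points of at least its own mass, since [x] lies in the preimage of
    [iter n T x]. Its orbit never repeats, as a repeated point would be periodic and hence null; but
    infinitely many points of that mass do not fit into total mass 1. *)
Lemma measure_point x : m [set x] = 0%E.
Proof.
apply/eqP/negPn/negP => nz.
have x0 : 0 < mass m [set x].
  rewrite lt0r mass_ge0 andbT; apply: contra nz => /eqP e.
  by rewrite (massE _ (measurable_point x)) e.
have up n : mass m [set x] <= mass m [set iter n T x].
  have mn := measurable_point (iter n T x).
  rewrite -(mass_iter n mn); apply: le_mass; first exact: measurable_point.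
    exact: measurable_preimage_iter.
  by move=> y ->.
have inj : injective (fun n => iter n T x).
  have per i k : iter (i + k.+1) T x = iter i T x -> False.
    rewrite addnC iterD => e.
    have [N [mN N0 /(_ (iter i T x)) pN]] := haper.
    have := up i; rewrite leNgt => /negP; apply.
    apply: le_lt_trans x0.
    rewrite -[leRHS](_ : mass m N = 0); last by rewrite /mass N0.
    apply: le_mass => //; first exact: measurable_point.
    by move=> y ->; apply: pN; exists k.+1.
  move=> i j /= e; case: (ltngtP i j) => // ij; exfalso.
    by apply: (per i (j - i.+1)%N); rewrite e; congr (iter _ T x); lia.
  by apply: (per j (i - j.+1)%N); rewrite -e; congr (iter _ T x); lia.
pose N := Num.truncn (mass m [set x])^-1.
have : mass m (\big[setU/set0]_(i < N.+1) [set iter i T x]) <= 1.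
  by apply: mass_le1; apply: bigsetU_measurable => i _; exact: measurable_point.
rewrite /mass measure_bigsetU_ord; last 2 first.
- by move=> i; exact: measurable_point.
- move=> i j _ _ [y [/= -> /inj]]; exact: val_inj.
rewrite (_ : (\sum_(i < N.+1) _)%E = (\sum_(i < N.+1) mass m [set iter i T x])%:E); last first.
  by rewrite -sumEFin; apply: eq_bigr => i _; rewrite -massE//; exact: measurable_point.
rewrite /= leNgt => /negP; apply.
apply: (@lt_le_trans _ _ (\sum_(i < N.+1) mass m [set x])); last by apply: ler_sum.
rewrite sumr_const card_ord -mulr_natl -ltr_pdivrMr// div1r.
by rewrite truncnS_gt.
Qed.

(** The partition generated by the first [r] sets [C j], with its cells named by bit vectors; some
    vectors may name an empty cell. *)
Definition cell r (x : X) : {ffun 'I_r -> bool} := [ffun j : 'I_r => `[< C j x >]].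

Definition cell_word r L (x : X) : {ffun 'I_L -> {ffun 'I_r -> bool}} :=
  [ffun i : 'I_L => cell r (iter i T x)].

Lemma measurable_cell r c : measurable (@cell r @^-1` [set c]).
Proof. by apply: measurable_fiber_ffun => j b; exact: measurable_fiber_bool. Qed.

Lemma measurable_cell_word r L g : measurable (@cell_word r L @^-1` [set g]).
Proof.
apply: measurable_fiber_ffun => i c.
exact: (measurable_preimage_iter i (measurable_cell c)).
Qed.

Lemma cell_separates (x y : X) : x != y ->
  exists r0, forall r, (r0 <= r)%N -> cell r x != cell r y.
Proof.
move=> xy; have [j nj] : exists j, ~ (C j x <-> C j y).
  by apply/existsNP => h; move/eqP: xy; apply; exact: sepC.
exists j.+1 => r jr; apply/eqP => /ffunP/(_ (Ordinal jr)); rewrite !ffunE /= => e.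
by apply: nj; split => /asboolP h; apply/asboolP; rewrite ?e// -e.
Qed.

(** The sum is the integral over [x] of the mass of the cell containing [x]. These cells decrease to
    the null set [[set x]], and dominated convergence applies. Thus two independent points rarely
    share a cell. *)
Lemma cell_collision_cvg0 :
  (fun r => \sum_(c : {ffun 'I_r -> bool}) mass m (@cell r @^-1` [set c]) ^+ 2)
    @ \oo --> (0 : R).
Proof.
pose G r (c : {ffun 'I_r -> bool}) := mass m (@cell r @^-1` [set c]).
rewrite (_ : (fun r => _) = (fun r => \int[m]_x G r (cell r x))); last first.
  apply/funext => r; rewrite (Rintegral_fin _ (@measurable_cell r)).
  by apply: eq_bigr => c _; rewrite expr2.
have G1 r c : `|G r c| <= 1.
  by rewrite ger0_norm ?mass_ge0//; apply: mass_le1; exact: measurable_cell.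
have mG r : measurable_fun setT (fun x => G r (cell r x)).
  exact: (measurable_fin_fun (@measurable_cell r)).
have pt x : (fun r => (G r (cell r x))%:E) @ \oo --> (0 : \bar R).
  have -> : (0 : \bar R) = m (\bigcap_r (@cell r @^-1` [set cell r x])).
    rewrite -[LHS](measure_point x); congr (m _); apply/seteqP.
    split => [y -> //|y h].
    apply: contrapT => /eqP /cell_separates[r0 /(_ r0 (leqnn _))].
    by rewrite (h r0 I) eqxx.
  rewrite (_ : (fun r => _) = m \o (fun r => @cell r @^-1` [set cell r x])); last first.
    by apply/funext => r; rewrite /= massE//; exact: measurable_cell.
  apply: nonincreasing_cvg_mu.
  - rewrite (le_lt_trans (probability_le1 _ _)) ?ltry//; exact: measurable_cell.
  - by move=> r; exact: measurable_cell.
  - by apply: bigcap_measurable => [|r _]; [exists 0%N|exact: measurable_cell].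
  - apply/nonincreasing_seqP => r; apply/subsetPset => y /= /ffunP e.
    apply/ffunP => j; have := e (widen_ord (leqnSn r) j).
    by rewrite !ffunE.
have [] := @dominated_convergence _ _ _ m setT measurableT
    (fun r x => (G r (cell r x))%:E) (cst 0%E) (cst 1%:E).
- by move=> r; apply/measurable_EFinP; exact: mG.
- exact: measurable_cst.
- by apply: aeW => x _; exact: pt.
- by apply: (@bounded_integrable _ _ _ m (cst 1) 1) => // x; rewrite normr1.
- by apply: aeW => x r _ /=; rewrite lee_fin.
move=> _ _; rewrite integral0 => h.
by apply: (@fine_cvg _ _ _ _ _ 0 h).
Qed.

(** The sets decrease in [r]. A point in all of them has two equal iterates among the first [L],
    because finitely many distinct points are separated by a fine enough partition; its orbit then
    meets the null set of periodic points. *)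
Lemma cell_recurrence_cvg0 L :
  (fun r => mass m [set x | ~~ injectiveb (cell_word r L x)]) @ \oo --> (0 : R).
Proof.
pose D r := [set x | ~~ injectiveb (cell_word r L x)].
have mD r : measurable (D r).
  exact: (measurable_preimage_fin (@measurable_cell_word r L) [set g | ~~ injectiveb g]).
have mD' : measurable (\bigcap_r D r).
  by apply: bigcap_measurable => [|r _]; [exists 0%N|].
have D0 : m (\bigcap_r D r) = 0%E.
  have [N [mN N0 pN]] := haper.
  apply: measure_negligible => //.
  apply: (@negligibleS _ _ _ _ (\bigcup_i (iter i T @^-1` N))).
    move=> x Dx.
    have [[i j] [/= ij e]] : exists ij : 'I_L * 'I_L,
        (ij.1 < ij.2)%N /\ iter ij.1 T x = iter ij.2 T x.
      apply: contrapT => h.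
      have sep (i j : 'I_L) : exists r0, i != j ->
          forall r, (r0 <= r)%N -> cell r (iter i T x) != cell r (iter j T x).
        case: (eqVneq i j) => [//|ij]; first by exists 0%N.
        have : iter i T x != iter j T x.
          apply/eqP => e; apply: h; move: ij; rewrite neq_ltn => /orP[] ij.
            by exists (i, j).
          by exists (j, i).
        by move=> /cell_separates[r0 hr]; exists r0.
      have [r0 hr0] := choice (fun ij : 'I_L * 'I_L => sep ij.1 ij.2).
      pose r := \max_ij r0 ij.
      have := Dx r I; rewrite /D /= => /negP; apply; apply/injectiveP => i j.
      rewrite !ffunE => e; apply/eqP/negPn/negP => ij.
      have := hr0 (i, j) ij r; rewrite e eqxx => /(_ _)/negP; apply => //.
      by apply: (leq_bigmax (i, j)).
    exists i => //=; apply: pN; exists (j - i)%N; split; first by rewrite subn_gt0.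
    by rewrite -iterD subnK// ltnW.
  apply: negligible_bigcup => i; exists (iter i T @^-1` N); split => //.
    exact: measurable_preimage_iter.
  exact: etrans (measure_iter i mN) N0.
have h : m \o D @ \oo --> m (\bigcap_r D r).
  apply: nonincreasing_cvg_mu => //.
    by rewrite (le_lt_trans (probability_le1 _ _)) ?ltry//; exact: mD.
  apply/nonincreasing_seqP => r; apply/subsetPset => y; rewrite /D /=.
  apply: contra => /injectiveP inj; apply/injectiveP => i j /ffunP e.
  apply: inj; rewrite !ffunE; apply/ffunP => k; have := e (widen_ord (leqnSn r) k).
  by rewrite !ffunE.
rewrite D0 in h; exact: (@fine_cvg _ _ _ _ _ 0 h).
Qed.

Definition pattern_set L (E : set X) (s : {ffun 'I_L -> bool}) : set X :=
  [set x | forall i : 'I_L, `[< E (iter i T x) >] = s i].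

(* [E] is a union of cells of a fine partition; the bound says that the pattern of
   visits to [E] is almost Bernoulli and independent of each [A q]. *)
Lemma copying_lemma (Q : finType) (A : Q -> set X) (L : nat) (p delta : R) :
  (forall q, measurable (A q)) -> 0 < p -> p < 1 -> 0 < delta ->
  exists E : set X, measurable E /\ forall q s,
    mass m (A q `&` pattern_set E s) <=
    (1 + delta) * (mass m (A q) * @label_prob R L p s).
Proof.
move=> mA p0 p1 delta0.
have p01 : 0 <= p <= 1 by rewrite !ltW.
(* A null [A q] counts as 1, which keeps the product in [tau] positive; this case is treated
   separately at the end. *)
pose mq q := if mass m (A q) == 0 then 1 else mass m (A q).
have mq01 q : 0 < mq q <= 1.
  rewrite /mq; case: eqVneq => [_|nz]; first by rewrite ltr01 lexx.
  by rewrite lt0r nz mass_ge0 mass_le1.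
(* An absolute error below [delta] times every nonzero target: the product of the [mq] is at most
   each factor, and each of the [L] factors of [label_prob] is at least [p * (1 - p)]. This turns
   the second moment bound into a relative one. *)
pose tau := delta * (\prod_q mq q * (p * (1 - p)) ^+ L).
have mqP : 0 < \prod_q mq q by apply: prodr_gt0 => q _; have /andP[] := mq01 q.
have q0 : 0 < p * (1 - p) by rewrite mulr_gt0// subr_gt0.
have tau0 : 0 < tau by rewrite !mulr_gt0// exprn_gt0.
have tau_le q s : mass m (A q) != 0 ->
    tau <= delta * (mass m (A q) * @label_prob R L p s).
  move=> nz; rewrite ler_pM2l// ler_pM//; [exact: ltW|by rewrite exprn_ge0// ltW| |].
    rewrite (bigD1 q)//= {1}/mq (negbTE nz) ler_piMr ?mass_ge0//.
    by apply: prodr_ile1 => r _; have /andP[/ltW -> ->] := mq01 r.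
  rewrite -{1}(card_ord L) -prodr_const; apply: ler_prod => i _.
  by rewrite (ltW q0)/= /bern; case: ifP => _; nra.
pose B r := \sum_(c : {ffun 'I_r -> bool}) mass m (@cell r @^-1` [set c]) ^+ 2.
pose D r := mass m [set x | ~~ injectiveb (cell_word r L x)].
have [r small] : exists r, #|Q|%:R * (2 ^ L)%:R * (2 * D r + (L%:R ^+ 2) * B r) <= tau ^+ 2.
  have : (fun r => #|Q|%:R * (2 ^ L)%:R * (2 * D r + (L%:R ^+ 2) * B r)) @ \oo -->
      (#|Q|%:R * (2 ^ L)%:R * (2 * 0 + (L%:R ^+ 2) * 0) : R).
    apply: cvgMr; apply: cvgD; apply: cvgMr; first exact: cell_recurrence_cvg0.
    exact: cell_collision_cvg0.
  rewrite !mulr0 addr0 mulr0 => /cvgrPdist_le /(_ _ (exprn_gt0 2 tau0)) [r _ hr].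
  exists r; have := hr r (leqnn _); rewrite sub0r normrN; apply: le_trans.
  exact: ler_norm.
pose mu (g : {ffun 'I_L -> {ffun 'I_r -> bool}}) := mass m (@cell_word r L @^-1` [set g]).
pose a q g := mass m (A q `&` @cell_word r L @^-1` [set g]).
have mAg q g : measurable (A q `&` @cell_word r L @^-1` [set g]).
  by apply: measurableI => //; exact: measurable_cell_word.
(* A repetition lies within the first word, within the second, or between place [i] of one and place
   [j] of the other. By invariance the last event has probability [B r] for each of the [L ^ 2]
   pairs. *)
have bad : bad_mass mu <= 2 * D r + (L%:R ^+ 2) * B r.
  have mu0 g : 0 <= mu g by exact: mass_ge0.
  have muP (P : pred {ffun 'I_L -> {ffun 'I_r -> bool}}) :
      \sum_g mu g * (P g)%:R = mass m [set x | P (cell_word r L x)].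
    have := mass_fin m P (@measurable_cell_word r L) measurableT.
    by rewrite setTI => ->; apply: eq_bigr => g _; rewrite setTI.
  have mu1 : \sum_g mu g = 1.
    rewrite -[RHS](massT m); transitivity (\sum_g mu g * (xpredT g)%:R).
      by apply: eq_bigr => g _; rewrite mulr1.
    by rewrite muP; congr (mass m _); apply/seteqP; split.
  have mui i c : \sum_g mu g * (g i == c)%:R = mass m (@cell r @^-1` [set c]).
    rewrite (muP (fun g => g i == c)).
    rewrite -[RHS](mass_iter i (measurable_cell c)); congr (mass m _).
    apply/seteqP; split => [x /= /eqP <-|x /= <-]; first by rewrite ffunE.
    by rewrite ffunE.
  apply: (@le_trans _ _ (\sum_g \sum_h (mu g * mu h * (~~ injectiveb g)%:R +
      (mu g * mu h * (~~ injectiveb h)%:R + \sum_i \sum_j \sum_c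
        (mu g * (g i == c)%:R) * (mu h * (h j == c)%:R))))).
    apply: ler_sum => g _; rewrite [leLHS]big_mkcond; apply: ler_sum => h _.
    have gh0 : 0 <= mu g * mu h by rewrite mulr_ge0.
    have S0 : 0 <= \sum_i \sum_j \sum_c
        (mu g * (g i == c)%:R) * (mu h * (h j == c)%:R).
      do 3 (apply: sumr_ge0 => ? _); rewrite !mulr_ge0 ?ler0n//.
    case: ifPn => [bad|_]; last by rewrite !addr_ge0// mulr_ge0.
    have [gI|gI] := boolP (injectiveb g); last first.
      by rewrite mulr1 lerDl addr_ge0// mulr_ge0.
    have [hI|hI] := boolP (injectiveb h); last first.
      by rewrite mulr0 add0r mulr1 lerDl.
    rewrite !mulr0 !add0r.
    have [i [j gij]] : exists i j, g i = h j.
      apply: contrapT => nij; move/negP: bad; apply; apply/injectiveP.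
      move=> [i|i] [j|j] /= e.
      - by congr inl; exact: (injectiveP _ gI).
      - by exfalso; apply: nij; exists i, j.
      - by exfalso; apply: nij; exists j, i.
      - by congr inr; exact: (injectiveP _ hI).
    rewrite (bigD1 i)//= (bigD1 j)//= (bigD1 (g i))//= eqxx gij eqxx !mulr1.
    rewrite -!addrA lerDl !addr_ge0//; do ?(apply: sumr_ge0 => ? _);
      by rewrite !mulr_ge0 ?ler0n//; do ?(apply: sumr_ge0 => ? _); rewrite !mulr_ge0 ?ler0n.
  under eq_bigr do rewrite !big_split.
  rewrite !big_split /= [2 * D r]mulr_natl mulr2n -addrA; apply: lerD.
    rewrite (_ : D r = \sum_g mu g * (~~ injectiveb g)%:R); last first.
      by rewrite (muP (fun g => ~~ injectiveb g)).
    apply: ler_sum => g _; rewrite -[leRHS]mulr1 -mu1 mulr_sumr.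
    by apply: ler_sum => h _; rewrite mulrAC.
  apply: lerD.
    rewrite -[leRHS]mul1r -[X in _ <= X * _]mu1 mulr_suml; apply: ler_sum => g _.
    rewrite (_ : D r = \sum_g mu g * (~~ injectiveb g)%:R); last first.
      by rewrite (muP (fun g => ~~ injectiveb g)).
    by rewrite mulr_sumr; apply: ler_sum => h _; rewrite mulrA.
  rewrite [leRHS](_ : _ = \sum_(i < L) \sum_(j < L) B r); last first.
    by rewrite sumr_const card_ord sumr_const card_ord -mulrnA -[RHS]mulr_natl natrM expr2.
  rewrite (_ : \sum_g _ = \sum_(i < L) \sum_(j < L) \sum_c
      (\sum_g mu g * (g i == c)%:R) * (\sum_h mu h * (h j == c)%:R)); last first.
    under eq_bigr do rewrite exchange_big/=.
    rewrite exchange_big/=; apply: eq_bigr => i _.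
    under eq_bigr do rewrite exchange_big/=.
    rewrite exchange_big/=; apply: eq_bigr => j _.
    under eq_bigr do rewrite exchange_big/=.
    rewrite exchange_big/=; apply: eq_bigr => c _.
    by rewrite mulr_suml; apply: eq_bigr => g _; rewrite mulr_sumr.
  apply: ler_sum => i _; apply: ler_sum => j _; apply: ler_sum => c _.
  by rewrite !mui expr2.
have a_le q g : a q g <= mu g.
  by apply: le_mass => //; exact: measurable_cell_word.
have small' : #|Q|%:R * (2 ^ L)%:R * bad_mass mu <= tau ^+ 2.
  by apply: le_trans small; rewrite ler_wpM2l// mulr_ge0.
have [v hv] := exists_labelling p01 (fun q g => mass_ge0 m _) a_le tau0 small'.
exists (@cell r @^-1` [set c | v c]); split.
  exact: (measurable_preimage_fin (@measurable_cell r)).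
move=> q s.
have patE : pattern_set (@cell r @^-1` [set c | v c]) s =
    [set x | labelled (cell_word r L x) s v].
  apply/seteqP; split => x /=.
    by move=> h; apply/forallP => i; rewrite ffunE -h; apply/eqP/esym/asboolb.
  by move=> /forallP h i; rewrite -(eqP (h i)) ffunE; exact: asboolb.
have e1 : mass m (A q `&` pattern_set (@cell r @^-1` [set c | v c]) s) =
    \sum_g a q g * (labelled g s v)%:R.
  rewrite patE (mass_fin m (fun g => labelled g s v) (@measurable_cell_word r L) (mA q)).
  by [].
have e2 : mass m (A q) = \sum_g a q g.
  have := mass_fin m xpredT (@measurable_cell_word r L) (mA q).
  rewrite (_ : [set x | _] = setT) ?setIT; last by apply/seteqP; split.
  by move=> ->; apply: eq_bigr => g _; rewrite mulr1.
have [z|nz] := eqVneq (mass m (A q)) 0.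
  rewrite z mul0r mulr0 -z; apply: le_mass => //.
  by rewrite patE; apply: measurableI => //; exact: (measurable_preimage_fin (@measurable_cell_word r L) [set g | labelled g s v]).
rewrite mulrDl mul1r -lerBlDl; apply: le_trans (tau_le q s nz).
by apply: le_trans (hv q s); rewrite -e1 -e2; exact: ler_norm.
Qed.

End copying.

(** * Recursive choice of almost independent events *)

Section almost_independent_events.
Context (R : realType) (d : measure_display) (X : measurableType d)
  (m : probability X R) (T : X -> X).
Hypotheses (hstd : standard_probability_space m)
  (hT : measure_preserving m T) (haper : aperiodic m T).
Variables (p : nat -> R) (L : nat -> nat).
Hypothesis p01 : forall k, 0 < p k < 1.

(** The pattern [b] is a total function, read only at [K <= k < N] and [i < L k]; this keeps its
    type fixed while [N] grows. *)
Definition block_set (E : nat -> set X) (K N : nat) (b : nat -> nat -> bool) : set X :=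
  [set x | forall k, (K <= k < N)%N ->
    forall i, (i < L k)%N -> `[< E k (iter i T x) >] = b k i].

Lemma measurable_block_set E K N b : (forall k, measurable (E k)) ->
  measurable (block_set E K N b).
Proof.
move=> mE; rewrite (_ : block_set _ _ _ _ = \bigcap_(k in [set k | (K <= k < N)%N])
  \bigcap_(i in [set i | (i < L k)%N]) (iter i T @^-1`
     ((fun x => `[< E k x >]) @^-1` [set b k i]))).
  apply: bigcap_measurableType => k _; apply: bigcap_measurableType => i _.
  apply: (measurable_preimage_iter hT); exact: measurable_fiber_bool.
by apply/seteqP; split => x h k kKN i iL; exact: h.
Qed.

Lemma eq_block_set E E' K N b : (forall k, (k < N)%N -> E k = E' k) ->
  block_set E K N b = block_set E' K N b.
Proof.
move=> EE'; apply/seteqP.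
split => x h k kKN i iL; have := h k kKN i iL; rewrite EE' //; lia.
Qed.

Lemma block_setS E K N b : (K <= N)%N ->
  block_set E K N.+1 b =
  block_set E K N b `&` pattern_set T (E N) [ffun i : 'I_(L N) => b N i].
Proof.
move=> KN; apply/seteqP; split => [x h|x [h1 h2] k].
  split; first by move=> k kKN i iL; apply: h => //; lia.
  by move=> i; rewrite ffunE; apply: h => //; lia.
rewrite ltnS (leq_eqVlt k) andb_orr => /orP[/andP[_ /eqP ->]|kKN]; last exact: h1.
by move=> i iL; have := h2 (Ordinal iL); rewrite ffunE.
Qed.

(* The relative error of step [k] is [ratio k / ratio k.+1 - 1], so that the
   errors of the steps from [K] on multiply to less than [ratio K]. *)
Let ratio (k : nat) : R := 1 + k.+1%:R^-1.

Let ratio_gt1 k : 1 < ratio k.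
Proof. by rewrite ltrDl invr_gt0. Qed.

Let ratio_gt0 k : 0 < ratio k.
Proof. exact: lt_trans (ratio_gt1 k). Qed.

(** The patterns of the earlier sets, for every start [K <= N], form a finite family, so one
    application of [copying_lemma] serves them all. *)
Let step N (E : nat -> set X) : (forall k, measurable (E k)) ->
  exists E' : set X, measurable E' /\ forall K b, (K <= N)%N ->
    mass m (block_set E K N b `&` pattern_set T E' [ffun i : 'I_(L N) => b N i]) <=
    (ratio N / ratio N.+1) * (mass m (block_set E K N b) *
       label_prob (p N) [ffun i : 'I_(L N) => b N i]).
Proof.
move=> mE; have [C [mC sepC]] := standard_separating hstd.
(* A common bound on the earlier windows; [ext] reads a table of size [N] by [M] and gives [false]
   outside it, where [block_set] never looks. *)
pose M := \max_(k < N) L k.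
pose ext (g : {ffun 'I_N * 'I_M -> bool}) (k i : nat) : bool :=
  match insub k, insub i with Some k', Some i' => g (k', i') | _, _ => false end.
pose A (q : 'I_N.+1 * {ffun 'I_N * 'I_M -> bool}) := block_set E q.1 N (ext q.2).
have mA q : measurable (A q) by exact: measurable_block_set.
have delta0 : 0 < ratio N / ratio N.+1 - 1.
  rewrite subr_gt0 ltr_pdivlMr// mul1r ltrD2l ltf_pV2 ?posrE ?ltr0n//.
  by rewrite ltr_nat.
have /andP[p0 p1] := p01 N.
have [E' [mE' hE']] := copying_lemma hT haper mC sepC (L N) mA p0 p1 delta0.
exists E'; split => // K b KN.
pose q : 'I_N.+1 * {ffun 'I_N * 'I_M -> bool} :=
  (inord K, [ffun ki : 'I_N * 'I_M => b ki.1 ki.2]).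
have := hE' q [ffun i : 'I_(L N) => b N i].
rewrite (_ : 1 + _ = ratio N / ratio N.+1); last by rewrite addrC subrK.
rewrite (_ : A q = block_set E K N b)//.
rewrite /A /q /= inordK//; apply/seteqP.
have bE k i : (K <= k < N)%N -> (i < L k)%N ->
    ext [ffun ki : 'I_N * 'I_M => b ki.1 ki.2] k i = b k i.
  move=> /andP[_ kN] iL; have iM : (i < M)%N.
    by apply: leq_trans iL _; exact: (leq_bigmax (Ordinal kN)).
  by rewrite /ext (insubT (fun k => k < N)%N kN) (insubT (fun i => i < M)%N iM) ffunE.
by split => x h k kKN i iL; have := h k kKN i iL; rewrite bE.
Qed.

(** Each set is chosen from the list of the earlier ones. Multiplying the bounds of the steps from
    [K] to [N - 1] leaves the factor [ratio K / ratio N], and [ratio N] exceeds 1. *)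
Lemma exists_almost_independent_events : exists E : nat -> set X,
  (forall k, measurable (E k)) /\
  forall K N b, (K <= N)%N ->
    mass m (block_set E K N b) <=
    (1 + K.+1%:R^-1) * \prod_(K <= k < N) \prod_(i < L k) bern (p k) (b k i).
Proof.
(* Measurability of the history is a premise inside the choice, so that [F] is total; indices beyond
   the list read [setT], which is measurable. *)
have /choice[F hF] : forall Nh : nat * seq (set X), exists E' : set X,
    (forall k, measurable (nth setT Nh.2 k)) ->
    measurable E' /\ forall K b, (K <= Nh.1)%N ->
    mass m (block_set (nth setT Nh.2) K Nh.1 b `&`
       pattern_set T E' [ffun i : 'I_(L Nh.1) => b Nh.1 i]) <=
    (ratio Nh.1 / ratio Nh.1.+1) * (mass m (block_set (nth setT Nh.2) K Nh.1 b) *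
       label_prob (p Nh.1) [ffun i : 'I_(L Nh.1) => b Nh.1 i]).
  move=> [N h]; have [mh|nmh] := pselect (forall k, measurable (nth setT h k)).
    by have [E' hE'] := step N mh; exists E'.
  by exists setT => mh; case: nmh.
pose hist := fix hist n := if n is n'.+1 then rcons (hist n') (F (n', hist n')) else [::].
have sz n : size (hist n) = n by elim: n => //= n ih; rewrite size_rcons ih.
pose E n := F (n, hist n).
have nthE N k : (k < N)%N -> nth setT (hist N) k = E k.
  elim: N => [//|N ih]; rewrite ltnS leq_eqVlt => /orP[/eqP ->|kN].
    by rewrite /= nth_rcons sz ltnn eqxx.
  by rewrite /= nth_rcons sz kN ih.
have mh N : forall k, measurable (nth setT (hist N) k).
  elim: N => [|N ih] k; first by rewrite nth_nil.
  rewrite /= nth_rcons; case: ifP => _; first exact: ih.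
  case: ifP => _ //; exact: (hF (N, hist N) ih).1.
have mE k : measurable (E k) by exact: (hF (k, hist k) (mh k)).1.
exists E; split => // K N b.
suff h n : mass m (block_set E K (K + n) b) <= ratio K / ratio (K + n) *
    \prod_(K <= k < K + n) \prod_(i < L k) bern (p k) (b k i).
  move=> KN; have := h (N - K)%N; rewrite subnKC// => /le_trans; apply.
  apply: ler_wpM2r.
    apply: prodr_ge0 => k _; apply: prodr_ge0 => i _.
    by have /andP[p0 p1] := p01 k; rewrite /bern; case: ifP => _; lra.
  by rewrite ler_pdivrMr// ler_peMr// ltW.
elim: n => [|n ih].
  rewrite addn0 big_geq// divff ?gt_eqF// mulr1; apply: mass_le1.
  exact: measurable_block_set.
rewrite addnS block_setS ?leq_addr// big_nat_recr ?leq_addr//=.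
have := (hF (K + n, hist (K + n))%N (mh _)).2 K b (leq_addr _ _).
rewrite /= (@eq_block_set (nth setT (hist (K + n))) E); last first.
  by move=> k; exact: nthE.
move=> /le_trans; apply.
rewrite /label_prob; under eq_bigr do rewrite ffunE.
have -> : ratio K / ratio (K + n).+1 = (ratio (K + n) / ratio (K + n).+1) * (ratio K / ratio (K + n)).
  by field; rewrite !gt_eqF.
rewrite -[leRHS]mulrA ler_pM2l ?divr_gt0// mulrA; apply: ler_wpM2r => //.
apply: prodr_ge0 => i _.
by have /andP[p0 p1] := p01 (K + n)%N; rewrite /bern; case: ifP => _; lra.
Qed.

Definition block_index (K N : nat) := {k : 'I_(N - K) & 'I_(L (K + k))}.

Lemma big_block_index (S : Type) (idx : S) (op : Monoid.com_law idx)
    (F : nat -> nat -> S) (K N : nat) :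
  \big[op/idx]_(u : block_index K N) F (K + tag u)%N (tagged u) =
  \big[op/idx]_(K <= k < N) \big[op/idx]_(i < L k) F k i.
Proof.
have shift (H : nat -> S) :
    \big[op/idx]_(K <= k < N) H k = \big[op/idx]_(k < N - K) H (K + k)%N.
  rewrite -{1}[K]add0n big_addn big_mkord.
  by apply: eq_bigr => k _; rewrite addnC.
by rewrite shift (sig_big_dep xpredT (fun _ => xpredT)
    (fun (k : 'I_(N - K)) (i : 'I_(L (K + k))) => F (K + k)%N i)).
Qed.

Definition block_prob (K N : nat) (u : block_index K N) : R := p (K + tag u).

Definition block_bits (E : nat -> set X) (K N : nat) (x : X) :
    {ffun block_index K N -> bool} :=
  [ffun u : block_index K N => `[< E (K + tag u)%N (iter (tagged u) T x) >]].

Variable E : nat -> set X.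
Hypothesis mE : forall k, measurable (E k).
Hypothesis hE : forall K N b, (K <= N)%N ->
    mass m (block_set E K N b) <=
    (1 + K.+1%:R^-1) * \prod_(K <= k < N) \prod_(i < L k) bern (p k) (b k i).

Lemma measurable_block_bits K N b : measurable (@block_bits E K N @^-1` [set b]).
Proof.
apply: measurable_fiber_ffun => u e.
exact: (measurable_preimage_iter hT _ (measurable_fiber_bool _ (mE _))).
Qed.

(** Domination of the law of the bits, point by point, integrates only against nonnegative [G]; a
    signed function must be shifted first, as in [main_part_cos]. *)
Lemma block_bits_mean K N (G : {ffun block_index K N -> bool} -> R) : (K <= N)%N ->
  (forall b, 0 <= G b) ->
  \int[m]_x G (block_bits E K N x) <=
  (1 + K.+1%:R^-1) * bern_mean (@block_prob K N) G.
Proof.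
move=> KN G0; rewrite (Rintegral_fin _ (@measurable_block_bits K N)).
rewrite /bern_mean mulr_sumr; apply: ler_sum => b _.
rewrite mulrA [leRHS]mulrC; apply: ler_wpM2l => //.
pose idx (k : 'I_(N - K)) (i : 'I_(L (K + k))) : block_index K N := existT _ k i.
pose ext (k i : nat) : bool :=
  if (insub (k - K)%N : option 'I_(N - K)) is Some k' then
    if (insub i : option 'I_(L (K + k'))) is Some i' then b (idx k' i') else false
  else false.
have extE (k : 'I_(N - K)) (i : 'I_(L (K + k))) : ext (K + k)%N i = b (idx k i).
  by rewrite /ext addKn !valK.
rewrite (_ : _ @^-1` _ = block_set E K N ext); last first.
  apply/seteqP; split => [x /= xb k /andP[Kk kN] i iL|x h].
    have kNK : (k - K < N - K)%N by lia.
    have kE : k = (K + Ordinal kNK)%N by rewrite /= subnKC.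
    move: i iL; rewrite kE => i iL.
    by rewrite (extE (Ordinal kNK) (Ordinal iL)) -xb ffunE.
  apply/ffunP => -[k i]; rewrite ffunE /= -extE.
  by apply: h => //; have := ltn_ord k; lia.
apply: le_trans (hE _ KN) _; apply: ler_wpM2l.
  by rewrite addr_ge0 ?invr_ge0.
rewrite le_eqVlt; apply/orP; left; apply/eqP.
rewrite -(big_block_index _ (fun k i => bern (p k) (ext k i))).
by apply: eq_bigr => -[k i] _; rewrite /= extE.
Qed.

End almost_independent_events.

(** * The Riemann sum of the characteristic exponent *)

Lemma norm_sin_le (R : realType) (x : R) : `|sin x| <= `|x|.
Proof.
wlog x0 : x / 0 < x.
  move=> hw; have [x0|x0|->] := ltgtP x 0; last by rewrite sin0.
    by rewrite -(normrN x) -(normrN (sin x)) -sinN; apply: hw; rewrite oppr_gt0.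
  exact: hw.
have [|c _] := @MVT R sin cos 0 x x0 (fun y _ => is_derive_sin y).
  by apply: continuous_subspaceT; exact: continuous_sin.
rewrite sin0 !subr0 => ->; rewrite normrM ler_piMl//.
by rewrite ler_norml cos_geN1 cos_le1.
Qed.

Lemma one_sub_cos_le (R : realType) (y : R) : 1 - cos y <= y ^+ 2 / 2.
Proof.
have -> : 1 - cos y = 2 * sin (y / 2) ^+ 2.
  rewrite {1}(splitr y) cosD; have := cos2Dsin2 (y / 2); lra.
have := norm_sin_le (y / 2); rewrite -ler_sqr ?nnegrE// !real_normK ?num_real//.
by rewrite !expr2; lra.
Qed.

Lemma powR_continuous_gt0 (R : realType) (g t : R) : 0 < t ->
  {for t, continuous (fun x => x `^ g)}.
Proof.
move=> t0; apply: differentiable_continuous; apply/derivable1_diffP.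
by apply: derivable_powR; rewrite in_itv/= t0.
Qed.

(** A discrete derivative bound, for [b < 1] and [b >= 1] alike, that lets sums of
    [(k + 1) ^ (b - 1)] telescope. With [x = 1 / (k + 1)] it amounts to
    [(1 - x) ^ b <= 1 - b' x / 2]. *)
Lemma powR_increment (R : realType) (b : R) (k : nat) : 0 < b ->
  k.+1%:R `^ (b - 1) <= 2 / Num.min b 1 * (k.+1%:R `^ b - k%:R `^ b).
Proof.
move=> b0; set b' := Num.min b 1.
have b'0 : 0 < b' by rewrite lt_min b0 ltr01.
have b'b : b' <= b by rewrite ge_min lexx.
have b'1 : b' <= 1 by rewrite ge_min lexx orbT.
have k0 : 0 < k.+1%:R :> R by rewrite ltr0n.
pose x : R := k.+1%:R^-1.
have x0 : 0 < x by rewrite invr_gt0.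
have x1 : x <= 1 by rewrite invf_le1// ler1n.
have ratio : k%:R `^ b = k.+1%:R `^ b * (1 - x) `^ b.
  rewrite -powRM ?(ltW k0) ?subr_ge0//; congr (_ `^ _).
  by rewrite /x mulrBr mulr1 divff ?gt_eqF// -natr1 addrK.
(* The bounds [ln (1 - x) <= - x] and [b' <= b] lead to [expR (- b' x)], and
   [(1 - y / 2) (1 + y) >= 1] on [[0, 1]] does the rest. The case [x = 1] is [k = 0], where the left
   side is 0. *)
have key : (1 - x) `^ b <= 1 - b' * x / 2.
  have b'x : b' * x <= 1 by rewrite mulr_ile1 ?(ltW b'0) ?(ltW x0).
  have b'x0 : 0 < b' * x by rewrite mulr_gt0.
  have [->|xn1] := eqVneq x 1.
    by rewrite subrr powR0 ?gt_eqF// mulr1; lra.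
  have x1' : 0 < 1 - x by rewrite subr_gt0 lt_neqAle xn1.
  rewrite /powR gt_eqF//.
  apply: (@le_trans _ _ (expR (- (b' * x)))).
    rewrite ler_expR -mulrN; have ln1 : ln (1 - x) <= - x.
      by apply: le_ln1Dx; rewrite ltrN2; lra.
    apply: (@le_trans _ _ (b * - x)); first by rewrite ler_pM2l.
    by rewrite !mulrN lerN2 ler_pM2r.
  rewrite expRN -[leLHS]mul1r ler_pdivrMr ?expR_gt0//.
  apply: (@le_trans _ _ ((1 - b' * x / 2) * (1 + b' * x))); first by nra.
  by rewrite ler_wpM2l ?expR_ge1Dx//; lra.
have kb : 0 < k.+1%:R `^ b :> R by exact: powR_gt0.
rewrite mulrAC ler_pdivlMr// ratio -{1}[k.+1%:R `^ b]mulr1 -mulrBr.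
have -> : k.+1%:R `^ (b - 1) = k.+1%:R `^ b * x :> R.
  by rewrite powRB ?(gt_eqF k0) ?implybT// powRr1 ?(ltW k0).
rewrite -[leLHS]mulrA [leRHS]mulrCA ler_pM2l//; lra.
Qed.

(** The weights are at most [(k + 1) ^ (- 2)], which leaves the exponent [2 g - 2] and lets
    [powR_increment] telescope. With [g = 1 / alpha] the hypothesis is [alpha < 2]. *)
Lemma sum_powR_le (R : realType) (g : R) (N : nat) : 1 < 2 * g ->
  \sum_(0 <= k < N) (k.+1%:R * k.+2%:R)^-1 * k.+1%:R `^ (2 * g) <=
  2 / Num.min (2 * g - 1) 1 * N%:R `^ (2 * g - 1).
Proof.
move=> g1; have b0 : 0 < 2 * g - 1 by rewrite subr_gt0.
apply: (@le_trans _ _ (\sum_(0 <= k < N) 2 / Num.min (2 * g - 1) 1 *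
    (k.+1%:R `^ (2 * g - 1) - k%:R `^ (2 * g - 1)))); last first.
  rewrite -mulr_sumr telescope_sumr// powR0 ?gt_eqF// subr0//.
apply: ler_sum => k _; apply: le_trans (powR_increment _ b0).
have k0 : 0 < k.+1%:R :> R by rewrite ltr0n.
have -> : k.+1%:R `^ (2 * g - 1 - 1) = k.+1%:R `^ (2 * g) / k.+1%:R / k.+1%:R :> R.
  by rewrite !powRB ?(gt_eqF k0) ?implybT// powRr1 ?(ltW k0).
rewrite mulrC invfM mulrA ler_wpM2l ?mulr_ge0 ?invr_ge0 ?powR_ge0//.
by rewrite lef_pV2 ?posrE ?ltr0n// ler_nat.
Qed.

Section riemann_sum.
Context (R : realType) (g : R).
Hypothesis g1 : 1 < 2 * g.
Let mu := @lebesgue_measure R.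
Let D : set R := `]0, +oo[%classic.

Let g0 : 0 < g.
Proof. by move: g1 => ?; lra. Qed.

Let H (t : R) : R := 1 - cos (t `^ g).

Let H_ge0 t : 0 <= H t.
Proof. by rewrite subr_ge0 cos_le1. Qed.

Let H_le2 t : H t <= 2.
Proof. by rewrite /H; have := cos_geN1 (t `^ g); lra. Qed.

Let H_le (t : R) : 0 <= t -> H t <= t `^ (2 * g).
Proof.
move=> t0; apply: (le_trans (one_sub_cos_le _)).
rewrite mulrC powRrM powRAC powR_mulrn ?powR_ge0//.
by have := sqr_ge0 (t `^ g); lra.
Qed.

Let H_continuous (t : R) : 0 < t -> {for t, continuous H}.
Proof.
move=> t0; apply: continuousB; first exact: cvg_cst.
apply: (@continuous_comp _ _ _ (fun x => x `^ g) cos); first exact: powR_continuous_gt0.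
exact: continuous_cos.
Qed.

Definition stable_const : R := \int[mu]_(s in D) H s^-1.

(** Integrable on []0, +oo[]: [1 - cos] is at most 2 near 0, and its quadratic bound gives the tail
    exponent [- 2 g < - 1]. *)
Let dom (s : R) : R := if s <= 1 then 2 else s `^ (- (2 * g)).

Let tail : set R := `[1, +oo[%classic.

Let dom_tail : mu.-integrable tail (fun s : R => (s `^ (- (2 * g)))%:E).
Proof.
pose F (x : R) := (1 - 2 * g)^-1 * x `^ (1 - 2 * g).
have ne : 1 - 2 * g != 0 by rewrite subr_eq0 lt_eqF.
have mf : measurable_fun tail (fun s : R => (s `^ (- (2 * g)))%:E).
  by apply/measurable_EFinP; apply: measurable_funTS; exact: measurable_powR.
apply/integrableP; split => //.
have -> : (\int[mu]_(s in tail) `|(s `^ (- (2 * g)))%:E| =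
    \int[mu]_(s in tail) (s `^ (- (2 * g)))%:E)%E.
  by apply: eq_integral => s _; rewrite gee0_abs// lee_fin powR_ge0.
have gt0 (x : R) : 1 <= x -> 0 < x by exact: lt_le_trans.
rewrite (@ge0_continuous_FTC2y _ _ F 1 0); first by rewrite -EFinB ltry.
- by move=> x _; exact: powR_ge0.
- apply: continuous_in_subspaceT => x; rewrite inE/= in_itv/= andbT => x1.
  by apply: powR_continuous_gt0; exact: gt0.
- rewrite -[X in _ --> X](mulr0 (1 - 2 * g)^-1); apply: cvgMr.
  have -> : (fun x : R => x `^ (1 - 2 * g)) = (fun x => (x `^ (2 * g - 1))^-1).
    by apply/funext => x; rewrite -powRN opprB.
  apply/cvgrPdist_le => e e0; near=> x.
  have xe : e^-1 `^ (2 * g - 1)^-1 <= x.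
    by near: x; apply: nbhs_pinfty_ge; exact: num_real.
  have b0 : 0 < 2 * g - 1 by rewrite subr_gt0.
  have := @ge0_ler_powR R _ (ltW b0) _ _ _ _ xe.
  rewrite !nnegrE powR_ge0 -powRrM mulVf ?gt_eqF// powRr1 ?invr_ge0 ?(ltW e0)//.
  move=> /(_ isT (le_trans (powR_ge0 _ _) xe)) ex.
  have ei0 : 0 < e^-1 by rewrite invr_gt0.
  rewrite sub0r normrN ger0_norm ?invr_ge0 ?powR_ge0//.
  by rewrite -[leRHS]invrK lef_pV2 ?posrE// (lt_le_trans ei0).
- move=> x x1; apply: derivableM; first exact: derivable_cst.
  by apply: derivable_powR; rewrite in_itv/= andbT (lt_trans _ x1).
- apply: cvg_at_right_filter; apply: cvgMr; exact: powR_continuous_gt0.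
- move=> x; rewrite in_itv/= andbT => x1.
  rewrite derive1Ml; last by apply: derivable_powR; rewrite in_itv/= andbT (lt_trans _ x1).
  rewrite powR_derive1 ?in_itv/= ?andbT ?(lt_trans _ x1)// mulKf//.
  by congr (_ `^ _); ring.
Unshelve. all: by end_near. Qed.

Let measurable_D : measurable (D : set (measurableTypeR R)).
Proof. exact: measurable_itv. Qed.

Let measurable_dom : measurable_fun setT dom.
Proof.
rewrite /dom; apply: (@measurable_fun_ifT _ _ R R (fun=> 2) (fun s : R => s `^ (- (2 * g))) (fun s : R => s <= 1)).
- by apply: measurable_fun_ler => //; exact: measurable_cst.
- exact: measurable_cst.
- exact: measurable_powR.
Qed.

Let dom_integrable : mu.-integrable D (fun s => (dom s)%:E).
Proof.
have i1 : mu.-integrable setT (EFin \o \1_(`[0, 1]%classic : set R)).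
  exact: integrable_indic_itv.
have i2 : mu.-integrable setT ((fun s : R => (s `^ (- (2 * g)))%:E) \_ tail).
  have mt : measurable (tail : set (measurableTypeR R)) by exact: measurable_itv.
  have := dom_tail; move/(integrable_mkcond _ mt); apply.
have i3 := integrableD measurableT (integrableZl measurableT 2 i1) i2.
have i4 := integrableS measurableT measurable_D (@subsetT _ _) i3.
apply: (le_integrable measurable_D _ _ i4).
  by apply/measurable_EFinP; apply: measurable_funTS.
move=> s; rewrite /D /= in_itv/= andbT => s0; rewrite /dom /patch /=.
have p0 : 0 <= s `^ (- (2 * g)) by exact: powR_ge0.
case: (leP s 1) => s1.
  rewrite indicE mem_set/=; last by rewrite in_itv/= s1 ltW.
  rewrite mule1; case: ifP => _; last by rewrite adde0.
  by rewrite -EFinD lee_fin !ger0_norm ?addr_ge0// lerDl.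
rewrite indicE memNset/=; last by rewrite in_itv/= => /andP[_]; rewrite leNgt s1.
by rewrite mule0 add0e mem_set//= /tail/= in_itv/= andbT ltW.
Qed.

(** Stated for every [t] up to [s^-1], because [Phi] evaluates [H] at a grid point at or below
    [s^-1]. *)
Let dom_ge (s : R) : 0 < s -> forall t : R, 0 <= t -> t <= s^-1 -> H t <= dom s.
Proof.
move=> s0 t t0 ts; rewrite /dom; case: ifPn => [_//|]; rewrite -ltNge => s1.
apply: (le_trans (H_le t0)); rewrite powRN -powR_inv1 ?powR_ge0//.
rewrite powRAC powR_inv1 ?(ltW s0)//.
have g20 : 0 <= 2 * g by move: g0 => ?; lra.
by apply: ge0_ler_powR; rewrite ?nnegrE ?invr_ge0 ?(ltW s0).
Qed.

Variables (lam : nat -> R) (K N : nat -> nat).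
Hypotheses (lam0 : forall n, 0 < lam n) (lamy : lam n @[n --> \oo] --> +oo).
Hypotheses (K0 : (K n)%:R / lam n @[n --> \oo] --> (0 : R))
  (Ny : (N n)%:R / lam n @[n --> \oo] --> +oo).

(** Where the integer part of [lam n / s] equals [k + 1]. The length is [lam n / ((k + 1) (k + 2))],
    exactly the weight of the term in the Riemann sum. *)
Let I n k : set R := `]lam n / k.+2%:R, lam n / k.+1%:R]%classic.

(* A step function whose integral is the Riemann sum; it converges pointwise to
   [H s^-1] and is dominated by [dom]. *)
Let Phi n (s : R) : R := \sum_(K n <= k < N n) H (k.+1%:R / lam n) * \1_(I n k) s.

Let in_I n k (s : R) : 0 < s -> I n k s -> Num.truncn (lam n / s) = k.+1.
Proof.
move=> s0; rewrite /I /= in_itv/= => /andP[l u]; apply: truncn_def.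
rewrite ler_pdivlMr// -ler_pdivlMl ?ltr0n// mulrC u/=.
by rewrite ltr_pdivrMr// -ltr_pdivrMl ?ltr0n// mulrC.
Qed.

Let I_in n k (s : R) : 0 < s -> Num.truncn (lam n / s) = k.+1 -> I n k s.
Proof.
move=> s0 e; have l0 : 0 <= lam n / s by rewrite divr_ge0 ?ltW.
have := truncn_itv l0; rewrite e => /andP[l u].
rewrite /I /= in_itv/=; apply/andP; split.
  by rewrite ltr_pdivrMr ?ltr0n// -ltr_pdivrMl// mulrC.
by rewrite ler_pdivlMr ?ltr0n// -ler_pdivlMl// mulrC.
Qed.

Let PhiE n (s : R) k : 0 < s -> I n k s ->
  Phi n s = if (K n <= k < N n)%N then H (k.+1%:R / lam n) else 0.
Proof.
move=> s0 Ik; rewrite /Phi.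
have other j : j != k -> H (j.+1%:R / lam n) * \1_(I n j) s = 0.
  move=> jk; rewrite indicE memNset ?mulr0// => Ij.
  by have := in_I s0 Ij; rewrite (in_I s0 Ik) => -[e]; rewrite e eqxx in jk.
case: ifPn => kKN.
  rewrite (bigD1_seq k) ?mem_index_iota ?iota_uniq//= big1 => [|j jk]; last exact: other.
  by rewrite indicE mem_set// mulr1 addr0.
rewrite big_nat big1// => j jKN; apply: other; apply: contra kKN => /eqP <-//.
Qed.

Let Phi0 n s : (forall k, ~ I n k s) -> Phi n s = 0.
Proof. by move=> h; rewrite /Phi big1// => k _; rewrite indicE memNset ?mulr0//; exact: h. Qed.

Let Phi_ge0 n s : 0 <= Phi n s.
Proof. by apply: sumr_ge0 => k _; rewrite mulr_ge0. Qed.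

Let Phi_le n (s : R) : 0 < s -> Phi n s <= dom s.
Proof.
move=> s0; have d0 : 0 <= dom s.
  by rewrite /dom; case: ifP => // _; exact: powR_ge0.
have [[k Ik]|/forallNP/Phi0 -> //] := pselect (exists k, I n k s).
rewrite (PhiE s0 Ik); case: ifP => // _; apply: dom_ge => //.
  by rewrite divr_ge0// ltW.
move: Ik; rewrite /I/= in_itv/= => /andP[_ u].
by rewrite -invf_div lef_pV2 ?posrE ?divr_gt0 ?ltr0n.
Qed.

(** The integer part of [lam n / s], divided by [lam n], tends to [s^-1]. Its index, one less than
    the integer part, is eventually between [K n], which is [o(lam n)], and [N n], which outgrows
    [lam n]. *)
Let Phi_cvg (s : R) : 0 < s -> Phi n s @[n --> \oo] --> H s^-1.
Proof.
move=> s0.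
have si0 : 0 < s^-1 by rewrite invr_gt0.
have lams n : 0 < lam n / s by rewrite divr_gt0.
have c1 : (Num.truncn (lam n / s))%:R / lam n @[n --> \oo] --> s^-1.
  apply/cvgrPdist_le => e e0; near=> n.
  have le : e^-1 <= lam n by near: n; move/cvgryPge : lamy; exact.
  have /andP[l u] := truncn_itv (ltW (lams n)).
  have -> : s^-1 - (Num.truncn (lam n / s))%:R / lam n =
      (lam n / s - (Num.truncn (lam n / s))%:R) / lam n.
    by rewrite mulrBl mulrAC divff ?gt_eqF// mul1r.
  rewrite normrM ger0_norm ?subr_ge0// ger0_norm ?invr_ge0 ?(ltW (lam0 n))//.
  rewrite ler_pdivrMr//.
  apply: (@le_trans _ _ 1); first by rewrite lerBlDr addrC natr1 ltW.
  by rewrite -(mulfV (lt0r_neq0 e0)) ler_pM2l.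
have c2 : H ((Num.truncn (lam n / s))%:R / lam n) @[n --> \oo] --> H s^-1.
  by apply: (cvg_comp _ _ c1); exact: H_continuous.
apply: cvg_trans c2; apply: near_eq_cvg.
have s2 : 0 < s^-1 / 2 by rewrite divr_gt0.
near=> n.
have l1 : (s^-1 / 2)^-1 <= lam n by near: n; move/cvgryPge : lamy; exact.
have k1 : (K n)%:R / lam n < s^-1 / 2.
  near: n; move/cvgrPdist_lt : K0 => /(_ _ s2); apply: filterS => n.
  by rewrite sub0r normrN ger0_norm// divr_ge0// ltW.
have n1 : s^-1 <= (N n)%:R / lam n by near: n; move/cvgryPge : Ny; exact.
have /andP[l u] := truncn_itv (ltW (lams n)).
have tK : (K n < Num.truncn (lam n / s))%N.
  rewrite -ltnS -(ltr_nat R); apply: le_lt_trans u.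
  rewrite -natr1.
  move: k1; rewrite ltr_pdivrMr// => k1.
  have : 1 <= s^-1 / 2 * lam n by rewrite mulrC -ler_pdivrMr// div1r.
  by rewrite (mulrC (lam n)); lra.
have tN : (Num.truncn (lam n / s) <= N n)%N.
  rewrite -(ler_nat R); apply: le_trans l _.
  by rewrite mulrC -ler_pdivlMr.
have tE : Num.truncn (lam n / s) = (Num.truncn (lam n / s)).-1.+1.
  by rewrite prednK// (leq_ltn_trans _ tK).
have kKN : (K n <= (Num.truncn (lam n / s)).-1 < N n)%N.
  by move: tK tN; case: (Num.truncn _) => [//|t] /=; lia.
by rewrite (PhiE s0 (I_in s0 tE)) kKN -tE.
Unshelve. all: by end_near. Qed.

Let measurable_Phi n : measurable_fun setT (Phi n).
Proof.
apply: measurable_sum => k; apply: measurable_funM; first exact: measurable_cst.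
by apply: measurable_indic; exact: measurable_itv.
Qed.

Let integral_Phi n : \int[mu]_(s in D) Phi n s =
  \sum_(K n <= k < N n) (lam n * (k.+1%:R * k.+2%:R)^-1 * H (k.+1%:R / lam n)).
Proof.
have iI k : mu.-integrable D (fun s => (\1_(I n k) s)%:E).
  apply: (@integrableS _ _ _ mu setT) => //; exact: integrable_indic_itv.
rewrite /Rintegral.
under eq_integral do rewrite -sumEFin.
rewrite integral_sum//; last first.
  by move=> k; under eq_fun do rewrite EFinM; exact: integrableZl.
rewrite -[RHS]/(fine (_%:E)) -sumEFin; congr fine; apply: eq_bigr => k _.
under eq_integral do rewrite EFinM.
rewrite integralZl// integral_indic//; last exact: measurable_itv.
have kl : lam n / k.+2%:R < lam n / k.+1%:R.
  by rewrite ltr_pM2l// ltf_pV2 ?posrE ?ltr0n// ltr_nat.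
rewrite (_ : I n k `&` D = I n k); last first.
  apply/setIidPl => s; rewrite /I /D /= !in_itv/= andbT => /andP[ls _].
  by apply: lt_trans ls; rewrite divr_gt0 ?ltr0n.
have muI : lebesgue_measure (I n k : set R) = (lam n / k.+1%:R - lam n / k.+2%:R)%:E.
  by rewrite lebesgue_measure_itv/= lte_fin kl -EFinB.
transitivity ((H (k.+1%:R / lam n))%:E * lebesgue_measure (I n k : set R))%E => //.
rewrite muI -EFinM; congr EFin.
have a0 : k.+1%:R != 0 :> R by rewrite pnatr_eq0.
have a1 : k.+2%:R != 0 :> R by rewrite pnatr_eq0.
rewrite mulrC; congr (_ * _); move: a1; rewrite -(natr1 k.+1).
by move: a0; move: (k.+1%:R : R) => a a0 a1; field; rewrite a0 a1.
Qed.

Let measurable_H_inv : measurable_fun D (fun s : R => H s^-1).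
Proof.
apply: open_continuous_measurable_fun; first exact: interval_open.
move=> s; rewrite inE /D /= in_itv/= andbT => s0.
apply: (@continuous_comp _ _ _ (fun x : R => x^-1) H).
  by apply: inv_continuous; rewrite gt_eqF.
by apply: H_continuous; rewrite invr_gt0.
Qed.

Let integrable_H_inv : mu.-integrable D (fun s : R => (H s^-1)%:E).
Proof.
apply: (le_integrable measurable_D _ _ dom_integrable); first exact/measurable_EFinP.
move=> s; rewrite /D /= in_itv/= andbT => s0; rewrite lee_fin ger0_norm//.
have si0 : 0 <= s^-1 by rewrite invr_ge0 ltW.
exact: (le_trans (dom_ge s0 si0 (lexx _)) (ler_norm _)).
Qed.

(** For [s] in [[1, 2]] the argument [s ^ (- g)] stays in [[2 ^ (- g), 1]], where cosine decreases,
    so the integrand is at least [1 - cos (2 ^ (- g)) > 0]. Positivity allows the scale [c] to be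
    solved for. *)
Lemma stable_const_gt0 : 0 < stable_const.
Proof.
pose J : set R := `[1, 2]%classic.
have mJ : measurable (J : set (measurableTypeR R)) by exact: measurable_itv.
have pi1 : 1 < pi :> R by apply: lt_le_trans (pi_ge2 R); rewrite ltr1n.
have pow_mono (x y : R) : 0 <= x -> x <= y -> x `^ g <= y `^ g.
  move=> x0 xy; apply: ge0_ler_powR; rewrite ?nnegrE ?(ltW g0)//.
  exact: le_trans xy.
have cos_mono (x y : R) : 0 <= x -> x <= y -> y <= 1 -> cos y <= cos x.
  move=> x0 xy y1; rewrite leNgt ltr_cos ?in_itv/= -?leNgt//; apply/andP; split; lra.
have h20 : 0 < (2^-1 : R) `^ g by rewrite powR_gt0.
have h21 (x : R) : 0 <= x -> x <= 1 -> x `^ g <= 1.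
  by move=> x0 x1; have := pow_mono _ _ x0 x1; rewrite powR1.
pose e := H 2^-1.
have e0 : 0 < e.
  have h : (2^-1 : R) `^ g <= 1 by apply: h21; rewrite ?invr_ge0// invf_le1// ler1n.
  have : cos ((2^-1 : R) `^ g) < cos 0.
    rewrite ltr_cos// in_itv/= ?lexx ?pi_ge0// (ltW h20)/=.
    by apply: (le_trans h); exact: ltW.
  by rewrite cos0 /e /H; lra.
have Hge s : J s -> e <= H s^-1.
  rewrite /J /= in_itv/= => /andP[s1 s2].
  have s0 : 0 < s by lra.
  have l1 : 2^-1 <= s^-1 by rewrite lef_pV2 ?posrE.
  have l2 : s^-1 <= 1 by rewrite invf_le1.
  rewrite lerB//; apply: cos_mono; first exact: powR_ge0.
    exact: pow_mono.
  by apply: h21 => //; rewrite invr_ge0 ltW.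
apply: (lt_le_trans e0).
have iJ : mu.-integrable D (fun s => (\1_J s)%:E).
  apply: (@integrableS _ _ _ mu setT) => //; exact: integrable_indic_itv.
have -> : e = \int[mu]_(s in D) (e * \1_J s).
  rewrite RintegralZl// /Rintegral integral_indic// (_ : J `&` D = J); last first.
    by apply/setIidPl => s; rewrite /J /D /= !in_itv/= andbT => /andP[s1 _]; lra.
  have muJ : lebesgue_measure (J : set R) = 1%:E.
    rewrite lebesgue_measure_itv/= lte_fin ltr1n/= -EFinD/=; congr EFin; ring.
  transitivity (e * fine (lebesgue_measure (J : set R))) => //.
  by rewrite muJ mulr1.
apply: le_Rintegral => //.
  rewrite (_ : _ \o _ = (fun s => (e%:E * (\1_J s)%:E)%E)); first exact: integrableZl.
  by apply/funext => s; rewrite -EFinM.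
move=> s _; rewrite indicE; have [Js|nJs] := pselect (J s).
  by rewrite mem_set// mulr1; exact: Hge.
by rewrite memNset// mulr0.
Qed.

Lemma riemann_sum_cvg :
  \sum_(K n <= k < N n) (lam n * (k.+1%:R * k.+2%:R)^-1 * (1 - cos ((k.+1%:R / lam n) `^ g)))
    @[n --> \oo] --> stable_const.
Proof.
have [] := @dominated_convergence _ _ _ mu D measurable_D
    (fun n s => (Phi n s)%:E) (fun s => (H s^-1)%:E) (fun s => (dom s)%:E).
- by move=> n; apply/measurable_EFinP; apply: measurable_funTS; exact: measurable_Phi.
- exact/measurable_EFinP.
- apply: aeW => s; rewrite /D /= in_itv/= andbT => s0.
  by apply/cvg_EFin; [exact: nearW|exact: Phi_cvg].
- exact: dom_integrable.
- apply: aeW => s n; rewrite /D /= in_itv/= andbT => s0.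
  by rewrite lee_fin ger0_norm//; exact: Phi_le.
move=> iH _ cv.
rewrite (_ : (fun n => _) = (fun n => \int[mu]_(s in D) Phi n s)); last first.
  by apply/funext => n; rewrite integral_Phi.
apply: fine_cvg; rewrite fineK//.
exact: integrable_fin_num.
Qed.

End riemann_sum.

(** * Levy's continuity theorem *)

Definition bounded_measurable (R : realType) (g : R -> R) : Prop :=
  measurable_fun setT g /\ exists K, forall x, `|g x| <= K.

Lemma continuous_bounded_measurable (R : realType) (g : R -> R) :
  continuous g -> bounded_fun g -> bounded_measurable g.
Proof.
move=> cg [K' [_ hK']]; split; first exact: continuous_measurable_fun.
exists (`|K'| + 1) => x; apply: hK' => //.
by apply: le_lt_trans (ler_norm _) _; rewrite ltrDl.
Qed.

Lemma continuous_cos_affine (R : realType) (theta s : R) :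
  continuous (fun y : R => cos (theta * y + s)).
Proof.
move=> y; apply: (@continuous_comp _ _ _ (fun x => theta * x + s) cos).
  by apply: continuousD; [apply: continuousM; [exact: cvg_cst|exact: cvg_id]|exact: cvg_cst].
exact: continuous_cos.
Qed.

Lemma bounded_cos_affine (R : realType) (theta s : R) :
  bounded_fun (fun y : R => cos (theta * y + s)).
Proof.
exists 1; split=> // r r1 y _.
by apply: le_trans (cos_max _) (ltW r1).
Qed.

Lemma bounded_measurable_cos (R : realType) (theta s : R) :
  bounded_measurable (fun y : R => cos (theta * y + s)).
Proof.
apply: continuous_bounded_measurable; first exact: continuous_cos_affine.
exact: bounded_cos_affine.
Qed.

Lemma Rintegral_close (R : realType) (d : measure_display) (X : measurableType d)
    (m : probability X R) (f h : X -> R) (B : set X) (Cf Ch K e : R) :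
  measurable_fun setT f -> measurable_fun setT h -> measurable B ->
  (forall x, `|f x| <= Cf) -> (forall x, `|h x| <= Ch) ->
  0 <= e -> 0 <= K ->
  (forall x, `|f x - h x| <= K) -> (forall x, ~ B x -> `|f x - h x| <= e) ->
  `|\int[m]_x f x - \int[m]_x h x| <= e + K * mass m B.
Proof.
move=> mf mh mB fC hC e0 K0 fhK fhe.
have If := bounded_integrable m mf fC; have Ih := bounded_integrable m mh hC.
have mfh : measurable_fun setT (fun x => f x - h x) by exact: measurable_funB.
rewrite -RintegralB//.
apply: (le_trans (le_normr_Rintegral _ (bounded_integrable m mfh fhK))) => //.
have -> : e + K * mass m B = \int[m]_x (e + K * \1_B x).
  rewrite RintegralD//.
  - by rewrite Rintegral_cst_prob RintegralZl// ?Rintegral_indic//; exact: integrable_indic.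
  - by apply: (@bounded_integrable _ _ _ m (cst e) `|e|) => //; exact: measurable_cst.
  - apply: (@bounded_integrable _ _ _ m (fun x => K * \1_B x) K) => [|x].
      by apply: measurable_funM => //; exact: measurable_cst.
    by rewrite normrM ger0_norm// ler_piMr// indicE; case: (_ \in _); rewrite ?normr1 ?normr0.
apply: le_Rintegral => //.
- apply: (@bounded_integrable _ _ _ m (fun x => `|f x - h x|) K) => [|x].
    exact: measurableT_comp.
  by rewrite normr_id.
- apply: (@bounded_integrable _ _ _ m (fun x => e + K * \1_B x) (e + K)) => [|x].
    apply: measurable_funD; first exact: measurable_cst.
    by apply: measurable_funM => //; exact: measurable_cst.
  apply: (le_trans (ler_normD _ _)); apply: lerD; first by rewrite ger0_norm.
  by rewrite normrM ger0_norm// ler_piMr// indicE; case: (_ \in _); rewrite ?normr1 ?normr0.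
move=> x _; rewrite indicE; have [Bx|nBx] := pselect (B x).
  by rewrite mem_set// mulr1 (le_trans (fhK _))// lerDr.
by rewrite memNset// mulr0 addr0; exact: fhe.
Qed.

(** * Means of test functions under the law of a random variable *)

Section law_functional.
Context (R : realType) (d : measure_display) (X : measurableType d)
  (m : probability X R) (V : X -> R).
Hypothesis mV : measurable_fun setT V.
Implicit Types g h : R -> R.

Lemma bounded_measurable_comp g : bounded_measurable g ->
  m.-integrable setT (EFin \o (g \o V)).
Proof.
move=> [mg [K gK]]; apply: (@bounded_integrable _ _ _ m (g \o V) K) => [|x].
  exact: measurableT_comp.
exact: gK.
Qed.

Lemma bounded_measurableD g h : bounded_measurable g -> bounded_measurable h ->
  bounded_measurable (fun x => g x + h x).
Proof.
move=> [mg [K gK]] [mh [K' hK]]; split; first exact: measurable_funD.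
by exists (K + K') => x; apply: (le_trans (ler_normD _ _)); exact: lerD.
Qed.

Lemma bounded_measurableZ (a : R) g : bounded_measurable g ->
  bounded_measurable (fun x => a * g x).
Proof.
move=> [mg [K gK]]; split.
  by apply: measurable_funM => //; exact: measurable_cst.
by exists (`|a| * K) => x; rewrite normrM ler_wpM2l.
Qed.

Lemma bounded_measurable_sum (I : Type) (s : seq I) (F : I -> R -> R) :
  (forall i, bounded_measurable (F i)) ->
  bounded_measurable (fun x => \sum_(i <- s) F i x).
Proof.
move=> mF; elim: s => [|i s ih].
  rewrite (_ : (fun x => _) = cst 0); last by apply/funext => x; rewrite big_nil.
  by split; [exact: measurable_cst|exists 0 => x; rewrite normr0].
rewrite (_ : (fun x => _) = fun x => F i x + \sum_(j <- s) F j x).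
  exact: bounded_measurableD.
by apply/funext => x; rewrite big_cons.
Qed.

Definition law_mean g : R := \int[m]_x g (V x).

Lemma law_meanD g h : bounded_measurable g -> bounded_measurable h ->
  law_mean (fun x => g x + h x) = law_mean g + law_mean h.
Proof.
by move=> bg bh; rewrite /law_mean RintegralD//; exact: bounded_measurable_comp.
Qed.

Lemma law_meanZ (a : R) g : bounded_measurable g ->
  law_mean (fun x => a * g x) = a * law_mean g.
Proof.
by move=> bg; rewrite /law_mean RintegralZl//; exact: bounded_measurable_comp.
Qed.

Lemma law_mean_cst (a : R) : law_mean (fun=> a) = a.
Proof. exact: Rintegral_cst_prob. Qed.

Lemma law_mean_sum (I : Type) (s : seq I) (F : I -> R -> R) :
  (forall i, bounded_measurable (F i)) ->
  law_mean (fun x => \sum_(i <- s) F i x) = \sum_(i <- s) law_mean (F i).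
Proof.
move=> mF; elim: s => [|i s ih].
  rewrite big_nil -[RHS](law_mean_cst 0); congr law_mean.
  by apply/funext => x; rewrite big_nil.
rewrite big_cons -ih -law_meanD//; last exact: bounded_measurable_sum.
by congr law_mean; apply/funext => x; rewrite big_cons.
Qed.

Lemma le_law_mean g h : bounded_measurable g -> bounded_measurable h ->
  (forall x, g x <= h x) -> law_mean g <= law_mean h.
Proof.
by move=> bg bh gh; apply: le_Rintegral => //; exact: bounded_measurable_comp.
Qed.

Lemma measurable_tail (M : R) : measurable [set x | M < `|V x|].
Proof.
rewrite (_ : [set x | _] = (fun x => `|V x|) @^-1` `]M, +oo[%classic).
  have mN : measurable_fun setT (fun x => `|V x|) by exact: measurableT_comp.
  by rewrite -[X in measurable X]setTI; apply: mN => //; exact: measurable_itv.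
by apply/seteqP; split => x /=; rewrite in_itv/= andbT.
Qed.

Lemma law_mean_close g h (K M e : R) :
  bounded_measurable g -> bounded_measurable h -> 0 <= e -> 0 <= K ->
  (forall x, `|g x - h x| <= K) -> (forall x, `|x| <= M -> `|g x - h x| <= e) ->
  `|law_mean g - law_mean h| <= e + K * mass m [set x | M < `|V x|].
Proof.
move=> [mg [Cg gC]] [mh [Ch hC]] e0 K0 ghK ghe.
apply: (@Rintegral_close _ _ _ m (g \o V) (h \o V) _ Cg Ch) => //.
- exact: measurableT_comp.
- exact: measurableT_comp.
- exact: measurable_tail.
- by move=> x; exact: gC.
- by move=> x; exact: hC.
- by move=> x; exact: ghK.
- by move=> x /= /negP; rewrite -leNgt; exact: ghe.
Qed.

End law_functional.

Lemma dist_unit_interval (R : realFieldType) (x y : R) :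
  0 <= x <= 1 -> 0 <= y <= 1 -> `|x - y| <= 1.
Proof.
move=> /andP[? ?] /andP[? ?]; rewrite ler_norml; apply/andP; split; lra.
Qed.

(** The Bernstein polynomial of [h] at [u], written as a mean over [N] coin tosses. A frequency
    within [delta] of [u] costs at most [e]; Chebyshev handles the rest, with variance
    [u (1 - u) / N <= 1 / N]. *)
Lemma bernstein_close (R : realType) (h : R -> R) (e delta u : R) (N : nat) :
  (0 < N)%N -> 0 < delta -> 0 <= u <= 1 ->
  (forall v : R, 0 <= v <= 1 -> 0 <= h v <= 1) ->
  (forall v w : R, 0 <= v <= 1 -> 0 <= w <= 1 -> `|v - w| <= delta -> `|h v - h w| <= e) ->
  `|bern_mean (fun _ : 'I_N => u) (fun b => h (N%:R^-1 * \sum_i (b i)%:R)) - h u| <=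
  e + (N%:R * delta ^+ 2)^-1.
Proof.
move=> N0 d0 u01 h01 hd.
have NR : 0 < N%:R :> R by rewrite ltr0n.
have p01 : forall i : 'I_N, 0 <= u <= 1 by [].
have e0 : 0 <= e by have := hd u u u01 u01; rewrite !subrr normr0; apply; exact: ltW.
pose mean (b : {ffun 'I_N -> bool}) : R := N%:R^-1 * \sum_i (b i)%:R.
have mean01 b : 0 <= mean b <= 1.
  rewrite /mean mulr_ge0 ?invr_ge0 ?(ltW NR)// ?sumr_ge0//= ler_pdivrMl// mulr1.
  rewrite (_ : N%:R = \sum_(i < N) 1); last by rewrite sumr_const card_ord.
  by apply: ler_sum => i _; case: (b i).
rewrite -[X in _ - X](bern_mean_cst (fun _ : 'I_N => u)) -mulN1r -bern_meanZ -bern_meanD.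
apply: (le_trans (ler_norm_bern_mean p01 _)).
apply: (@le_trans _ _ (bern_mean (fun _ : 'I_N => u)
    (fun b => e + (delta ^+ 2)^-1 * (\sum_i N%:R^-1 * ((b i)%:R - u)) ^+ 2))).
  apply: ler_bern_mean => // b; rewrite mulN1r.
  have -> : \sum_i N%:R^-1 * ((b i)%:R - u) = mean b - u.
    rewrite -mulr_sumr sumrB mulrBr sumr_const card_ord -[u *+ N]mulr_natl.
    by rewrite mulKf// gt_eqF.
  have [le|lt] := leP `|mean b - u| delta.
    apply: (le_trans (hd _ _ (mean01 b) u01 le)).
    by rewrite lerDl mulr_ge0 ?invr_ge0 ?sqr_ge0.
  apply: (@le_trans _ _ 1).
    by apply: dist_unit_interval; [exact: (h01 _ (mean01 b))|exact: (h01 _ u01)].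
  apply: (@le_trans _ _ ((delta ^+ 2)^-1 * (mean b - u) ^+ 2)).
    rewrite ler_pdivlMl ?exprn_gt0// mulr1 -[leRHS]real_normK ?num_real//.
    by rewrite lerXn2r ?nnegrE// ltW.
  by rewrite lerDr.
rewrite bern_meanD bern_mean_cst bern_meanZ bern_mean_var lerD2l.
have -> : (N%:R * delta ^+ 2)^-1 = (delta ^+ 2)^-1 * N%:R^-1 by rewrite invfM mulrC.
rewrite ler_pM2l ?invr_gt0 ?exprn_gt0// sumr_const card_ord -[leLHS]mulr_natl.
have -> : N%:R * (N%:R^-1 ^+ 2 * (u * (1 - u))) = N%:R^-1 * (u * (1 - u)).
  by field; rewrite gt_eqF.
rewrite ler_piMr ?invr_ge0 ?(ltW NR)//; have /andP[u0 u1] := u01.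
by rewrite mulr_ile1// ?subr_ge0// gerBl.
Qed.

(** A modulus of continuity for [acos], in contrapositive form. For [a <= b], with [c] the half sum
    and [h] the half difference, the right side is [2 sin c sin h], and [sin c >= sin h] leaves
    [2 (sin h) ^ 2 = 1 - cos (b - a)]. *)
Lemma cos_gap (R : realType) (a b e : R) : 0 <= a <= pi -> 0 <= b <= pi ->
  0 <= e <= pi -> e <= `|a - b| -> 1 - cos e <= `|cos a - cos b|.
Proof.
wlog ab : a b / a <= b.
  move=> hw ha hb he; have [ab|/ltW ab] := leP a b; first exact: hw.
  by rewrite distrC [X in _ -> _ <= X]distrC; exact: hw.
move=> /andP[a0 api] /andP[b0 bpi] /andP[e0 epi].
have pi0 := pi_gt0 R.
rewrite distrC ger0_norm ?subr_ge0// => eh.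
pose h := (b - a) / 2; pose c := (a + b) / 2.
have -> : cos a - cos b = 2 * (sin c * sin h).
  have -> : a = c - h by rewrite /c /h; lra.
  have -> : b = c + h by rewrite /c /h; lra.
  by rewrite cosB cosD; lra.
have sh0 : 0 <= sin h by apply: sin_ge0_pi; rewrite /h; apply/andP; split; lra.
have sch : sin h <= sin c.
  rewrite -subr_ge0.
  have -> : sin c - sin h = 2 * (cos (b / 2) * sin (a / 2)).
    have -> : c = b / 2 + a / 2 by rewrite /c; lra.
    have -> : h = b / 2 - a / 2 by rewrite /h; lra.
    by rewrite sinB sinD; lra.
  rewrite !mulr_ge0//.
    by apply: cos_ge0_pihalf; apply/andP; split; lra.
  by apply: sin_ge0_pi; apply/andP; split; lra.
apply: le_trans (ler_norm _).
apply: (@le_trans _ _ (2 * (sin h * sin h))); last first.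
  by rewrite ler_pM2l// ler_wpM2r.
have -> : 2 * (sin h * sin h) = 1 - cos (b - a).
  have -> : b - a = h + h by rewrite /h; lra.
  by rewrite cosD; have := cos2Dsin2 h; lra.
have bap : 0 <= b - a <= pi by apply/andP; split; lra.
have ep : 0 <= e <= pi by rewrite e0.
by rewrite lerB// leNgt ltr_cos ?in_itv//= -leNgt.
Qed.

(** * Convergence for Lipschitz functions by trigonometric approximation *)

Section bounded_test_functions.
Context (R : realType) (d : measure_display) (X : measurableType d)
  (m : probability X R) (Z : nat -> X -> R).
Hypothesis mZ : forall n, measurable_fun setT (Z n).
Hypothesis tight : forall e : R, 0 < e -> exists M : R, 0 < M /\
  \forall n \near \oo, mass m [set x | M < `|Z n x|] <= e.
Hypothesis cvg_cos : forall theta c : R,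
  cvgn (fun n => law_mean m (Z n) (fun x => cos (theta * x + c))).

(** No limit is named, since the limit law is not yet constructed; what matters is that these
    functions form a vector space. *)
Let good (g : R -> R) : Prop :=
  bounded_measurable g /\ cvgn (fun n => law_mean m (Z n) g).

Let goodD g h : good g -> good h -> good (fun x => g x + h x).
Proof.
move=> [bg cg] [bh ch]; split; first exact: bounded_measurableD.
under eq_fun do rewrite law_meanD//.
exact: is_cvgD.
Qed.

Let goodZ a g : good g -> good (fun x => a * g x).
Proof.
move=> [bg cg]; split; first exact: bounded_measurableZ.
by under eq_fun do rewrite law_meanZ//; apply: is_cvgMr.
Qed.

Let good_sum (I : Type) (s : seq I) (F : I -> R -> R) :
  (forall i, good (F i)) -> good (fun x => \sum_(i <- s) F i x).
Proof.
move=> mF; elim: s => [|i s ih].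
  rewrite (_ : (fun x => _) = cst 0); last by apply/funext => x; rewrite big_nil.
  split.
    by split; [exact: measurable_cst|exists 0 => x; rewrite normr0].
  by under eq_fun do rewrite law_mean_cst; exact: is_cvg_cst.
rewrite (_ : (fun x => _) = fun x => F i x + \sum_(j <- s) F j x).
  exact: goodD.
by apply/funext => x; rewrite big_cons.
Qed.

Let good_cos theta c : good (fun x => cos (theta * x + c)).
Proof.
by split => //; exact: bounded_measurable_cos.
Qed.

(** By the product-to-sum formulas each factor [bern] replaces the last cosine by three, two of them
    with shifted frequency and phase; hence the induction over all [theta'] and [c']. *)
Let good_bern theta c (s : seq bool) theta' c' :
  good (fun x => (\prod_(e <- s) bern ((1 + cos (theta * x + c)) / 2) e) *
    cos (theta' * x + c')).
Proof.
elim: s theta' c' => [|e s ih] theta' c'.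
  rewrite (_ : (fun x => _) = fun x => cos (theta' * x + c')); first exact: good_cos.
  by apply/funext => x; rewrite big_nil mul1r.
pose sg : R := if e then 1 else -1.
pose P x := \prod_(e <- s) bern ((1 + cos (theta * x + c)) / 2) e.
have -> : (fun x => (\prod_(e0 <- e :: s) bern ((1 + cos (theta * x + c)) / 2) e0) *
    cos (theta' * x + c')) =
  (fun x => 2^-1 * (P x * cos (theta' * x + c')) +
     ((sg / 4) * (P x * cos ((theta' + theta) * x + (c' + c))) +
      (sg / 4) * (P x * cos ((theta' - theta) * x + (c' - c))))).
  apply/funext => x; rewrite big_cons -/(P x).
  have -> : (theta' + theta) * x + (c' + c) = (theta' * x + c') + (theta * x + c) by ring.
  have -> : (theta' - theta) * x + (c' - c) = (theta' * x + c') - (theta * x + c) by ring.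
  move: (theta' * x + c') (theta * x + c) (P x) => A B q.
  by rewrite cosD cosB /bern /sg; case: (e); field.
by apply: goodD; [|apply: goodD]; apply: goodZ; exact: ih.
Qed.

Let good_bern_mean theta c N (H : {ffun 'I_N -> bool} -> R) :
  good (fun x => bern_mean (fun _ : 'I_N => (1 + cos (theta * x + c)) / 2) H).
Proof.
rewrite (_ : (fun x => _) = fun x => \sum_b H b *
   ((\prod_(e <- [seq b i | i <- index_enum 'I_N]) bern ((1 + cos (theta * x + c)) / 2) e)
     * cos (0 * x + 0))).
  by apply: good_sum => b; apply: goodZ; exact: good_bern.
apply/funext => x; apply: eq_bigr => b _.
by rewrite mul0r addr0 cos0 mulr1 mulrC big_map.
Qed.

(* [x |-> (1 + cos (theta * x + c)) / 2] is injective on [[-M, M]] for suitable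
   [theta] and [c]; a Bernstein polynomial in it is a trigonometric polynomial
   close to [g] there. *)
Lemma lipschitz_law_mean_cvg (g : R -> R) (K : R) : 0 < K ->
  bounded_measurable g -> (forall x, 0 <= g x <= 1) ->
  (forall x y, `|g x - g y| <= K * `|x - y|) ->
  cvgn (fun n => law_mean m (Z n) g).
Proof.
move=> K0 bg g01 gK.
apply/cauchy_cvgP/cauchyP => e e0.
have e8 : 0 < e / 16 by rewrite divr_gt0.
have [M [M0 tM]] := tight e8.
have pi0 := pi_gt0 R.
(* [psi] will invert [u] on [[- M, M]], where the angle [theta * x + c] sweeps [[0, pi]]. *)
pose r := M * 2 / pi.
have r0 : 0 < r by rewrite /r divr_gt0// mulr_gt0.
pose psi (v : R) := r * acos (v * 2 - 1) - M.
pose h v := g (psi v).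
have b01 (v : R) : 0 <= v <= 1 -> -1 <= v * 2 - 1 <= 1 by move=> /andP[? ?]; apply/andP; split; lra.
(* [K r e' <= e / 16] makes [h] vary by at most [e / 16]. Angles more than [e'] apart have cosines
   at least [1 - cos e'] apart, so [v] and [w] are then at least [2 * delta] apart. *)
pose e' := Num.min pi (e / 16 / (K * r)).
have e'0 : 0 < e' by rewrite lt_min pi0/= divr_gt0// mulr_gt0.
pose delta := (1 - cos e') / 4.
have delta0 : 0 < delta.
  rewrite divr_gt0// subr_gt0 -cos0 ltr_cos ?in_itv//= ?lexx ?(ltW pi0)//.
  by rewrite (ltW e'0)/= ge_min lexx.
have hd (v w : R) : 0 <= v <= 1 -> 0 <= w <= 1 -> `|v - w| <= delta -> `|h v - h w| <= e / 16.
  move=> v01 w01 vw.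
  have [av cv] := acos_def (b01 _ v01); have [aw cw] := acos_def (b01 _ w01).
  have le : `|acos (v * 2 - 1) - acos (w * 2 - 1)| <= e'.
    rewrite leNgt; apply/negP => lt.
    have e'pi : 0 <= e' <= pi by rewrite (ltW e'0)/= ge_min lexx.
    have := cos_gap av aw e'pi (ltW lt); rewrite cv cw.
    have -> : v * 2 - 1 - (w * 2 - 1) = 2 * (v - w) by ring.
    rewrite normrM ger0_norm// => gap.
    by move: vw delta0; rewrite /delta; lra.
  rewrite /h (le_trans (gK _ _))//.
  have -> : psi v - psi w = r * (acos (v * 2 - 1) - acos (w * 2 - 1)) by rewrite /psi; ring.
  rewrite normrM (gtr0_norm r0) mulrA -ler_pdivlMl ?(mulr_gt0 K0 r0)//.
  by rewrite [leRHS]mulrC (le_trans le)// ge_min lexx orbT.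
pose N := (Num.truncn ((delta ^+ 2)^-1 / (e / 16))).+1.
have N0 : 0 < N%:R :> R by rewrite ltr0n.
pose theta := pi / (M * 2); pose c := pi / 2 : R.
pose u x := (1 + cos (theta * x + c)) / 2.
have u01 x : 0 <= u x <= 1.
  by have := cos_geN1 (theta * x + c); have := cos_le1 (theta * x + c);
     rewrite /u => ? ?; apply/andP; split; lra.
pose H (b : {ffun 'I_N -> bool}) := h (N%:R^-1 * \sum_i (b i)%:R).
pose B x := bern_mean (fun _ : 'I_N => u x) H.
have [bB cB] : good B by exact: good_bern_mean.
have Bg x : `|x| <= M -> `|B x - g x| <= e / 8.
  rewrite ler_norml => /andP[x1 x2].
  have gh : g x = h (u x).
    rewrite /h /psi /u; congr g.
    have -> : (1 + cos (theta * x + c)) / 2 * 2 - 1 = cos (theta * x + c) by field.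
    have Mn0 : M != 0 by rewrite gt_eqF.
    have [E F G] : [/\ r * (theta * x + c) - M = x,
        theta * x + c = (x + M) * theta & pi = (M * 2) * theta].
      rewrite /r /theta /c; move: pi0; move: (@pi R) => q /lt0r_neq0 qn0.
      by split; field; rewrite ?Mn0.
    rewrite cosK ?E// in_itv/=.
    have th0 : 0 < theta by rewrite /theta divr_gt0// mulr_gt0.
    rewrite F mulr_ge0 ?(ltW th0)//=; last by lra.
    rewrite G.
    by rewrite ler_pM2r//; lra.
  rewrite gh.
  have := @bernstein_close R h (e / 16) delta (u x) N isT delta0 (u01 x)
    (fun v _ => g01 _) hd.
  move=> /le_trans; apply.
  rewrite (_ : e / 8 = e / 16 + e / 16); last by field.
  rewrite lerD2l invfM ler_pdivrMl// -ler_pdivrMr//.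
  by apply/ltW; rewrite truncnS_gt.
have B01 x : 0 <= B x <= 1.
  have p01 : forall i : 'I_N, 0 <= u x <= 1 by [].
  rewrite -(bern_mean_cst (fun _ : 'I_N => u x) 0).
  rewrite -[X in _ && (_ <= X)](bern_mean_cst (fun _ : 'I_N => u x)).
  by apply/andP; split; apply: ler_bern_mean => // b; have /andP[] := g01 (psi (N%:R^-1 * \sum_i (b i)%:R)).
have close n : mass m [set x | M < `|Z n x|] <= e / 16 ->
    `|law_mean m (Z n) B - law_mean m (Z n) g| <= e / 8 + e / 16.
  have Bg1 x : `|B x - g x| <= 1 by exact: dist_unit_interval.
  have e80 : 0 <= e / 8 by rewrite divr_ge0// ltW.
  move=> tn; apply: (le_trans (law_mean_close m (mZ n) bB bg e80 ler01 Bg1 Bg)).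
  by rewrite mul1r lerD2l.
have /cvgrPdist_lt/(_ (e / 16) e8) hl := cB.
(* The Cauchy criterion is met by a ball about the limit belonging to the trigonometric polynomial
   [B]. *)
exists (lim (law_mean m (Z n) B @[n --> \oo])).
have : \forall n \near \oo, `|lim (law_mean m (Z n) B @[n --> \oo]) - law_mean m (Z n) g| < e.
  near=> n.
  have c1 : `|law_mean m (Z n) B - law_mean m (Z n) g| <= e / 8 + e / 16.
    by apply: close; near: n; exact: tM.
  have c2 : `|lim (law_mean m (Z n) B @[n --> \oo]) - law_mean m (Z n) B| < e / 16.
    by near: n.
  rewrite (le_lt_trans (ler_distD (law_mean m (Z n) B) _ _))//.
  by lra.
by apply: filterS => n.
Unshelve. all: by end_near. Qed.

End bounded_test_functions.

(** * Distribution functions and piecewise linear test functions *)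

Section probability_of_cdf.
Context (R : realType) (F : R -> R).
Hypotheses (ndF : {homo F : x y / x <= y}) (rcF : right_continuous F)
  (F0 : F x @[x --> -oo] --> (0 : R)) (F1 : F x @[x --> +oo] --> (1 : R)).

#[local] HB.instance Definition _ := isCumulative.Build R _ R F ndF rcF.
#[local] HB.instance Definition _ := isCumulativeBounded.Build R 0 1 F F0 F1.

Lemma exists_probability_of_cdf :
  exists P : probability (measurableTypeR R) R, forall x, P `]-oo, x]%classic = (F x)%:E.
Proof.
exists (lebesgue_stieltjes_measure F) => x.
by rewrite -cdf_lebesgue_stieltjes_id.
Qed.

End probability_of_cdf.

Section ramp.
Context {R : realType}.
Implicit Types s t x y : R.

(** Equal to 1 left of [s], to 0 right of [t], and affine between. Written with positive parts,
    ramps over consecutive intervals telescope. *)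
Definition ramp s t x : R := (Num.max 0 (t - x) - Num.max 0 (s - x)) / (t - s).

Lemma ramp_left s t x : s < t -> x <= s -> ramp s t x = 1.
Proof.
move=> st xs; rewrite /ramp !max_r ?subr_ge0//; last by lra.
rewrite (_ : t - x - (s - x) = t - s); last by ring.
by rewrite divff// subr_eq0 gt_eqF.
Qed.

Lemma ramp_right s t x : s < t -> t <= x -> ramp s t x = 0.
Proof.
by move=> st tx; rewrite /ramp !max_l ?subr_le0//; [rewrite subrr mul0r|lra].
Qed.

Lemma ramp01 s t x : s < t -> 0 <= ramp s t x <= 1.
Proof.
move=> st; have st0 : 0 < t - s by rewrite subr_gt0.
rewrite /ramp divr_ge0 ?ler_pdivrMr ?mul1r ?(ltW st0)//= ;
  by case: (leP 0 (t - x)); case: (leP 0 (s - x)); lra.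
Qed.

Lemma ramp_lipschitz s t x y : s < t ->
  `|ramp s t x - ramp s t y| <= (t - s)^-1 * `|x - y|.
Proof.
move=> st; have st0 : 0 < t - s by rewrite subr_gt0.
rewrite /ramp -mulrBl normrM [X in _ * X]gtr0_norm ?invr_gt0// mulrC.
rewrite ler_pM2l ?invr_gt0//.
wlog xy : x y / x <= y.
  move=> hw; have [xy|/ltW yx] := leP x y; first exact: hw.
  by rewrite distrC [leRHS]distrC; exact: hw.
rewrite [leRHS]distrC [leRHS]ger0_norm ?subr_ge0// ler_norml.
apply/andP; case: (leP 0 (t - x)); case: (leP 0 (s - x));
  case: (leP 0 (t - y)); case: (leP 0 (s - y)); move=> ? ? ? ?; split; lra.
Qed.

Lemma ramp_bounded_measurable s t : s < t -> bounded_measurable (ramp s t).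
Proof.
move=> st; split; last first.
  by exists 1 => x; have /andP[? ?] := ramp01 x st; rewrite ger0_norm.
apply: measurable_funM; last exact: measurable_cst.
apply: measurable_funB; apply: measurable_maxr; [exact: measurable_cst| |exact: measurable_cst|];
  by apply: measurable_funB => //; exact: measurable_cst.
Qed.

Lemma ramp_mean s t x (r : nat) : s < t -> (0 < r)%N ->
  let y (j : nat) := s + j%:R * ((t - s) / r%:R) in
  ramp s t x = r%:R^-1 * \sum_(0 <= j < r) ramp (y j) (y j.+1) x.
Proof.
move=> st r0 y; have rR : 0 < r%:R :> R by rewrite ltr0n.
have h0 : 0 < (t - s) / r%:R by rewrite divr_gt0// subr_gt0.
transitivity (r%:R^-1 * (((t - s) / r%:R)^-1 *
    \sum_(0 <= j < r) (Num.max 0 (y j.+1 - x) - Num.max 0 (y j - x)))).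
  rewrite telescope_sumr// /ramp.
  have -> : y r = t by rewrite /y mulrC divfK ?gt_eqF// addrC subrK.
  have -> : y 0%N = s by rewrite /y mul0r addr0.
  field; rewrite (gt_eqF rR) subr_eq0 gt_eqF//.
congr (_ * _); rewrite mulr_sumr; apply: eq_bigr => j _.
rewrite /ramp mulrC; congr (_ / _); rewrite /y -natr1; ring.
Qed.

End ramp.

(** Only [x] is confined to the segment while [y] may leave it; the covering form of compactness
    gives this stronger version directly. *)
Lemma uniformly_continuous_segment (R : realType) (g : R -> R) (M e : R) :
  continuous g -> 0 < e ->
  exists n : nat, forall x y, `|x| <= M -> `|x - y| <= n.+1%:R^-1 -> `|g x - g y| <= e.
Proof.
move=> cg e0.
have cov := (compact_near_coveringP _).1 (@segment_compact R (- M) M) nat \oo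
  (fun n x => forall y, `|x - y| <= n.+1%:R^-1 -> `|g x - g y| <= e).
suff [n _ hn] : \forall n \near \oo, `[- M, M]%classic `<=`
    (fun x => forall y, `|x - y| <= n.+1%:R^-1 -> `|g x - g y| <= e).
  exists n => x y xM; apply: (hn n (leqnn _)).
  by rewrite /= in_itv/= -ler_norml.
apply: cov => x _.
have e2 : 0 < e / 2 by rewrite divr_gt0.
have /nbhs_ballP[r /= r0 hr] : nbhs x [set y | `|g x - g y| < e / 2].
  by have /cvgrPdist_lt/(_ (e / 2) e2) := cg x.
have r2 : 0 < r / 2 by rewrite divr_gt0.
near=> x' n => /= y x'y.
have xx' : `|x - x'| < r / 2 by near: x'; apply: cvgr_dist_lt; rewrite ?divr_gt0//; exact: cvg_id.
have xy : `|x - y| < r.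
  apply: (le_lt_trans (ler_distD x' _ _)).
  have n2 : n.+1%:R^-1 < r / 2.
    by near: n; exact: (near_infty_natSinv_lt (PosNum r2)).
  have := le_lt_trans x'y n2; lra.
have a1 : `|g x - g x'| < e / 2 by apply: hr; rewrite /ball/=; lra.
have a2 : `|g x - g y| < e / 2 by exact: hr.
rewrite distrC in a1.
by apply: (le_trans (ler_distD (g x) _ _)); lra.
Unshelve. all: by end_near. Qed.

(** * Construction and identification of the limit law *)

Section levy_continuity.
Context (R : realType) (d : measure_display) (X : measurableType d)
  (m : probability X R) (Z : nat -> X -> R).
Hypothesis mZ : forall n, measurable_fun setT (Z n).
Hypothesis tight : forall e : R, 0 < e -> exists M : R, 0 < M /\
  \forall n \near \oo, mass m [set x | M < `|Z n x|] <= e.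
Hypothesis cvg_cos : forall theta c : R,
  cvgn (fun n => law_mean m (Z n) (fun x => cos (theta * x + c))).

Let ramp_lim (s t : R) : R := lim (law_mean m (Z n) (ramp s t) @[n --> \oo]).

Let cvg_ramp s t : s < t -> law_mean m (Z n) (ramp s t) @[n --> \oo] --> ramp_lim s t.
Proof.
move=> st; apply: (@lipschitz_law_mean_cvg _ _ _ m Z mZ tight cvg_cos _ (t - s)^-1).
- by rewrite invr_gt0 subr_gt0.
- exact: ramp_bounded_measurable.
- by move=> x; exact: ramp01.
- by move=> x y; exact: ramp_lipschitz.
Qed.

Let bounded_measurable_cst (a : R) : bounded_measurable (fun=> a : R).
Proof. by split; [exact: measurable_cst|exists `|a|]. Qed.

Let ramp_lim01 s t : s < t -> 0 <= ramp_lim s t <= 1.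
Proof.
move=> st; have bst := ramp_bounded_measurable st.
apply/andP; split.
  apply: (cvgr_to_ge (cvg_ramp st)); apply: nearW => n.
  rewrite -(law_mean_cst m (Z n) 0); apply: le_law_mean => // x.
  by have /andP[] := ramp01 x st.
apply: (cvgr_to_le (cvg_ramp st)); apply: nearW => n.
rewrite -(law_mean_cst m (Z n) 1); apply: le_law_mean => // x.
by have /andP[] := ramp01 x st.
Qed.

Let ramp_le (s t s' t' : R) : s < t -> t <= s' -> s' < t' -> forall x, ramp s t x <= ramp s' t' x.
Proof.
move=> st ts st' x; have [xt|/ltW tx] := leP x t.
  rewrite [leRHS]ramp_left//; last exact: le_trans ts.
  by have /andP[] := ramp01 x st.
by rewrite ramp_right//; have /andP[] := ramp01 x st'.
Qed.

Let ramp_lim_le s t s' t' : s < t -> t <= s' -> s' < t' -> ramp_lim s t <= ramp_lim s' t'.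
Proof.
move=> st ts st'; apply: (ler_cvg_to (cvg_ramp st) (cvg_ramp st')).
apply: nearW => n; apply: le_law_mean => //; [exact: ramp_bounded_measurable..|].
exact: ramp_le.
Qed.

(** Taking the infimum over ramps that start strictly to the right of [x] makes [F]
    right-continuous, with [F x <= ramp_lim s t <= F t] for [x < s < t]. No subsequence has to be
    selected, as the means of each ramp converge along the whole sequence. *)
Let cdf_set (x : R) : set R := [set y | exists s t, [/\ x < s, s < t & y = ramp_lim s t]].

Let F (x : R) : R := inf (cdf_set x).

Let cdf_set_ne x : cdf_set x !=set0.
Proof. by exists (ramp_lim (x + 1) (x + 2)), (x + 1), (x + 2); split => //; lra. Qed.

Let cdf_set_lb x : has_lbound (cdf_set x).
Proof. by exists 0 => _ [s [t [_ st ->]]]; have /andP[] := ramp_lim01 st. Qed.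

Let F_le x s t : x < s -> s < t -> F x <= ramp_lim s t.
Proof. by move=> xs st; apply: ge_inf => //; exists s, t. Qed.

Let F_ge x a : (forall s t, x < s -> s < t -> a <= ramp_lim s t) -> a <= F x.
Proof. by move=> h; apply: lb_le_inf => // _ [s [t [xs st ->]]]; exact: h. Qed.

Let ramp_lim_le_F s t : s < t -> ramp_lim s t <= F t.
Proof. by move=> st; apply: F_ge => s' t' ts st'; apply: ramp_lim_le => //; exact: ltW. Qed.

Let F_nd : {homo F : x y / x <= y}.
Proof. by move=> x y xy; apply: F_ge => s t ys st; apply: F_le => //; exact: le_lt_trans ys. Qed.

Let F01 x : 0 <= F x <= 1.
Proof.
apply/andP; split.
  by apply: F_ge => s t _ st; have /andP[] := ramp_lim01 st.
have l1 : x < x + 1 by lra.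
have l2 : x + 1 < x + 2 by lra.
by apply: (le_trans (F_le l1 l2)); have /andP[] := ramp_lim01 l2.
Qed.

Let F_rc : right_continuous F.
Proof.
move=> x; apply/cvgrPdist_lt => e e0.
have [_ [s [t [xs st ->]]]] := inf_adherent e0 (conj (cdf_set_ne x) (cdf_set_lb x)).
rewrite -/(F x) => lt.
near=> y.
have xy : x <= y by [].
have ys : y < s by near: y; exact: nbhs_right_lt.
have := F_nd xy; have := F_le ys st => a b.
by rewrite distrC ger0_norm ?subr_ge0//; lra.
Unshelve. all: by end_near. Qed.

Let F_hi e : 0 < e -> exists M, forall x, M <= x -> 1 - e <= F x.
Proof.
move=> e0; have [M [M0 tM]] := tight e0; exists M => x Mx.
apply: F_ge => s t xs st; apply: (cvgr_to_ge (cvg_ramp st)).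
near=> n.
have tn : mass m [set x | M < `|Z n x|] <= e by near: n.
have := @law_mean_close _ _ _ m _ (mZ n) _ _ 1 M 0
  (bounded_measurable_cst 1) (ramp_bounded_measurable st) (lexx 0) ler01.
rewrite (law_mean_cst m (Z n)) mul1r add0r => h.
have : `|1 - law_mean m (Z n) (ramp s t)| <= mass m [set x | M < `|Z n x|].
  apply: h => z; first by have /andP[? ?] := ramp01 z st; rewrite ger0_norm; lra.
  by rewrite ler_norml => /andP[_ zM]; rewrite ramp_left ?subrr ?normr0//; lra.
by rewrite ler_norml => /andP[? ?]; lra.
Unshelve. all: by end_near. Qed.

Let F_lo e : 0 < e -> exists M, forall x, x <= M -> F x <= e.
Proof.
(* The ramp from [x + 1] to [x + 2] has to vanish on [[- M, M]]. *)
move=> e0; have [M [M0 tM]] := tight e0; exists (- M - 3) => x Mx.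
have l1 : x < x + 1 by lra.
have l2 : x + 1 < x + 2 by lra.
apply: (le_trans (F_le l1 l2)); apply: (cvgr_to_le (cvg_ramp l2)).
near=> n.
have tn : mass m [set x | M < `|Z n x|] <= e by near: n.
have := @law_mean_close _ _ _ m _ (mZ n) _ _ 1 M 0
  (ramp_bounded_measurable l2) (bounded_measurable_cst 0) (lexx 0) ler01.
rewrite (law_mean_cst m (Z n)) mul1r add0r => h.
have : `|law_mean m (Z n) (ramp (x + 1) (x + 2)) - 0| <= mass m [set x | M < `|Z n x|].
  apply: h => z; rewrite subr0.
    by have /andP[? ?] := ramp01 z l2; rewrite ger0_norm.
  by rewrite ler_norml => /andP[zM _]; rewrite ramp_right ?normr0//; lra.
by rewrite subr0 ler_norml => /andP[? ?]; lra.
Unshelve. all: by end_near. Qed.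

Let F_y : F x @[x --> +oo] --> (1 : R).
Proof.
apply/cvgrPdist_le => e e0; have [M hM] := F_hi e0.
near=> x; have : M <= x by near: x; apply: nbhs_pinfty_ge; exact: num_real.
move=> /hM h; have /andP[_ F1] := F01 x.
by rewrite ger0_norm ?subr_ge0//; lra.
Unshelve. all: by end_near. Qed.

Let F_Ny : F x @[x --> -oo] --> (0 : R).
Proof.
apply/cvgrPdist_le => e e0; have [M hM] := F_lo e0.
near=> x; have : x <= M by near: x; apply: nbhs_ninfty_le; exact: num_real.
by move=> /hM h; have /andP[F0 _] := F01 x; rewrite sub0r normrN ger0_norm.
Unshelve. all: by end_near. Qed.

Let idR : measurableTypeR R -> R := idfun.

Let m_idR : measurable_fun setT idR.
Proof. exact: measurable_id. Qed.

Section limit_law.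
Variable P : probability (measurableTypeR R) R.
Hypothesis PF : forall x, P `]-oo, x]%classic = (F x)%:E.

Let P_ramp_le s t : s < t -> law_mean P idR (ramp s t) <= F t.
Proof.
move=> st; have -> : F t = mass P `]-oo, t]%classic by rewrite /mass PF.
rewrite -Rintegral_indic//; apply: le_Rintegral => //.
- exact: (bounded_measurable_comp P m_idR (ramp_bounded_measurable st)).
- exact: integrable_indic.
move=> x _; rewrite indicE; have [xt|tx] := leP (x : R) t.
  by rewrite mem_set ?/= ?in_itv//=; have /andP[] := ramp01 (x : R) st.
by rewrite ramp_right// ltW.
Qed.

Let P_ramp_ge s t : s < t -> F s <= law_mean P idR (ramp s t).
Proof.
move=> st; have -> : F s = mass P `]-oo, s]%classic by rewrite /mass PF.
rewrite -Rintegral_indic//; apply: le_Rintegral => //.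
- exact: integrable_indic.
- exact: (bounded_measurable_comp P m_idR (ramp_bounded_measurable st)).
move=> x _; rewrite indicE; have [xs|sx] := leP (x : R) s.
  by rewrite [leRHS]ramp_left//; case: (_ \in _).
rewrite memNset; first by have /andP[] := ramp01 (x : R) st.
by rewrite /= in_itv/= leNgt sx.
Qed.

Let cvg_law_sum (N : nat) (G : nat -> R -> R) (l : nat -> R) :
  (forall i, bounded_measurable (G i)) ->
  (forall i, law_mean m (Z n) (G i) @[n --> \oo] --> l i) ->
  law_mean m (Z n) (fun x => \sum_(0 <= i < N) G i x) @[n --> \oo] -->
    \sum_(0 <= i < N) l i.
Proof.
move=> bG cG; under eq_fun do rewrite law_mean_sum//.
elim: N => [|N ih].
  by rewrite big_geq//; under eq_fun do rewrite big_geq//; exact: cvg_cst.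
rewrite big_nat_recr//=.
rewrite (_ : (fun n => _) = (fun n => \sum_(0 <= i < N) law_mean m (Z n) (G i) +
  law_mean m (Z n) (G N))); first exact: cvgD.
by apply/funext => n; rewrite big_nat_recr.
Qed.

(* [ramp s t] is the mean of [r] shorter ramps; for each of them both sides lie
   between neighbouring values of [F], and these errors telescope. *)
Let ramp_lim_mean s t : s < t -> ramp_lim s t = law_mean P idR (ramp s t).
Proof.
move=> st.
have close (r : nat) : (0 < r)%N ->
    `|ramp_lim s t - law_mean P idR (ramp s t)| <= r%:R^-1 * 2.
  move=> r0; have rR : 0 < r%:R :> R by rewrite ltr0n.
  pose h := (t - s) / r%:R.
  have h0 : 0 < h by rewrite divr_gt0// subr_gt0.
  pose y (j : nat) := s + j%:R * h.
  (* The grid [z] has one node left of [s], because [F_le] bounds [ramp_lim] from below only by [F]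
     strictly left of the ramp. Both means of ramp [j] lie between [F (z j)] and [F (z j.+2)], and
     these gaps add up to at most 2. *)
  pose z (j : nat) := s - h + j%:R * h.
  have yz j : y j = z j.+1 by rewrite /y /z -natr1; ring.
  have zS j : z j < z j.+1 by rewrite /z -natr1; lra.
  have yS j : y j < y j.+1 by rewrite !yz.
  have bmy j := ramp_bounded_measurable (yS j).
  have rE : ramp s t = fun x => r%:R^-1 * \sum_(0 <= j < r) ramp (y j) (y j.+1) x.
    by apply/funext => x; exact: ramp_mean.
  have bS : bounded_measurable (fun x => \sum_(0 <= j < r) ramp (y j) (y j.+1) x).
    exact: bounded_measurable_sum.
  have e1 : ramp_lim s t = r%:R^-1 * \sum_(0 <= j < r) ramp_lim (y j) (y j.+1).
    apply: (cvg_unique _ (cvg_ramp st)) => //.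
    rewrite (_ : (fun n => _) = (fun n => r%:R^-1 *
        law_mean m (Z n) (fun x => \sum_(0 <= j < r) ramp (y j) (y j.+1) x))); last first.
      by apply/funext => n; rewrite rE law_meanZ.
    apply: cvgMr; apply: (@cvg_law_sum r (fun j => ramp (y j) (y j.+1))
      (fun j => ramp_lim (y j) (y j.+1))) => // i; exact: cvg_ramp.
  have e2 : law_mean P idR (ramp s t) =
      r%:R^-1 * \sum_(0 <= j < r) law_mean P idR (ramp (y j) (y j.+1)).
    by rewrite {1}rE law_meanZ// law_mean_sum.
  rewrite e1 e2 -mulrBr normrM gtr0_norm ?invr_gt0// ler_pM2l ?invr_gt0// -sumrB.
  apply: (le_trans (ler_norm_sum _ _ _)).
  apply: (@le_trans _ _ (\sum_(0 <= j < r) ((F (z j.+2) - F (z j.+1)) + (F (z j.+1) - F (z j))))).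
    apply: ler_sum => j _; rewrite !yz.
    have := F_le (zS j) (zS j.+1); have := ramp_lim_le_F (zS j.+1).
    have := P_ramp_le (zS j.+1); have := P_ramp_ge (zS j.+1).
    have := F_nd (ltW (zS j)).
    by move=> ? ? ? ? ?; rewrite ler_norml; apply/andP; split; lra.
  have T1 := telescope_sumr (fun j => F (z j.+1)) (leq0n r).
  have T2 := telescope_sumr (fun j => F (z j)) (leq0n r).
  rewrite big_split/= T1 T2.
  have /andP[? ?] := F01 (z r); have /andP[? ?] := F01 (z r.+1).
  by have /andP[? ?] := F01 (z 0%N); have /andP[? ?] := F01 (z 1%N); lra.
apply/eqP; rewrite -subr_eq0 -normr_eq0; apply/negPn/negP => ne.
have D0 : 0 < `|ramp_lim s t - law_mean P idR (ramp s t)| by rewrite lt0r ne normr_ge0.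
set D := `|_ - _| in close D0.
have := close (Num.truncn (2 / D)).+1 isT; rewrite leNgt => /negP; apply.
rewrite ltr_pdivrMl ?ltr0n// -ltr_pdivrMr//.
by rewrite truncnS_gt.
Qed.

(** On [[- M, M]] the function is uniformly close to its piecewise linear interpolant, a constant
    plus a combination of ramps, to which [ramp_lim_mean] applies. Off the segment both are bounded
    by [K], and the laws of [Z n] and [P] have little mass there. *)
Lemma law_mean_cvg (g : R -> R) : continuous g -> bounded_fun g ->
  law_mean m (Z n) g @[n --> \oo] --> law_mean P idR g.
Proof.
move=> cg fg; have bg := continuous_bounded_measurable cg fg.
have [K K0 gK] : exists2 K : R, 0 < K & forall x, `|g x| <= K.
  have [_ [K' gK']] := bg; exists (`|K'| + 1); first by rewrite ltr_wpDl.
  by move=> x; apply: (le_trans (gK' x)); have := ler_norm K'; lra.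
apply/cvgrPdist_le => e e0.
pose q := e / (16 * K).
have q0 : 0 < q by rewrite divr_gt0// mulr_gt0.
have Kq : 2 * K * q = e / 8 by rewrite /q; field; rewrite gt_eqF.
have [M1 [M10 tM1]] := tight q0.
have q20 : 0 < q / 2 by rewrite divr_gt0.
have [M2 hM2] := F_hi q20.
have [M3 hM3] := F_lo q20.
pose M := `|M1| + `|M2| + `|M3|.
have MM1 : M1 <= M.
  by have := ler_norm M1; have := normr_ge0 M2; have := normr_ge0 M3; rewrite /M; lra.
have MM2 : M2 <= M.
  by have := ler_norm M2; have := normr_ge0 M1; have := normr_ge0 M3; rewrite /M; lra.
have MM3 : - M <= M3.
  by have := lerNnormlW (lexx `|M3|); have := normr_ge0 M1; have := normr_ge0 M2; rewrite /M; lra.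
have tZ : \forall n \near \oo, mass m [set x | M < `|Z n x|] <= q.
  apply: filterS tM1 => n; apply: le_trans; apply: le_mass.
  - exact: measurable_tail.
  - exact: measurable_tail.
  - by move=> x /=; exact: le_lt_trans.
have tP : mass P [set x | M < `|idR x|] <= q.
  apply: (@le_trans _ _ (mass P `]-oo, - M]%classic + mass P (~` `]-oo, M]%classic))).
    apply: (@le_trans _ _ (mass P (`]-oo, - M]%classic `|` ~` `]-oo, M]%classic))).
      apply: le_mass.
      - exact: (measurable_tail m_idR).
      - by apply: measurableU => //; apply: measurableC.
      - move=> x /=; rewrite /idR/= ltr_normr in_itv/= => /orP[Mx|Mx].
          by right; rewrite /= in_itv/=; apply/negP; rewrite -ltNge.
        by left; lra.
    by apply: massU2 => //; apply: measurableC.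
  have -> : mass P (~` `]-oo, M]%classic) = 1 - F M.
    by rewrite /mass probability_setC// PF.
  have -> : mass P `]-oo, - M]%classic = F (- M) by rewrite /mass PF.
  by have := hM2 _ MM2; have := hM3 _ MM3; lra.
have e8 : 0 < e / 8 by rewrite divr_gt0.
have [k hk] := uniformly_continuous_segment M cg e8.
pose h : R := k.+1%:R^-1.
have h0 : 0 < h by rewrite invr_gt0.
pose y (j : nat) : R := - M + j%:R * h.
have yS j : y j < y j.+1 by rewrite /y -natr1; lra.
have bmy j := ramp_bounded_measurable (yS j).
(* The interpolant after summation by parts; it is constant, equal to [g (y 0)] on the left of the
   grid and to [g (y N)] on the right. *)
pose S (N : nat) (x : R) := g (y N) + \sum_(0 <= i < N) (g (y i) - g (y i.+1)) * ramp (y i) (y i.+1) x.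
have y_mono i j : (i <= j)%N -> y i <= y j.
  by move=> ij; rewrite lerD2l ler_wpM2r ?ler_nat// ltW.
(* A further interval changes [S] only beyond [y N], where the value is a convex combination of
   [g (y N)] and [g (y N.+1)]; the two bounds below follow by induction. *)
have SS N x : S N.+1 x = if x <= y N then S N x else
    g (y N) + (g (y N.+1) - g (y N)) * (1 - ramp (y N) (y N.+1) x).
  rewrite /S big_nat_recr//=; case: ifPn => [xy|].
    by rewrite ramp_left//; ring.
  rewrite -ltNge => yx; rewrite big_nat big1 => [|i /andP[_ iN]]; first by ring.
  by rewrite ramp_right ?mulr0//; apply: le_trans (ltW yx); exact: y_mono.
have SK N x : `|S N x| <= K.
  elim: N => [|N ih]; first by rewrite /S big_geq// addr0.
  rewrite SS; case: ifP => // _.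
  have /andP[r0 r1] := ramp01 x (yS N).
  move: (gK (y N)) (gK (y N.+1)); rewrite !ler_norml => /andP[? ?] /andP[? ?].
  by apply/andP; split; nra.
have Sg N x : `|x| <= M -> x <= y N -> `|S N x - g x| <= e / 8.
  elim: N => [|N ih] xM xy.
    have -> : x = y 0%N.
      move: xy xM; rewrite /y mul0r addr0 ler_norml => ? /andP[? _].
      by apply/eqP; rewrite eq_le; apply/andP; split.
    by rewrite /S big_geq// addr0 subrr normr0 ltW.
  rewrite SS; case: (leP x (y N)) => [xN|yx]; first exact: ih.
  have /andP[r0 r1] := ramp01 x (yS N).
  have dh : y N.+1 = y N + h by rewrite /y -natr1; ring.
  have : `|g x - g (y N)| <= e / 8.
    by apply: hk => //; rewrite -/h ger0_norm; lra.
  have : `|g x - g (y N.+1)| <= e / 8.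
    by apply: hk => //; rewrite -/h distrC ger0_norm; lra.
  rewrite !ler_norml => /andP[? ?] /andP[? ?].
  by apply/andP; split; nra.
pose N := (Num.truncn (2 * M / h)).+1.
have yN : M <= y N.
  have : 2 * M / h < N%:R by rewrite truncnS_gt.
  by rewrite ltr_pdivrMr// /y; lra.
have bterm i : bounded_measurable (fun x => (g (y i) - g (y i.+1)) * ramp (y i) (y i.+1) x).
  exact: bounded_measurableZ.
have bsum : bounded_measurable (fun x => \sum_(0 <= i < N) (g (y i) - g (y i.+1)) * ramp (y i) (y i.+1) x).
  exact: bounded_measurable_sum.
have bS : bounded_measurable (S N) by exact: bounded_measurableD.
have cS : law_mean m (Z n) (S N) @[n --> \oo] --> law_mean P idR (S N).
  rewrite (_ : (fun n => _) = (fun n => g (y N) + law_mean m (Z n)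
      (fun x => \sum_(0 <= i < N) (g (y i) - g (y i.+1)) * ramp (y i) (y i.+1) x))); last first.
    by apply/funext => n; rewrite /S law_meanD// law_mean_cst.
  rewrite /S law_meanD// law_mean_cst law_mean_sum//.
  apply: cvgD; first exact: cvg_cst.
  apply: (@cvg_law_sum N (fun i x => (g (y i) - g (y i.+1)) * ramp (y i) (y i.+1) x)
    (fun i => law_mean P idR (fun x => (g (y i) - g (y i.+1)) * ramp (y i) (y i.+1) x))) => // i.
  rewrite (_ : (fun n => _) = (fun n => (g (y i) - g (y i.+1)) *
      law_mean m (Z n) (ramp (y i) (y i.+1)))); last first.
    by apply/funext => n; rewrite law_meanZ.
  rewrite law_meanZ//.
  by apply: cvgMr; rewrite -ramp_lim_mean//; exact: cvg_ramp.
have Sg2 x : `|S N x - g x| <= 2 * K.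
  by apply: (le_trans (ler_normB _ _)); have := SK N x; have := gK x; lra.
have Sg1 x : `|x| <= M -> `|S N x - g x| <= e / 8.
  by move=> xM; apply: Sg => //; apply: le_trans yN; exact: le_trans (ler_norm _) xM.
have K2 : 0 <= 2 * K by lra.
have cP : `|law_mean P idR (S N) - law_mean P idR g| <= e / 8 + e / 8.
  apply: (le_trans (law_mean_close P m_idR bS bg (ltW e8) K2 Sg2 Sg1)).
  by rewrite lerD2l -Kq ler_wpM2l.
move/cvgrPdist_le/(_ _ e8) : cS => cS.
near=> n.
have tn : mass m [set x | M < `|Z n x|] <= q by near: n.
have cn : `|law_mean m (Z n) (S N) - law_mean m (Z n) g| <= e / 8 + e / 8.
  apply: (le_trans (law_mean_close m (mZ n) bS bg (ltW e8) K2 Sg2 Sg1)).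
  by rewrite lerD2l -Kq ler_wpM2l.
have sn : `|law_mean P idR (S N) - law_mean m (Z n) (S N)| <= e / 8 by near: n.
move: cP cn sn; rewrite !ler_norml => /andP[? ?] /andP[? ?] /andP[? ?].
by apply/andP; split; lra.
Unshelve. all: by end_near. Qed.

End limit_law.

(** Tightness stands in for continuity of the limit characteristic function at 0. Cosines of every
    phase are assumed to have convergent means, which covers the sines. *)
Theorem levy_continuity : exists P : probability (measurableTypeR R) R,
  forall g : R -> R, continuous g -> bounded_fun g ->
    law_mean m (Z n) g @[n --> \oo] --> law_mean P (idfun : measurableTypeR R -> R) g.
Proof.
have [P PF] := exists_probability_of_cdf F_nd F_rc F_Ny F_y.
by exists P => g; exact: law_mean_cvg.
Qed.

End levy_continuity.

(** * The stable process *)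

Lemma big_window (S : Type) (idx : S) (op : Monoid.com_law idx) (F : nat -> S) (n d : nat) :
  (n <= d)%N ->
  \big[op/idx]_(i < d + d)
     (if (i < n)%N then F i else if (d <= i < d + n)%N then F i else idx) =
  op (\big[op/idx]_(i < n) F i) (\big[op/idx]_(i < n) F (d + i)%N).
Proof.
move=> nd; rewrite big_split_ord/=; congr (op _ _).
  rewrite (big_ord_widen _ _ nd) [RHS]big_mkcond; apply: eq_bigr => i _.
  by case: ifP => // ni; rewrite leqNgt ltn_ord.
rewrite (big_ord_widen _ (fun i => F (d + i)%N) nd) [RHS]big_mkcond; apply: eq_bigr => i _.
rewrite leq_addr ltn_add2l/= ifF//; apply/negbTE.
by rewrite -leqNgt (leq_trans nd)// leq_addr.
Qed.

(** The sum of the first [n + d] terms, cut after [n] or after [d]. This exchanges [n] and [d], so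
    that few terms remain when the lag [d] is short. *)
Lemma sum_telescope_shift (R : zmodType) (e : nat -> R) (n d : nat) :
  \sum_(j < n) (e j - e (d + j)%N) = \sum_(i < d) e i - \sum_(i < d) e (n + i)%N.
Proof.
have split_sum a b : \sum_(i < a + b) e i = \sum_(i < a) e i + \sum_(i < b) e (a + i)%N.
  by rewrite big_split_ord.
rewrite sumrB; apply/eqP; rewrite subr_eq addrAC eq_sym subr_eq eq_sym.
by rewrite -split_sum addnC split_sum addrC.
Qed.

(** * Characteristic functions of Bernoulli sums *)

Section cis.
Context {R : realType}.
Local Open Scope complex_scope.

Definition cis (t : R) : R[i] := Complex (cos t) (sin t).

Lemma cisD (s t : R) : cis (s + t) = cis s * cis t.
Proof. by rewrite /cis cosD sinD; congr Complex; rewrite addrC mulrC. Qed.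

Lemma cis0 : cis 0 = 1.
Proof. by rewrite /cis cos0 sin0. Qed.

Lemma cis_sum (I : Type) (s : seq I) (F : I -> R) :
  cis (\sum_(i <- s) F i) = \prod_(i <- s) cis (F i).
Proof. exact: (big_morph cis cisD cis0). Qed.

Lemma Re_sum (I : Type) (s : seq I) (F : I -> R[i]) :
  complex.Re (\sum_(i <- s) F i) = \sum_(i <- s) complex.Re (F i).
Proof. by apply: (big_morph (@complex.Re R)) => // -[? ?] [? ?]. Qed.

(** The complex exponential, unlike cosine, factors over independent coordinates. Since the product
    is real, the phase survives as the real part of [cis a * r]. *)
Lemma bern_mean_cos (I : finType) (p F : I -> R) (a : R) (r : R) :
  \prod_i ((1 - p i)%:C + (p i)%:C * cis (F i)) = r%:C ->
  bern_mean p (fun b => cos (\sum_i F i * (b i)%:R + a)) = cos a * r.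
Proof.
move=> pr.
transitivity (complex.Re (cis a *
    \sum_(b : {ffun I -> bool}) \prod_i ((bern (p i) (b i))%:C * cis (F i * (b i)%:R)))).
  rewrite mulr_sumr Re_sum; apply: eq_bigr => b _.
  have -> : \prod_i ((bern (p i) (b i))%:C * cis (F i * (b i)%:R)) =
      (bern_weight p b)%:C * cis (\sum_i F i * (b i)%:R).
    by rewrite big_split/= cis_sum rmorph_prod.
  by rewrite mulrCA -cisD addrC /cis /= mul0r subr0.
rewrite -(bigA_distr_bigA (fun i (e : bool) => (bern (p i) e)%:C * cis (F i * e%:R))).
under eq_bigr => i _ do rewrite big_bool/= /bern mulr1 mulr0 cis0 mulr1 addrC.
by rewrite pr /cis /= mulr0 subr0.
Qed.

(** The squared modulus of the characteristic function of a Bernoulli variable; the conjugate comes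
    from the second copy, which enters with the opposite sign. *)
Lemma cis_conj_factor (q t : R) :
  ((1 - q)%:C + q%:C * cis t) * ((1 - q)%:C + q%:C * cis (- t)) =
  (1 - 2 * (q * (1 - q)) * (1 - cos t))%:C.
Proof.
rewrite /cis cosN sinN; apply/eqP; rewrite eq_complex /=; apply/andP.
have e := cos2Dsin2 t.
split; apply/eqP; last by ring.
transitivity ((1 - q) ^+ 2 + 2 * q * (1 - q) * cos t + q ^+ 2 * (cos t ^+ 2 + sin t ^+ 2)).
  by ring.
by rewrite e; ring.
Qed.

End cis.

Definition window_sign (R : pzRingType) (n d i : nat) : R :=
  if (i < n)%N then 1 else if (d <= i < d + n)%N then -1 else 0.

Section window_statistic.
Variables (R : realType) (p a : nat -> R) (d : nat -> nat) (K N n : nat).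
Hypothesis p01 : forall k, 0 < p k < 1.
Let L k := (d k + d k)%N.
Let I := block_index L K N.
Let pI : I -> R := @block_prob R p L K N.

Let pI01 u : 0 <= pI u <= 1.
Proof. by rewrite /pI /block_prob; have /andP[/ltW -> /ltW ->] := p01 (K + tag u). Qed.

Definition window_coef (u : I) : R :=
  a (K + tag u) * window_sign R n (d (K + tag u)) (tagged u).

Definition window_stat (b : {ffun I -> bool}) : R := \sum_u window_coef u * (b u)%:R.

Hypothesis nd : forall k, (K <= k)%N -> (n <= d k)%N.

(** Kept for an arbitrary array [e]: the bits give the statistic itself, an array constant in time
    gives 0 and so centers it, and a signed array computes the variance. *)
Lemma window_statE (e : nat -> nat -> R) :
  \sum_(u : I) window_coef u * e (K + tag u)%N (tagged u) =
  \sum_(K <= k < N) a k * \sum_(j < n) (e k j - e k (d k + j)%N).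
Proof.
rewrite (big_block_index L _ (fun k i => a k * window_sign R n (d k) i * e k i)).
apply: eq_big_nat => k /andP[Kk _].
under eq_bigr do rewrite -mulrA.
rewrite -mulr_sumr; congr (_ * _); rewrite sumrB.
transitivity (\sum_(i < d k + d k) (if (i < n)%N then (if (i < n)%N then e k i else - e k i)
    else if (d k <= i < d k + n)%N then (if (i < n)%N then e k i else - e k i) else 0)).
  apply: eq_bigr => i _; rewrite /window_sign; case: ifP => _; first by rewrite mul1r.
  by case: ifP => _; rewrite ?mulN1r ?mul0r.
rewrite (big_window _ (fun i => if (i < n)%N then e k i else - e k i) (nd Kk)).
rewrite -sumrN; congr (_ + _); apply: eq_bigr => i _; first by rewrite ltn_ord.
by rewrite ifF//; apply/negbTE; rewrite -leqNgt (leq_trans (nd Kk))// leq_addr.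
Qed.

(** The windows [[0, n)] and [[d k, d k + n)] are disjoint, so each [k] contributes [n] pairs of
    conjugate factors, and the remaining times the factor 1. *)
Lemma window_stat_cos (theta s : R) :
  bern_mean pI (fun b => cos (theta * window_stat b + s)) =
  cos s * \prod_(K <= k < N) (1 - 2 * (p k * (1 - p k)) * (1 - cos (theta * a k))) ^+ n.
Proof.
transitivity (bern_mean pI (fun b => cos (\sum_u theta * window_coef u * (b u)%:R + s))).
  apply: eq_bigr => b _; congr (_ * cos (_ + _)).
  by rewrite mulr_sumr; apply: eq_bigr => u _; rewrite mulrA.
apply: bern_mean_cos.
pose phi k (sg : R) := ((1 - p k)%:C + (p k)%:C * cis (theta * (a k * sg)))%C.
transitivity (\prod_(u : I) phi (K + tag u)%N (window_sign R n (d (K + tag u)) (tagged u))).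
  by [].
rewrite (big_block_index L _ (fun k i => phi k (window_sign R n (d k) i))) rmorph_prod.
apply: eq_big_nat => k /andP[Kk _].
transitivity (\prod_(i < d k + d k) (if (i < n)%N then (phi k (if (i < n)%N then 1 else -1))
    else if (d k <= i < d k + n)%N then phi k (if (i < n)%N then 1 else -1) else 1)).
  apply: eq_bigr => i _; rewrite /window_sign; case: ifP => _ //.
  case: ifP => _ //; rewrite /phi !mulr0 cis0 mulr1 -rmorphD/=.
  by rewrite subrK.
rewrite (big_window _ (fun i => phi k (if (i < n)%N then 1 else -1)) (nd Kk)).
transitivity (phi k 1 ^+ n * phi k (-1) ^+ n).
  congr (_ * _).
    transitivity (\prod_(i < n) phi k 1); last by rewrite prodr_const card_ord.
    by apply: eq_bigr => i _; rewrite ltn_ord.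
  transitivity (\prod_(i < n) phi k (-1)); last by rewrite prodr_const card_ord.
  apply: eq_bigr => i _; rewrite ifF//; apply/negbTE.
  by rewrite -leqNgt (leq_trans (nd Kk))// leq_addr.
by rewrite -exprMn /phi mulr1 mulrN1 mulrN cis_conj_factor rmorphXn.
Qed.

Lemma window_stat_sqr :
  bern_mean pI (fun b => window_stat b ^+ 2) <=
  2 * n%:R * \sum_(K <= k < N) a k ^+ 2 * p k.
Proof.
have centered : \sum_u window_coef u * pI u = 0.
  rewrite (window_statE (fun k _ => p k)) big1// => k _.
  by rewrite big1 ?mulr0// => j _; rewrite subrr.
rewrite (_ : bern_mean _ _ =
    bern_mean pI (fun b => (\sum_u window_coef u * ((b u)%:R - pI u)) ^+ 2)); last first.
  apply: eq_bigr => b _; congr (_ * _ ^+ 2).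
  under [RHS]eq_bigr do rewrite mulrBr.
  by rewrite sumrB centered subr0.
rewrite bern_mean_var.
apply: (@le_trans _ _ (\sum_u window_coef u * (window_coef u * pI u))).
  apply: ler_sum => u _; have /andP[? ?] := pI01 u.
  rewrite expr2 -mulrA mulrA [leRHS]mulrA ler_wpM2l ?sqr_ge0// -?expr2 ?sqr_ge0//.
  by rewrite ler_piMr// gerBl.
(* With the sign inside the array the two windows add up instead of cancelling, whence the factor
   2. *)
rewrite (window_statE (fun k i => a k * window_sign R n (d k) i * p k)) mulr_sumr.
rewrite le_eqVlt; apply/orP; left; apply/eqP; apply: eq_big_nat => k /andP[Kk _].
rewrite (_ : \sum_(j < n) _ = \sum_(j < n) (2 * (a k * p k))); last first.
  apply: eq_bigr => j _; rewrite /window_sign ltn_ord.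
  rewrite (_ : (d k + j < n)%N = false); last first.
    by apply/negbTE; rewrite -leqNgt (leq_trans (nd Kk))// leq_addr.
  by rewrite leq_addr ltn_add2l ltn_ord/=; ring.
by rewrite sumr_const card_ord -[_ *+ n]mulr_natl; ring.
Qed.

End window_statistic.

Section centered_statistic.
Variables (R : realType) (p a : nat -> R) (d : nat -> nat) (N : nat).
Hypothesis p01 : forall k, 0 < p k < 1.
Let L k := (d k + d k)%N.
Let I := block_index L 0 N.
Let pI : I -> R := @block_prob R p L 0 N.

Definition centered_stat (b : {ffun I -> bool}) : R :=
  \sum_(u : I) a (tag u) * (tagged u < d (tag u))%N%:R * ((b u)%:R - p (tag u)).

Lemma centered_statE (e : nat -> nat -> R) :
  \sum_(u : I) a (tag u) * (tagged u < d (tag u))%N%:R *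
     (e (tag u) (tagged u) - p (tag u)) =
  \sum_(k < N) a k * \sum_(i < d k) (e k i - p k).
Proof.
rewrite (big_block_index L _ (fun k i => a k * (i < d k)%N%:R * (e k i - p k))) big_mkord.
apply: eq_bigr => k _; rewrite mulr_sumr big_split_ord/= [X in _ + X]big1 ?addr0.
  by apply: eq_bigr => i _; rewrite ltn_ord mulr1.
by move=> i _; rewrite ltnNge leq_addr/= mulr0 mul0r.
Qed.

Lemma centered_stat_sqr :
  bern_mean pI (fun b => centered_stat b ^+ 2) <=
  \sum_(k < N) (d k)%:R * (a k ^+ 2 * p k).
Proof.
rewrite bern_mean_var.
have -> : \sum_(k < N) (d k)%:R * (a k ^+ 2 * p k) =
  \sum_(u : I) a (tag u) ^+ 2 * (tagged u < d (tag u))%N%:R * p (tag u).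
  rewrite (big_block_index L _ (fun k i => a k ^+ 2 * (i < d k)%N%:R * p k)) big_mkord.
  apply: eq_bigr => k _; rewrite big_split_ord/= [X in _ + X]big1 ?addr0.
    rewrite (eq_bigr (fun=> a k ^+ 2 * p k)); last by move=> i _; rewrite ltn_ord mulr1.
    by rewrite sumr_const card_ord mulr_natl.
  by move=> i _; rewrite ltnNge leq_addr/= mulr0 mul0r.
apply: ler_sum => u _; rewrite (_ : pI u = p (tag u)); last by [].
have /andP[p0 p1] := p01 (tag u).
have q0 : 0 <= p (tag u) * (1 - p (tag u)) by apply: mulr_ge0; rewrite ?subr_ge0 ltW.
rewrite exprMn ler_pM//.
  by rewrite -exprMn sqr_ge0.
  rewrite ler_wpM2l ?sqr_ge0//.
  by case: (tagged u < d (tag u))%N; rewrite ?expr1n ?expr0n.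
by rewrite ler_piMr ?(ltW p0)// gerBl ltW.
Qed.

End centered_statistic.

Lemma dist_cos_le (R : realType) (x y : R) : `|cos x - cos y| <= `|x - y|.
Proof.
wlog xy : x y / x < y.
  move=> hw; have [xy|yx|->] := ltgtP x y; last by rewrite !subrr normr0.
    exact: hw.
  by rewrite distrC [leRHS]distrC; exact: hw.
have [|z _] := @MVT R cos (fun z => - sin z) x y xy (fun z _ => is_derive_cos z).
  by apply: continuous_subspaceT; exact: continuous_cos.
rewrite distrC => ->; rewrite normrM normrN [leRHS]distrC ler_piMl//.
exact: sin_max.
Qed.

(** Each [1 - x] lies between [expR (- x / (1 - eta))] and [expR (- x)]; the lower bound is
    [1 + y <= expR y] applied to [(1 - x)^-1]. The two exponents have the same limit because [eta n]
    tends to 0. *)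
Lemma prod_expR_cvg (R : realType) (x : nat -> nat -> R) (eta : nat -> R)
    (K N : nat -> nat) (l : R) :
  (forall n k, (K n <= k)%N -> 0 <= x n k <= eta n) ->
  eta n @[n --> \oo] --> (0 : R) ->
  \sum_(K n <= k < N n) n%:R * x n k @[n --> \oo] --> l ->
  \prod_(K n <= k < N n) (1 - x n k) ^+ n @[n --> \oo] --> expR (- l).
Proof.
move=> xeta eta0 xl.
pose s n := \sum_(K n <= k < N n) n%:R * x n k.
have lower : (fun n => expR (- (s n * (1 - eta n)^-1))) @ \oo --> expR (- l).
  apply: (@cvg_comp _ _ _ (fun n => - (s n * (1 - eta n)^-1)) expR _ (nbhs (- l))); last first.
    exact: continuous_expR.
  apply: cvgN; rewrite -[X in _ --> X]mulr1; apply: cvgM; first exact: xl.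
  rewrite -[X in _ --> X]invr1; apply: cvgV; first exact: oner_neq0.
  by rewrite -[X in _ --> X]subr0; apply: cvgB => //; exact: cvg_cst.
have upper : (fun n => expR (- s n)) @ \oo --> expR (- l).
  apply: (@cvg_comp _ _ _ (fun n => - s n) expR _ (nbhs (- l))); last exact: continuous_expR.
  exact: cvgN.
have half : (0 : R) < 2^-1 by rewrite invr_gt0.
apply: (squeeze_cvgr _ lower upper); near=> n.
have en : eta n < 2^-1.
  by near: n; move/cvgrPdist_lt : eta0 => /(_ _ half); apply: filterS => n;
     rewrite sub0r normrN; exact: le_lt_trans (ler_norm _).
have -> : expR (- (s n * (1 - eta n)^-1)) =
    \prod_(K n <= k < N n) expR (- (x n k * (1 - eta n)^-1)) ^+ n.
  rewrite /s mulr_suml -sumrN expR_sum; apply: eq_bigr => k _.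
  by rewrite -expRM_natl; congr expR; ring.
have -> : expR (- s n) = \prod_(K n <= k < N n) expR (- x n k) ^+ n.
  rewrite /s -sumrN expR_sum; apply: eq_bigr => k _.
  by rewrite -expRM_natl mulrN.
have bounds k : (K n <= k < N n)%N -> [/\ 0 <= 1 - x n k,
    expR (- (x n k * (1 - eta n)^-1)) <= 1 - x n k & 1 - x n k <= expR (- x n k)].
  move=> /andP[/(xeta n)/andP[x0 xe] _].
  have e1 : 0 < 1 - eta n by lra.
  have x1 : 0 < 1 - x n k by lra.
  split; [exact: ltW| |exact: expR_ge1Dx].
  rewrite expRN -[leRHS]invrK lef_pV2 ?posrE ?expR_gt0 ?invr_gt0//.
  apply: le_trans (expR_ge1Dx _).
  have -> : (1 - x n k)^-1 = 1 + x n k * (1 - x n k)^-1.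
    by field; rewrite gt_eqF.
  by rewrite lerD2l ler_wpM2l// lef_pV2 ?posrE//; lra.
apply/andP; split; rewrite big_nat_cond [leRHS]big_nat_cond; apply: ler_prod => k;
    rewrite andbT => /bounds[x1 lo hi].
  rewrite exprn_ge0 ?expR_ge0//=.
  by apply: lerXn2r; rewrite ?nnegrE ?expR_ge0.
rewrite exprn_ge0//=.
by apply: lerXn2r; rewrite ?nnegrE ?expR_ge0.
Unshelve. all: by end_near. Qed.

Lemma bern_mean_coord (R : realFieldType) (I : finType) (p : I -> R) (i : I) :
  bern_mean p (fun b => (b i)%:R) = p i.
Proof.
have gI : injective (fun e : unit => i) by case=> -[].
have := bern_mean_injective p (fun (e : unit) b => b%:R) gI.
have u1 (F : unit -> R) : \prod_j F j = F tt.
  by rewrite (big_pred1 tt)//; case.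
rewrite u1 mulr0n mulr1n mulr0 mulr1 addr0 => <-.
by apply: eq_bigr => b _; rewrite u1.
Qed.

Lemma mass_bigsetU_le (R : realType) (d : measure_display) (X : measurableType d)
    (m : probability X R) (I : Type) (s : seq I) (A : I -> set X) :
  (forall i, measurable (A i)) ->
  mass m (\big[setU/set0]_(i <- s) A i) <= \sum_(i <- s) mass m (A i).
Proof.
move=> mA; elim: s => [|i s ih]; first by rewrite !big_nil mass0.
rewrite !big_cons; apply: (le_trans (massU2 m (mA i) _)).
  by apply: bigsetU_measurable.
by rewrite lerD2l.
Qed.

Lemma mass_markov_sqr (R : realType) (d : measure_display) (X : measurableType d)
    (m : probability X R) (V : X -> R) (eta C : R) :
  0 < eta -> measurable_fun setT V -> (forall x, `|V x| <= C) ->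
  mass m [set x | eta < `|V x|] <= (eta ^+ 2)^-1 * \int[m]_x (V x ^+ 2).
Proof.
move=> eta0 mV VC.
have mt := measurable_tail mV eta.
have iV : m.-integrable setT (EFin \o (fun x => V x ^+ 2)).
  apply: (@bounded_integrable _ _ _ m _ (C ^+ 2)) => [|x].
    exact: measurable_funX.
  by rewrite normrX lerXn2r ?nnegrE//; exact: le_trans (VC x).
rewrite -Rintegral_indic// -RintegralZl//; apply: le_Rintegral => //.
- exact: integrable_indic.
- rewrite (_ : _ \o _ = (fun x => ((eta ^+ 2)^-1)%:E * (V x ^+ 2)%:E)%E).
    exact: integrableZl.
  by apply/funext => x; rewrite /= EFinM.
move=> x _; rewrite indicE; have [xe|nxe] := ltP eta `|V x|.
  rewrite mem_set// ler_pdivlMl ?exprn_gt0// mulr1 -[leRHS]real_normK ?num_real//.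
  by rewrite lerXn2r ?nnegrE// ltW.
rewrite memNset; first by rewrite mulr_ge0 ?invr_ge0 ?sqr_ge0.
by apply/negP; rewrite -leNgt.
Qed.

(** * The function, its Birkhoff sums and their second moments *)

Section stable_process.
Context (R : realType) (d : measure_display) (X : measurableType d)
  (m : probability X R) (T : X -> X).
Hypothesis hT : measure_preserving m T.
Variables (g c : R).
Hypotheses (g1 : 1 < 2 * g) (c0 : 0 < c).

(** Of order [k ^ (- 2)], in the form that telescopes in tail sums and matches the interval lengths
    of the Riemann sum exactly. *)
Definition jump_prob (k : nat) : R := (k.+1%:R * k.+2%:R)^-1.

(* Jumps larger than [y] have total probability of order [y ^ - (1 / g)]. *)
Definition jump_size (k : nat) : R := c * k.+1%:R `^ g.

Definition lag (k : nat) : nat := (k.+1 * k.+1)%N.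

(* Long enough to contain both visits, at times [j] and [lag k + j] with
   [j < n <= lag k]. *)
Definition lag_window (k : nat) : nat := (lag k + lag k)%N.

Let p := jump_prob.
Let v := jump_size.
Let L := lag_window.

Lemma jump_prob01 k : 0 < jump_prob k < 1.
Proof.
rewrite invr_gt0 mulr_gt0 ?ltr0n//= invf_lt1 ?mulr_gt0 ?ltr0n//.
by rewrite -natrM ltr1n mulSn.
Qed.

Let p0 k : 0 < p k. Proof. by have /andP[] := jump_prob01 k. Qed.

Let v0 k : 0 <= v k.
Proof. by rewrite mulr_ge0 ?powR_ge0// ltW. Qed.

Lemma sum_jump_prob N M : \sum_(N <= k < M) p k <= N.+1%:R^-1.
Proof.
have [NM|MN] := leqP N M; last by rewrite big_geq ?invr_ge0// ltnW.
have pE k : p k = - k.+2%:R^-1 - - k.+1%:R^-1.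
  rewrite /p /jump_prob; have a0 : k.+1%:R != 0 :> R by rewrite pnatr_eq0.
  have a1 : k.+2%:R != 0 :> R by rewrite pnatr_eq0.
  move: a1; rewrite -(natr1 k.+1).
  by move: a0; move: (k.+1%:R : R) => a a0 a1; field; rewrite a0 a1.
under eq_bigr do rewrite pE.
rewrite (telescope_sumr (fun k => - k.+1%:R^-1 : R))// opprK addrC gerBl.
by rewrite invr_ge0.
Qed.

Variable E : nat -> set X.
Hypothesis mE : forall k, measurable (E k).
Hypothesis hE : forall K N b, (K <= N)%N ->
    mass m (block_set T L E K N b) <=
    (1 + K.+1%:R^-1) * \prod_(K <= k < N) \prod_(i < L k) bern (p k) (b k i).

Definition jump (k i : nat) (x : X) : R := (`[< E k (iter i T x) >])%:R.

Lemma jump_iter k i j x : jump k i (iter j T x) = jump k (i + j)%N x.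
Proof. by rewrite /jump iterD. Qed.

Lemma measurable_jump k i : measurable_fun setT (jump k i).
Proof.
apply: (measurable_fin_fun (w := fun x => `[< E k (iter i T x) >]) _ (fun b : bool => b%:R)) => b.
exact: (measurable_preimage_iter hT _ (measurable_fiber_bool _ (mE _))).
Qed.

(* The series are finite almost everywhere; where one is infinite, [fine] gives [0]. *)
Definition stable_fun (x : X) : R :=
  fine (\sum_(k <oo) (v k * jump k 0 x)%:E)%E -
  fine (\sum_(k <oo) (v k * jump k (lag k) x)%:E)%E.

Lemma measurable_stable_fun : measurable_fun setT stable_fun.
Proof.
have h (s : nat -> nat) : measurable_fun setT
    (fun x => fine (\sum_(k <oo) (v k * jump k (s k) x)%:E)%E).
  apply: (measurableT_comp (f := fine)); first exact: fine_measurable.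
  apply: (ge0_emeasurable_sum (P := xpredT)) => [k x _ _|k _].
    by rewrite lee_fin mulr_ge0.
  apply/measurable_EFinP; apply: measurable_funM; first exact: measurable_cst.
  exact: measurable_jump.
by apply: measurable_funB; [exact: (h (fun=> 0%N))|exact: h].
Qed.

Lemma fine_series_finite (u : nat -> R) (N : nat) :
  (forall k, 0 <= u k) -> (forall k, (N <= k)%N -> u k = 0) ->
  fine (\sum_(k <oo) (u k)%:E)%E = \sum_(0 <= k < N) u k.
Proof.
move=> u0 uN; rewrite (nneseries_split 0 N); last by move=> k _; rewrite lee_fin.
rewrite add0n eseries0 ?adde0; last by move=> k Nk _; rewrite uN.
by rewrite sumEFin.
Qed.

(** Off this set both series stop before [N] at each of the first [n] points of the orbit, so they
    are finite sums and the default value of [fine] is not met. *)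
Definition late_jumps (n N : nat) : set X :=
  [set x | exists2 k, (N <= k)%N &
     exists2 j, (j < n)%N & E k (iter j T x) \/ E k (iter (lag k + j) T x)].

Lemma birkhoff_stable_fun n N x : ~ late_jumps n N x ->
  birkhoff_sum T stable_fun n x =
  \sum_(0 <= k < N) v k * \sum_(j < n) (jump k j x - jump k (lag k + j) x).
Proof.
move=> nx.
have jn k j : (N <= k)%N -> (j < n)%N -> jump k j x = 0 /\ jump k (lag k + j) x = 0.
  by move=> Nk jn; split; rewrite /jump asboolF//= => Ek; apply: nx;
     exists k => //; exists j => //; [left|right].
transitivity (\sum_(j < n) \sum_(0 <= k < N) v k * (jump k j x - jump k (lag k + j) x)).
  apply: eq_bigr => j _; rewrite /stable_fun.
  have fin (s : nat -> nat) : (forall k, (N <= k)%N -> jump k (s k + j) x = 0) ->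
      fine (\sum_(k <oo) (v k * jump k (s k) (iter j T x))%:E)%E =
      \sum_(0 <= k < N) v k * jump k (s k + j) x.
    move=> s0; rewrite (@fine_series_finite _ N).
    - by apply: eq_bigr => k _; rewrite jump_iter.
    - by move=> k; rewrite mulr_ge0.
    - by move=> k Nk; rewrite jump_iter s0// mulr0.
  rewrite (fin (fun=> 0%N)); last by move=> k Nk; exact: (jn k j Nk (ltn_ord j)).1.
  rewrite fin; last by move=> k Nk; exact: (jn k j Nk (ltn_ord j)).2.
  by rewrite -sumrB; apply: eq_bigr => k _; rewrite mulrBr.
rewrite exchange_big/=; apply: eq_bigr => k _.
by rewrite mulr_sumr.
Qed.

(** The domination for the single index [k], with the bit at time 0 as test function; its factor
    [1 + 1 / (k + 1)] is at most 2. *)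
Lemma mass_jump k : mass m (E k) <= 2 * p k.
Proof.
pose F (b : {ffun block_index L k k.+1 -> bool}) : R :=
  \sum_(u : block_index L k k.+1) (nat_of_ord (tagged u) == 0)%N%:R * (b u)%:R.
have F0 b : 0 <= F b by apply: sumr_ge0 => u _; rewrite mulr_ge0.
have Lk : (0 < L k)%N by rewrite /L /lag_window /lag; lia.
have sum1 (a : nat -> R) : \sum_(i < L k) (nat_of_ord i == 0)%N%:R * a i = a 0%N.
  rewrite (bigD1 (Ordinal Lk))//= mul1r big1 ?addr0// => i.
  by rewrite -val_eqE/= => /negbTE ->; rewrite mul0r.
have := block_bits_mean hT mE hE (leqnSn k) F0.
rewrite (_ : \int[m]_x _ = mass m (E k)); last first.
  rewrite -Rintegral_indic//; apply: eq_Rintegral => x _.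
  transitivity (\sum_(u : block_index L k k.+1) (nat_of_ord (tagged u) == 0)%N%:R *
      jump (k + tag u) (tagged u) x).
    by apply: eq_bigr => u _; rewrite ffunE.
  rewrite (big_block_index L _ (fun k i => (i == 0)%N%:R * jump k i x)) big_nat1.
  rewrite (sum1 (fun i => jump k i x)) /jump indicE /=; have [Ek|nEk] := pselect (E k x).
    by rewrite asboolT// mem_set.
  by rewrite asboolF// memNset.
move=> /le_trans; apply; rewrite /F bern_mean_sum.
under eq_bigr do rewrite bern_meanZ bern_mean_coord.
rewrite (big_block_index L _ (fun k i => (i == 0)%N%:R * p k)) big_nat1.
rewrite (sum1 (fun=> p k)) ler_wpM2r ?(ltW (p0 k))//.
have : k.+1%:R^-1 <= 1 :> R by rewrite invf_le1 ?ltr0n// ler1n.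
by rewrite -[2]/(1 + 1) lerD2l.
Qed.

Lemma measurable_late_jumps n N : measurable (late_jumps n N).
Proof.
rewrite (_ : late_jumps n N = \bigcup_(k in [set k | (N <= k)%N])
  \bigcup_(j in [set j | (j < n)%N])
    ((iter j T @^-1` E k) `|` (iter (lag k + j) T @^-1` E k))).
  apply: bigcup_measurable => k _; apply: bigcup_measurable => j _.
  by apply: measurableU; exact: (measurable_preimage_iter hT _ (mE _)).
by apply/seteqP; split => x [k Nk [j jn h]]; exists k => //; exists j.
Qed.

(** A union bound over [n] times and two visits, with the factor 2 of [mass_jump]; the [p k] beyond
    [N] sum to at most [1 / (N + 1)]. The infinite union is an increasing limit of finite ones. *)
Lemma mass_late_jumps n N : mass m (late_jumps n N) <= 4 * n%:R * N.+1%:R^-1.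
Proof.
pose B k : set X := \big[setU/set0]_(j < n)
    ((iter j T @^-1` E k) `|` (iter (lag k + j) T @^-1` E k)).
have mB k : measurable (B k).
  apply: bigsetU_measurable => j _.
  by apply: measurableU; exact: (measurable_preimage_iter hT _ (mE _)).
have massB k : mass m (B k) <= 4 * n%:R * p k.
  apply: (@le_trans _ _ (\sum_(j < n) 4 * p k)); last first.
    by rewrite sumr_const card_ord -[_ *+ n]mulr_natl; lra.
  apply: (le_trans (mass_bigsetU_le m _ _)) => [j|].
    by apply: measurableU; exact: (measurable_preimage_iter hT _ (mE _)).
  apply: ler_sum => j _; apply: (le_trans (massU2 m _ _)).
  - exact: (measurable_preimage_iter hT _ (mE _)).
  - exact: (measurable_preimage_iter hT _ (mE _)).
  - by rewrite !(mass_iter hT _ (mE k)); have := mass_jump k; lra.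
have BP k x : B k x <-> exists2 j, (j < n)%N &
    E k (iter j T x) \/ E k (iter (lag k + j) T x).
  rewrite /B -(bigcup_mkord n (fun j =>
    (iter j T @^-1` E k) `|` (iter (lag k + j) T @^-1` E k))).
  by split => -[j jn h]; exists j.
pose F M : set X := \big[setU/set0]_(N <= k < M) B k.
have mF M : measurable (F M) by apply: bigsetU_measurable => k _.
have eF : late_jumps n N = \bigcup_M F M.
  apply/seteqP; split => x.
    move=> [k Nk [j jn h]]; exists k.+1 => //.
    rewrite /F -bigcup_seq; exists k; first by rewrite /= mem_index_iota Nk ltnS leqnn.
    by apply/BP; exists j.
  move=> [M _]; rewrite /F -bigcup_seq => -[k]; rewrite /= mem_index_iota => /andP[Nk _].
  by move=> /BP[j jn h]; exists k => //; exists j.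
have cF : m (F M) @[M --> \oo] --> m (late_jumps n N).
  rewrite eF; apply: nondecreasing_cvg_mu => //; first exact: bigcup_measurable.
  apply/nondecreasing_seqP => M; apply/subsetPset => x.
  rewrite /F -!bigcup_seq => -[k /=]; rewrite mem_index_iota => /andP[Nk kM] h.
  by exists k => //; rewrite /= mem_index_iota Nk ltnW.
have cF' : mass m (F M) @[M --> \oo] --> mass m (late_jumps n N).
  by apply: fine_cvg; rewrite -massE//; exact: measurable_late_jumps.
apply: (cvgr_to_le cF'); apply: nearW => M.
apply: (le_trans (mass_bigsetU_le m _ mB)).
apply: (@le_trans _ _ (\sum_(N <= k < M) 4 * n%:R * p k)); first exact: ler_sum.
by rewrite -mulr_sumr ler_wpM2l ?mulr_ge0// sum_jump_prob.
Qed.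


Variable K : nat -> nat.
Hypothesis K_le : forall n k, (K n <= k)%N -> (n <= lag k)%N.
Hypothesis K_gt : forall n k, (k < K n)%N -> (lag k < n)%N.

Definition normalized_sum (n : nat) (x : X) : R :=
  (n%:R `^ g)^-1 * birkhoff_sum T stable_fun n x.

Definition scaled_jump (n k : nat) : R := (n%:R `^ g)^-1 * v k.

Definition main_part (n N : nat) (x : X) : R :=
  \sum_(K n <= k < N) scaled_jump n k *
    \sum_(j < n) (jump k j x - jump k (lag k + j) x).

(** Subtracting [p k] does not affect the difference between the values at [x] and at [iter n T x],
    and under the product law it makes the second moment a sum of variances. *)
Definition boundary_part (n : nat) (x : X) : R :=
  \sum_(k < K n) scaled_jump n k * \sum_(i < lag k) (jump k i x - p k).

(** For [k < K n] the lag is below [n], and [sum_telescope_shift] trades [n] differences for [lag k]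
    visits at each end of the orbit. *)
Lemma normalized_sum_decomposition n N x : (K n <= N)%N -> ~ late_jumps n N x ->
  normalized_sum n x =
  main_part n N x + (boundary_part n x - boundary_part n (iter n T x)).
Proof.
move=> KN nl; rewrite /normalized_sum (birkhoff_stable_fun nl) mulr_sumr.
rewrite (big_cat_nat (n := K n))//= addrC; congr (_ + _).
  by apply: eq_bigr => k _; rewrite mulrA.
rewrite big_mkord /boundary_part -sumrB; apply: eq_bigr => k _.
rewrite mulrA -/(scaled_jump n k) -mulrBr; congr (_ * _).
rewrite (sum_telescope_shift (fun i => jump k i x)) !sumrB.
have -> : \sum_(i < lag k) jump k i (iter n T x) = \sum_(i < lag k) jump k (n + i) x.
  by apply: eq_bigr => i _; rewrite jump_iter addnC.
by ring.
Qed.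

Lemma main_partE n N x :
  main_part n N x = window_stat (scaled_jump n) n (block_bits T L E (K n) N x).
Proof.
rewrite /main_part -(window_statE _ _ (@K_le n) (fun k i => jump k i x)).
by apply: eq_bigr => u _; rewrite ffunE.
Qed.

Lemma boundary_partE n x :
  boundary_part n x = centered_stat p (scaled_jump n) (block_bits T L E 0 (K n) x).
Proof.
rewrite /boundary_part -(centered_statE _ _ _ _ (fun k i => jump k i x)).
by apply: eq_bigr => u _; rewrite ffunE.
Qed.

Lemma measurable_main_part n N : measurable_fun setT (main_part n N).
Proof.
rewrite (_ : main_part n N = window_stat (scaled_jump n) n \o block_bits T L E (K n) N).
  by apply: measurable_fin_fun => b; exact: (measurable_block_bits hT mE).
by apply/funext => x; exact: main_partE.
Qed.

Lemma measurable_boundary_part n : measurable_fun setT (boundary_part n).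
Proof.
rewrite (_ : boundary_part n = @centered_stat R p (scaled_jump n) lag (K n) \o block_bits T L E 0 (K n)).
  by apply: measurable_fin_fun => b; exact: (measurable_block_bits hT mE).
by apply/funext => x; exact: boundary_partE.
Qed.

(** The one-sided domination is applied to the nonnegative functions [1 + cos] and [1 - cos]. As the
    mean under the product law is at most 1 in absolute value, a relative error [q] becomes an
    absolute error of at most [2 * q]. *)
Lemma main_part_cos n N (theta s : R) : (K n <= N)%N ->
  `|law_mean m (main_part n N) (fun y => cos (theta * y + s)) -
    cos s * \prod_(K n <= k < N)
      (1 - 2 * (p k * (1 - p k)) * (1 - cos (theta * scaled_jump n k))) ^+ n| <=
  2 * (K n).+1%:R^-1.
Proof.
move=> KN; rewrite -(window_stat_cos p (scaled_jump n) N (@K_le n)).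
set q : R := (K n).+1%:R^-1; set w := bern_mean _ _.
have q0 : 0 <= q by rewrite invr_ge0.
pose Cs (y : R) := cos (theta * y + s).
have bC : bounded_measurable Cs by exact: bounded_measurable_cos.
have mM := measurable_main_part n N.
have b1 : bounded_measurable (fun=> 1 : R).
  by split; [exact: measurable_cst|exists 1 => _; rewrite normr1].
have half (sg : R) : `|sg| = 1 ->
    1 + sg * law_mean m (main_part n N) Cs <= (1 + q) * (1 + sg * w).
  move=> sg1; rewrite -law_meanZ// -[X in X + _](law_mean_cst m (main_part n N)).
  rewrite -law_meanD//; last exact: bounded_measurableZ.
  have := @block_bits_mean _ _ _ _ _ hT p L E mE hE (K n) N
    (fun b => 1 + sg * Cs (window_stat (scaled_jump n) n b)) KN _.
  rewrite bern_meanD bern_mean_cst bern_meanZ => h.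
  rewrite /law_mean; under eq_Rintegral do rewrite main_partE.
  apply: h => b; have : `|sg * Cs (window_stat (scaled_jump n) n b)| <= 1.
    by rewrite normrM sg1 mul1r cos_max.
  by rewrite ler_norml => /andP[? _]; lra.
have w1 : `|w| <= 1.
  apply: (le_trans (ler_norm_bern_mean _ _)) => [u|].
    by rewrite /block_prob; have /andP[/ltW -> /ltW ->] := jump_prob01 (K n + tag u).
  rewrite -[leRHS](bern_mean_cst (@block_prob _ p L (K n) N)).
  apply: ler_bern_mean => [u|b]; last exact: cos_max.
  by rewrite /block_prob; have /andP[/ltW -> /ltW ->] := jump_prob01 (K n + tag u).
have h1 := half 1 (normr1 _); have h2 := half (-1) (normrN1 _).
move: h1 h2; rewrite -/Cs !mul1r !mulN1r; move: (law_mean _ _ _) => I h1 h2.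
move: w1; rewrite !ler_norml => /andP[? ?].
by apply/andP; split; nra.
Qed.

Definition variance_const : R := c ^+ 2 * (2 / Num.min (2 * g - 1) 1).

Lemma variance_const_ge0 : 0 <= variance_const.
Proof.
rewrite mulr_ge0 ?sqr_ge0// divr_ge0// le_min ler01 andbT.
by move: g1 => ?; lra.
Qed.

(** By scaling, the bound is a power of [N / n] with the positive exponent [2 g - 1]: constant when
    [N] is a fixed multiple of [n], and tending to 0 at [N = K n]. *)
Lemma scaled_jump_variance n N : (0 < n)%N ->
  n%:R * \sum_(0 <= k < N) scaled_jump n k ^+ 2 * p k <=
  variance_const * (N%:R / n%:R) `^ (2 * g - 1).
Proof.
move=> n0; have nR : 0 < n%:R :> R by rewrite ltr0n.
have sq (y : R) : 0 <= y -> (y `^ g) ^+ 2 = y `^ (2 * g).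
  by move=> y0; rewrite mulrC powRrM powR_mulrn ?powR_ge0.
have := sum_powR_le N g1 => S.
have -> : \sum_(0 <= k < N) scaled_jump n k ^+ 2 * p k =
    (n%:R `^ (2 * g))^-1 * c ^+ 2 *
    \sum_(0 <= k < N) (k.+1%:R * k.+2%:R)^-1 * k.+1%:R `^ (2 * g).
  rewrite mulr_sumr; apply: eq_bigr => k _.
  rewrite /scaled_jump /v /jump_size /p /jump_prob -!sq// exprMn exprMn exprVn.
  by ring.
have -> : (N%:R / n%:R) `^ (2 * g - 1) = N%:R `^ (2 * g - 1) * (n%:R * (n%:R `^ (2 * g))^-1).
  rewrite powRM ?invr_ge0// -[n%:R^-1]powR_inv1// -powRrM; congr (_ * _).
  rewrite -powRN -[X in _ = X * _]powRr1// -powRD ?(gt_eqF nR) ?implybT//.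
  by congr (_ `^ _); ring.
rewrite /variance_const.
rewrite [leLHS](_ : _ = (n%:R * (n%:R `^ (2 * g))^-1) * c ^+ 2 *
  \sum_(0 <= k < N) (k.+1%:R * k.+2%:R)^-1 * k.+1%:R `^ (2 * g)); last by ring.
rewrite [leRHS](_ : _ = (n%:R * (n%:R `^ (2 * g))^-1) * c ^+ 2 *
  (2 / Num.min (2 * g - 1) 1 * N%:R `^ (2 * g - 1))); last by ring.
by rewrite ler_wpM2l// !mulr_ge0 ?sqr_ge0 ?invr_ge0 ?powR_ge0// ltW.
Qed.

Lemma main_part_sqr n N : (0 < n)%N -> (K n <= N)%N ->
  \int[m]_x (main_part n N x ^+ 2) <=
  4 * variance_const * (N%:R / n%:R) `^ (2 * g - 1).
Proof.
move=> n0 KN.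
have := @block_bits_mean _ _ _ _ _ hT p L E mE hE (K n) N
  (fun b => window_stat (scaled_jump n) n b ^+ 2) KN (fun b => sqr_ge0 _).
under eq_Rintegral do rewrite -main_partE.
move=> /le_trans; apply.
have q1 : (K n).+1%:R^-1 <= 1 :> R by rewrite invf_le1 ?ltr0n// ler1n.
apply: (@le_trans _ _ (2 * (2 * n%:R * \sum_(K n <= k < N) scaled_jump n k ^+ 2 * p k))).
  apply: ler_pM.
  - by rewrite addr_ge0 ?invr_ge0.
  - apply: sumr_ge0 => b _; rewrite mulr_ge0 ?sqr_ge0//; apply: bern_weight_ge0 => u.
    by rewrite /block_prob; have /andP[/ltW -> /ltW ->] := jump_prob01 (K n + tag u).
  - by rewrite -[2]/(1 + 1) lerD2l.
  - exact: (window_stat_sqr _ _ jump_prob01 (@K_le n)).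
rewrite [leLHS](_ : _ = 4 * (n%:R * \sum_(K n <= k < N) scaled_jump n k ^+ 2 * p k)); last by ring.
rewrite -[leRHS]mulrA ler_pM2l//; apply: le_trans (scaled_jump_variance N n0).
rewrite ler_pM2l ?ltr0n//; rewrite [leRHS](big_cat_nat (n := K n))//= lerDr.
by apply: sumr_ge0 => k _; rewrite mulr_ge0 ?sqr_ge0// ltW.
Qed.

(** For [k < K n] only [lag k < n] times occur, so [n] copies of each variance suffice; starting the
    domination at index 0 costs the factor 2. *)
Lemma boundary_part_sqr n : (0 < n)%N ->
  \int[m]_x (boundary_part n x ^+ 2) <=
  2 * variance_const * ((K n)%:R / n%:R) `^ (2 * g - 1).
Proof.
move=> n0.
have := @block_bits_mean _ _ _ _ _ hT p L E mE hE 0 (K n)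
  (fun b => @centered_stat R p (scaled_jump n) lag (K n) b ^+ 2) (leq0n _) (fun b => sqr_ge0 _).
under eq_Rintegral do rewrite -boundary_partE.
move=> /le_trans; apply.
rewrite invr1 -[leRHS]mulrA (_ : 1 + 1 = 2)// ler_pM2l//.
apply: (le_trans (centered_stat_sqr _ _ _ jump_prob01)).
apply: le_trans (scaled_jump_variance (K n) n0).
rewrite mulr_sumr big_mkord; apply: ler_sum => k _.
have q0 : 0 <= scaled_jump n k ^+ 2 * p k.
  by apply: mulr_ge0; [exact: sqr_ge0|exact: ltW].
by rewrite ler_wpM2r// ler_nat ltnW// K_gt.
Qed.

Lemma main_part_tail n N (eta : R) : 0 < eta -> (0 < n)%N -> (K n <= N)%N ->
  mass m [set x | eta < `|main_part n N x|] <=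
  (eta ^+ 2)^-1 * (4 * variance_const * (N%:R / n%:R) `^ (2 * g - 1)).
Proof.
move=> eta0 n0 KN.
apply: (le_trans (mass_markov_sqr m eta0 (measurable_main_part n N)
   (C := \sum_b `|@window_stat R (scaled_jump n) lag (K n) N n b|) _)).
  by move=> x; rewrite main_partE; exact: fin_fun_bounded.
by rewrite ler_wpM2l ?invr_ge0 ?sqr_ge0//; exact: main_part_sqr.
Qed.

Lemma boundary_part_tail n (eta : R) : 0 < eta -> (0 < n)%N ->
  mass m [set x | eta < `|boundary_part n x|] <=
  (eta ^+ 2)^-1 * (2 * variance_const * ((K n)%:R / n%:R) `^ (2 * g - 1)).
Proof.
move=> eta0 n0.
apply: (le_trans (mass_markov_sqr m eta0 (measurable_boundary_part n)
   (C := \sum_b `|@centered_stat R p (scaled_jump n) lag (K n) b|) _)).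
  by move=> x; rewrite boundary_partE; exact: fin_fun_bounded.
by rewrite ler_wpM2l ?invr_ge0 ?sqr_ge0//; exact: boundary_part_sqr.
Qed.

End stable_process.

Lemma near_natr_ge (R : realType) (A : R) : \forall n \near \oo, A <= n%:R.
Proof. by have /cvgryPge := @cvgr_idn R; exact. Qed.

Lemma powR_seq_cvg0 (R : realType) (u : nat -> R) (b : R) :
  0 < b -> (forall n, 0 <= u n) -> u n @[n --> \oo] --> (0 : R) ->
  u n `^ b @[n --> \oo] --> (0 : R).
Proof.
move=> b0 u0 ucv; apply/cvgrPdist_le => e e0.
have eb : 0 < e `^ b^-1 by exact: powR_gt0.
move/cvgrPdist_le/(_ _ eb) : ucv; apply: filterS => n.
rewrite !sub0r !normrN !ger0_norm ?powR_ge0// => ue.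
have := ge0_ler_powR (ltW b0) _ _ ue; rewrite -powRrM mulVf ?gt_eqF// powRr1 ?(ltW e0)//.
by apply; rewrite nnegrE// ltW.
Qed.

Lemma exists_first_lag : exists K : nat -> nat,
  (forall n k, (K n <= k)%N -> (n <= lag k)%N) /\
  (forall n k, (k < K n)%N -> (lag k < n)%N).
Proof.
have /choice[K hK] : forall n, exists K : nat,
    (forall k, (K <= k)%N -> (n <= lag k)%N) /\ (forall k, (k < K)%N -> (lag k < n)%N).
  move=> n; have ex : exists k, (n <= lag k)%N by exists n; rewrite /lag; nia.
  exists (ex_minn ex); case: ex_minnP => K nK minK; split => k kK.
    by apply: (leq_trans nK); rewrite /lag leq_mul.
  by rewrite ltnNge; apply/negP => /minK; rewrite leqNgt kK.
by exists K; split => n; [exact: (hK n).1|exact: (hK n).2].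
Qed.

(** * The first lag reaching [n], and the exponent as a Riemann sum *)

Section first_lag.
Context (R : realType).
Variable K : nat -> nat.
Hypothesis K_le : forall n k, (K n <= k)%N -> (n <= lag k)%N.
Hypothesis K_gt : forall n k, (k < K n)%N -> (lag k < n)%N.

Lemma first_lag_sqr n : (K n * K n <= n)%N.
Proof.
case e : (K n) => [//|k].
by have := @K_gt n k; rewrite e ltnSn /lag => /(_ isT); lia.
Qed.

Lemma first_lag_leq n : (K n <= n)%N.
Proof. by have := first_lag_sqr n; nia. Qed.

Lemma first_lag_ratio : (K n)%:R / n%:R @[n --> \oo] --> (0 : R).
Proof.
apply/cvgrPdist_le => e e0; near=> n.
have ne : (e ^+ 2)^-1 <= n%:R by near: n; exact: near_natr_ge.
have n0 : 0 < n%:R :> R by apply: lt_le_trans ne; rewrite invr_gt0 exprn_gt0.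
rewrite sub0r normrN ger0_norm ?divr_ge0// ler_pdivrMr//.
rewrite -ler_sqr ?nnegrE ?mulr_ge0 ?(ltW e0)//.
apply: (@le_trans _ _ n%:R); first by rewrite expr2 -natrM ler_nat first_lag_sqr.
rewrite exprMn [n%:R ^+ 2]expr2 mulrA ler_peMl ?(ltW n0)//.
by rewrite -ler_pdivrMl ?exprn_gt0// mulr1.
Unshelve. all: by end_near. Qed.

Lemma first_lag_inv : (K n).+1%:R^-1 @[n --> \oo] --> (0 : R).
Proof.
apply/cvgrPdist_le => e e0; near=> n.
have ne : (e ^+ 2)^-1 <= n%:R by near: n; exact: near_natr_ge.
rewrite sub0r normrN ger0_norm ?invr_ge0//.
rewrite -[leRHS]invrK lef_pV2 ?posrE ?invr_gt0 ?ltr0n//.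
rewrite -ler_sqr ?nnegrE ?invr_ge0 ?(ltW e0)// exprVn.
by apply: (le_trans ne); rewrite expr2 -natrM ler_nat; exact: (K_le (leqnn (K n))).
Unshelve. all: by end_near. Qed.

Lemma first_lag_jump_prob : jump_prob R (K n) @[n --> \oo] --> (0 : R).
Proof.
have := first_lag_inv; apply: squeeze_cvgr (cvg_cst 0); apply: nearW => n.
rewrite invr_ge0 mulr_ge0//= /jump_prob invfM ler_piMr ?invr_ge0//.
by rewrite invf_le1 ?ltr0n// ler1n.
Qed.

Variables (g c : R).
Hypotheses (g1 : 1 < 2 * g) (c0 : 0 < c).

(** With [q = (|theta| c) ^ (1 / g)] and [lam n = n / q], the scaled jump times [|theta|] is
    [((k + 1) / lam n) ^ g], and the factor [n] is [q * lam n]. The cut-off [n * n] outgrows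
    [lam n], so no part of the integral is lost. *)
Lemma scaled_jump_riemann (theta : R) :
  \sum_(K n <= k < n * n) n%:R * (jump_prob R k * (1 - cos (theta * scaled_jump g c n k)))
    @[n --> \oo] --> (`|theta| * c) `^ g^-1 * stable_const g.
Proof.
have g0 : 0 < g by move: g1 => ?; lra.
have gi0 : g^-1 != 0 by rewrite invr_eq0 gt_eqF.
have [->|tn0] := eqVneq theta 0.
  rewrite normr0 mul0r powR0// mul0r.
  rewrite (_ : (fun n => _) = fun=> 0); first exact: cvg_cst.
  by apply/funext => n; rewrite big1// => k _; rewrite mul0r cos0 subrr !mulr0.
have t0 : 0 < `|theta| * c by rewrite mulr_gt0 ?normr_gt0.
set q := _ `^ g^-1; have q0 : 0 < q by exact: powR_gt0.
(* [maxn] only guards positivity at [n = 0]. *)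
pose lam (n : nat) : R := (maxn n 1)%:R / q.
have lam0 n : 0 < lam n by rewrite divr_gt0// ltr0n leq_max orbT.
have lamE n : (0 < n)%N -> lam n = n%:R / q by move=> n0; rewrite /lam (maxn_idPl n0).
have lamy : lam n @[n --> \oo] --> +oo.
  apply/cvgryPge => A; near=> n; rewrite lamE//; last by near: n; exact: nbhs_infty_gt.
  by rewrite ler_pdivlMr//; near: n; exact: near_natr_ge.
have K0 : (K n)%:R / lam n @[n --> \oo] --> (0 : R).
  have : q * ((K n)%:R / n%:R) @[n --> \oo] --> q * 0.
    by apply: cvgMr; exact: first_lag_ratio.
  rewrite mulr0; apply: cvg_trans; apply: near_eq_cvg; near=> n.
  rewrite lamE; last by near: n; exact: nbhs_infty_gt.
  by rewrite invfM invrK mulrCA [q * _]mulrC.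
have Ny : ((n * n)%N)%:R / lam n @[n --> \oo] --> +oo.
  apply/cvgryPge => A; near=> n.
  have n0 : (0 < n)%N by near: n; exact: nbhs_infty_gt.
  have nn0 : n%:R != 0 :> R by rewrite pnatr_eq0 -lt0n.
  have -> : (n * n)%:R / lam n = n%:R * q.
    by rewrite lamE// natrM; field; rewrite nn0 gt_eqF.
  by rewrite -ler_pdivrMr//; near: n; exact: near_natr_ge.
have rs := riemann_sum_cvg g1 lam0 lamy K0 Ny.
have : q * (\sum_(K n <= k < n * n) (lam n * (k.+1%:R * k.+2%:R)^-1 *
    (1 - cos ((k.+1%:R / lam n) `^ g)))) @[n --> \oo] --> q * stable_const g.
  exact: cvgMr.
apply: cvg_trans; apply: near_eq_cvg; near=> n.
have n0 : (0 < n)%N by near: n; exact: nbhs_infty_gt.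
have nR : 0 < n%:R :> R by rewrite ltr0n.
rewrite mulr_sumr; apply: eq_bigr => k _.
have -> : cos ((k.+1%:R / lam n) `^ g) = cos (theta * scaled_jump g c n k).
  rewrite -[RHS]cos_norm lamE//; congr cos.
  rewrite /scaled_jump /jump_size !normrM normfV.
  rewrite (ger0_norm (powR_ge0 n%:R _)) (gtr0_norm c0) (ger0_norm (powR_ge0 _ _)).
  have -> : k.+1%:R / (n%:R / q) = k.+1%:R * n%:R^-1 * q.
    by field; rewrite !gt_eqF.
  have qg : q `^ g = `|theta| * c.
    by rewrite /q -powRrM mulVf ?gt_eqF// powRr1 ?(ltW t0).
  have ng : n%:R^-1 `^ g = (n%:R `^ g)^-1 :> R.
    by rewrite -[n%:R^-1]powR_inv1// -powRrM mulN1r powRN.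
  rewrite powRM ?mulr_ge0 ?invr_ge0 ?(ltW q0)// powRM ?invr_ge0// qg ng.
  by ring.
rewrite lamE// /jump_prob; move: ((k.+1%:R * k.+2%:R)^-1 : R) (1 - cos _) => P C.
by field; rewrite gt_eqF.
Unshelve. all: by end_near. Qed.

End first_lag.

(** * Limit of the characteristic functions, and tightness *)

Section limits.
Context (R : realType).
Variables (g c : R) (K : nat -> nat).
Hypotheses (g1 : 1 < 2 * g) (c0 : 0 < c).
Hypothesis K_le : forall n k, (K n <= k)%N -> (n <= lag k)%N.
Hypothesis K_gt : forall n k, (k < K n)%N -> (lag k < n)%N.

Let p : nat -> R := jump_prob R.

Let p01 k : 0 < p k < 1. Proof. exact: jump_prob01. Qed.

Let p_mono j k : (j <= k)%N -> p k <= p j.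
Proof.
move=> jk; rewrite /p /jump_prob lef_pV2 ?posrE ?mulr_gt0 ?ltr0n//.
by rewrite -!natrM ler_nat leq_mul// ltnS.
Qed.

Definition stable_exponent (theta : R) : R :=
  2 * ((`|theta| * c) `^ g^-1 * stable_const g).

(** For [k >= K n] all [p k] are at most [p (K n)], which tends to 0. So the terms are at most
    [4 * p (K n)], and dropping [1 - p k] changes the sum by a relative error of at most
    [p (K n)]. *)
Lemma ideal_product_cvg (theta : R) :
  \prod_(K n <= k < n * n)
     (1 - 2 * (p k * (1 - p k)) * (1 - cos (theta * scaled_jump g c n k))) ^+ n
    @[n --> \oo] --> expR (- stable_exponent theta).
Proof.
pose S n : R := \sum_(K n <= k < n * n)
   n%:R * (p k * (1 - cos (theta * scaled_jump g c n k))).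
have Scv : S n @[n --> \oo] --> (`|theta| * c) `^ g^-1 * stable_const g.
  exact: (scaled_jump_riemann K_gt g1 c0).
have pcv : p (K n) @[n --> \oo] --> (0 : R) by exact: (first_lag_jump_prob K_le).
have C0 (x : R) : 0 <= 1 - cos x by rewrite subr_ge0 cos_le1.
apply: (@prod_expR_cvg R (fun n k => 2 * (p k * (1 - p k)) *
    (1 - cos (theta * scaled_jump g c n k))) (fun n => 4 * p (K n))).
- move=> n k Kk; have /andP[q0 q1] := p01 k; have pk := p_mono Kk.
  have a0 := C0 (theta * scaled_jump g c n k).
  have a1 := cos_geN1 (theta * scaled_jump g c n k).
  move: a0 a1 pk q0 q1; move: (p k) (p (K n)) (cos _) => a b C ? ? ? ? ?.
  have : 0 <= a * (1 - a) <= a by apply/andP; split; nra.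
  by move=> /andP[? ?]; apply/andP; split; nra.
- by rewrite -[X in _ --> X](mulr0 4); exact: cvgMr.
have lower : 2 * ((1 - p (K n)) * S n) @[n --> \oo] --> stable_exponent theta.
  apply: cvgMr; rewrite -[X in _ --> X]mul1r; apply: cvgM => //.
  by rewrite -[X in _ --> X]subr0; apply: cvgB => //; exact: cvg_cst.
have upper : 2 * S n @[n --> \oo] --> stable_exponent theta by exact: cvgMr.
apply: (squeeze_cvgr _ lower upper); apply: nearW => n.
rewrite /S !mulr_sumr; apply/andP; split; rewrite big_nat_cond [leRHS]big_nat_cond;
  apply: ler_sum => k; rewrite andbT => /andP[Kk _];
  have /andP[q0 q1] := p01 k; have pk := p_mono Kk;
  have a0 := C0 (theta * scaled_jump g c n k);
  have nR : 0 <= n%:R :> R by [].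
  have w0 : 0 <= n%:R * (p k * (1 - cos (theta * scaled_jump g c n k))).
    by rewrite !mulr_ge0// ltW.
  rewrite [leRHS](_ : _ = 2 * ((1 - p k) *
    (n%:R * (p k * (1 - cos (theta * scaled_jump g c n k)))))); last by ring.
  by rewrite ler_pM2l// ler_wpM2r// lerB.
have w0 : 0 <= n%:R * (p k * (1 - cos (theta * scaled_jump g c n k))).
  by rewrite !mulr_ge0// ltW.
rewrite [leLHS](_ : _ = 2 * ((1 - p k) *
  (n%:R * (p k * (1 - cos (theta * scaled_jump g c n k)))))); last by ring.
by rewrite ler_pM2l// ler_piMl// gerBl ltW.
Qed.

Context (d : measure_display) (X : measurableType d)
  (m : probability X R) (T : X -> X).
Hypothesis hT : measure_preserving m T.
Variable E : nat -> set X.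
Hypothesis mE : forall k, measurable (E k).
Hypothesis hE : forall K N b, (K <= N)%N ->
    mass m (block_set T lag_window E K N b) <=
    (1 + K.+1%:R^-1) * \prod_(K <= k < N) \prod_(i < lag_window k) bern (p k) (b k i).

Let Z n := normalized_sum T g c E n.
Let M n N := main_part T g c E K n N.
Let U n := boundary_part T g c E K n.
Let V := variance_const g c.

Lemma measurable_normalized_sum n : measurable_fun setT (Z n).
Proof.
apply: measurable_funM; first exact: measurable_cst.
apply: measurable_sum => i; apply: measurableT_comp; last exact: (measurable_iter hT).
exact: (measurable_stable_fun hT g c0 mE).
Qed.

Definition exceptional_set n N (eta : R) : set X :=
  late_jumps T E n N `|` ([set x | eta < `|U n x|] `|`
    iter n T @^-1` [set x | eta < `|U n x|]).

Lemma measurable_exceptional_set n N eta : measurable (exceptional_set n N eta).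
Proof.
have mU : measurable [set x | eta < `|U n x|].
  exact: (measurable_tail (measurable_boundary_part hT g c mE K n)).
apply: measurableU; first exact: (measurable_late_jumps hT mE).
by apply: measurableU => //; exact: (measurable_preimage_iter hT).
Qed.

Lemma mass_exceptional_set n N eta : 0 < eta -> (0 < n)%N ->
  mass m (exceptional_set n N eta) <= 4 * n%:R * N.+1%:R^-1 +
    2 * ((eta ^+ 2)^-1 * (2 * V * ((K n)%:R / n%:R) `^ (2 * g - 1))).
Proof.
move=> eta0 n0.
have mU : measurable [set x | eta < `|U n x|].
  exact: (measurable_tail (measurable_boundary_part hT g c mE K n)).
have mU' := measurable_preimage_iter hT n mU.
apply: (le_trans (massU2 m (measurable_late_jumps hT mE n N) (measurableU _ _ mU mU'))).
apply: lerD; first exact: (mass_late_jumps hT g1 c0 mE hE).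
apply: (le_trans (massU2 m mU mU')).
have := boundary_part_tail hT g1 c0 mE hE K_gt eta0 n0.
rewrite (mass_iter hT n mU) -/U -/V.
by move: (mass _ _) => A ?; rewrite mulr2n mulrDl !mul1r lerD.
Qed.

Lemma exceptional_set_close n N eta x : (K n <= N)%N ->
  ~ exceptional_set n N eta x -> `|Z n x - M n N x| <= 2 * eta.
Proof.
move=> KN nx; rewrite /Z (normalized_sum_decomposition g c0 KN).
  rewrite -/M addrAC subrr add0r.
  have u1 : `|U n x| <= eta by rewrite leNgt; apply/negP => h; apply: nx; right; left.
  have u2 : `|U n (iter n T x)| <= eta.
    by rewrite leNgt; apply/negP => h; apply: nx; right; right.
  by apply: (le_trans (ler_normB _ _)); rewrite -/U; lra.
by move=> h; apply: nx; left.
Qed.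

Lemma normalized_sum_cos_close n N theta s eta : (K n <= N)%N -> 0 <= eta ->
  `|law_mean m (Z n) (fun y => cos (theta * y + s)) -
    law_mean m (M n N) (fun y => cos (theta * y + s))| <=
  `|theta| * (2 * eta) + 2 * mass m (exceptional_set n N eta).
Proof.
move=> KN eta0; have [mc _] := bounded_measurable_cos theta s.
have mM := measurable_main_part hT g c mE K_le n N.
apply: (@Rintegral_close _ _ _ m _ _ _ 1 1).
- exact: (measurableT_comp mc (measurable_normalized_sum n)).
- exact: (measurableT_comp mc mM).
- exact: measurable_exceptional_set.
- by move=> x; exact: cos_max.
- by move=> x; exact: cos_max.
- by rewrite !mulr_ge0.
- by [].
- move=> x; apply: (le_trans (ler_normB _ _)).
  by rewrite -[2]/(1 + 1) lerD// cos_max.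
move=> x /(exceptional_set_close KN) close; apply: (le_trans (dist_cos_le _ _)).
rewrite (_ : _ - _ = theta * (Z n x - M n N x)); last by ring.
by rewrite normrM ler_wpM2l.
Qed.

Let ratio_cvg0 : ((K n)%:R / n%:R) `^ (2 * g - 1) @[n --> \oo] --> (0 : R).
Proof.
apply: powR_seq_cvg0; first by rewrite subr_gt0.
  by move=> n; rewrite divr_ge0.
exact: (first_lag_ratio K_gt).
Qed.

(** The cut-off [N = n * n] makes the mass of the late jumps, of order [n / N], vanish, while the
    product runs far enough to reach the full limit. *)
Lemma normalized_sum_cos_cvg theta s :
  law_mean m (Z n) (fun y => cos (theta * y + s)) @[n --> \oo] -->
  cos s * expR (- stable_exponent theta).
Proof.
pose C n := cos s * \prod_(K n <= k < n * n)
  (1 - 2 * (p k * (1 - p k)) * (1 - cos (theta * scaled_jump g c n k))) ^+ n.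
have Ccv : C n @[n --> \oo] --> cos s * expR (- stable_exponent theta).
  by apply: cvgMr; exact: ideal_product_cvg.
apply/cvgrPdist_le => e e0.
(* Makes the Lipschitz error [|theta| * (2 * eta)] at most [e / 4]; the added 1 covers
   [theta = 0]. *)
pose eta := e / (8 * (`|theta| + 1)).
have t1 : 0 < `|theta| + 1 by rewrite ltr_wpDl.
have eta0 : 0 < eta by rewrite divr_gt0// mulr_gt0.
have teta : `|theta| * (2 * eta) <= e / 4.
  have -> : e / 4 = (`|theta| + 1) * (2 * eta).
    by rewrite /eta; field; rewrite gt_eqF.
  by apply: ler_wpM2r; rewrite ?lerDl// mulr_ge0// ltW.
pose err n : R := 2 * (4 * (n%:R * (n * n).+1%:R^-1) +
    2 * ((eta ^+ 2)^-1 * (2 * V * ((K n)%:R / n%:R) `^ (2 * g - 1)))) +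
  2 * (K n).+1%:R^-1.
have errcv : err n @[n --> \oo] --> (0 : R).
  have late : n%:R * (n * n).+1%:R^-1 @[n --> \oo] --> (0 : R).
    have hcv : 2 * harmonic n @[n --> \oo] --> (0 : R).
      by rewrite -[X in _ --> X](mulr0 2); apply: cvgMr; exact: cvg_harmonic.
    apply: (squeeze_cvgr _ (cvg_cst 0) hcv); apply: nearW => n.
    rewrite mulr_ge0 ?invr_ge0//= /harmonic ler_pdivrMr ?ltr0n//.
    rewrite mulrAC ler_pdivlMr ?ltr0n// -!natrM ler_nat.
    by nia.
  have -> : (0 : R) = 2 * (4 * 0 + 2 * ((eta ^+ 2)^-1 * (2 * V * 0))) + 2 * 0.
    by rewrite !(mulr0, addr0).
  apply: cvgD; last by apply: cvgMr; exact: (first_lag_inv K_le).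
  apply: cvgMr; apply: cvgD; first exact: cvgMr.
  by apply: cvgMr; apply: cvgMr; exact: cvgMr.
have e4 : 0 < e / 4 by rewrite divr_gt0.
near=> n.
have n0 : (0 < n)%N by near: n; exact: nbhs_infty_gt.
have KN : (K n <= n * n)%N.
  by apply: (leq_trans (first_lag_leq K_gt n)); rewrite leq_pmulr.
have h1 := normalized_sum_cos_close theta s KN (ltW eta0).
have h2 := mass_exceptional_set (n * n) eta0 n0.
have h3 := main_part_cos hT g c mE hE K_le theta s KN.
have h4 : `|cos s * expR (- stable_exponent theta) - C n| <= e / 4.
  by near: n; move/cvgrPdist_le : Ccv; exact.
have h5 : err n <= e / 4.
  have : `|0 - err n| <= e / 4 by near: n; move/cvgrPdist_le : errcv; exact.
  by rewrite sub0r normrN; apply: le_trans; exact: ler_norm.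
have h : `|law_mean m (Z n) (fun y => cos (theta * y + s)) - C n| <= e / 4 + e / 4.
  apply: (le_trans (ler_distD (law_mean m (M n (n * n)) (fun y => cos (theta * y + s))) _ _)).
  apply: (le_trans (lerD h1 h3)).
  move: h2; rewrite -[4 * n%:R * _]mulrA.
  set bound := 4 * _ + _ => h2.
  have {}h5 : 2 * bound + 2 * (K n).+1%:R^-1 <= e / 4 := h5.
  move: teta h2 h5; move: (`|theta| * _) (mass _ _) ((K n).+1%:R^-1) bound.
  by move=> a b i w; lra.
rewrite distrC in h.
apply: (le_trans (ler_distD (C n) _ _)); apply: (le_trans (lerD h4 h)).
by lra.
Unshelve. all: by end_near. Qed.

(** At [N = n * n] the second moment bound of the main part would grow with [n]. With [N = n * r]
    and [r] fixed, that bound is the constant [W], and the late jumps have mass at most [4 / r],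
    which is small enough for large [r]. *)
Lemma normalized_sum_tight e : 0 < e -> exists A : R, 0 < A /\
  \forall n \near \oo, mass m [set x | A < `|Z n x|] <= e.
Proof.
move=> e0; have e4 : 0 < e / 4 by rewrite divr_gt0.
have V0 : 0 <= V := variance_const_ge0 c g1.
have [r r0 re] : exists2 r : nat, (0 < r)%N & 4 * r%:R^-1 <= e / 4.
  exists (Num.trunc (16 / e)).+1 => //.
  rewrite ler_pdivrMr ?ltr0n// -ler_pdivrMl//.
  apply: (@le_trans _ _ (16 / e)); last exact/ltW/truncnS_gt.
  by rewrite invf_div; lra.
pose W : R := 4 * V * r%:R `^ (2 * g - 1).
have W0 : 0 <= W by apply: mulr_ge0; [exact: mulr_ge0|exact: powR_ge0].
(* Both [B >= 1] and [B * e >= 4 * W] hold, so [W / B ^ 2 <= W / B <= e / 4]. *)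
pose B := 1 + 4 * W / e.
have B1 : 1 <= B by rewrite lerDl; apply: divr_ge0; [exact: mulr_ge0|exact: ltW].
have BW : (B ^+ 2)^-1 * W <= e / 4.
  rewrite ler_pdivrMl ?exprn_gt0 ?(lt_le_trans ltr01)//.
  have BE : B * e = e + 4 * W by rewrite /B; field; rewrite gt_eqF.
  have : B * e <= B ^+ 2 * e by rewrite ler_pM2r// expr2 ler_peMl// (le_trans ler01).
  by rewrite BE; lra.
exists (B + 2); split; first by lra.
have excv : 2 * (2 * V * ((K n)%:R / n%:R) `^ (2 * g - 1)) @[n --> \oo] --> (0 : R).
  have -> : (0 : R) = 2 * (2 * V * 0) by rewrite !mulr0.
  by apply: cvgMr; exact: cvgMr.
near=> n.
have n0 : (0 < n)%N by near: n; exact: nbhs_infty_gt.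
have nR : 0 < n%:R :> R by rewrite ltr0n.
have KN : (K n <= n * r)%N.
  by apply: (leq_trans (first_lag_leq K_gt n)); rewrite leq_pmulr.
have mM : measurable [set x | B < `|M n (n * r) x|].
  exact: (measurable_tail (measurable_main_part hT g c mE K_le n (n * r))).
have mX := measurable_exceptional_set n (n * r) 1.
have h1 := mass_exceptional_set (n * r) ltr01 n0.
have h2 := main_part_tail hT g1 c0 mE hE K_le (lt_le_trans ltr01 B1) n0 KN.
have h3 : 2 * (2 * V * ((K n)%:R / n%:R) `^ (2 * g - 1)) <= e / 4.
  set t := 2 * _.
  have : `|0 - t| <= e / 4 by rewrite /t; near: n; move/cvgrPdist_le : excv; exact.
  by rewrite sub0r normrN; apply: le_trans; exact: ler_norm.
have h4 : 4 * n%:R * (n * r).+1%:R^-1 <= e / 4.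
  apply: le_trans re; rewrite -mulrA ler_pM2l// ler_pdivrMr ?ltr0n//.
  by rewrite mulrC ler_pdivlMr ?ltr0n// -natrM ler_nat.
have h5 : (n * r)%:R / n%:R = r%:R :> R by rewrite natrM mulrC mulrA mulVf ?mul1r ?gt_eqF.
have sub : [set x | B + 2 < `|Z n x|] `<=`
    exceptional_set n (n * r) 1 `|` [set x | B < `|M n (n * r) x|].
  move=> x /= Zx; have [|nx] := pselect (exceptional_set n (n * r) 1 x); first by left.
  right => /=; have cl := exceptional_set_close KN nx.
  have tri := ler_normD (Z n x - M n (n * r) x) (M n (n * r) x).
  rewrite subrK in tri; move: cl (lt_le_trans Zx tri).
  by move: (`|Z n x - _|) (`|M _ _ _|) => a b; lra.
have mZ : measurable [set x | B + 2 < `|Z n x|].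
  exact: (measurable_tail (measurable_normalized_sum n)).
apply: (le_trans (le_mass m mZ (measurableU _ _ mX mM) sub)).
apply: (le_trans (massU2 m mX mM)).
move: h1 h2; rewrite h5 expr1n invr1 mul1r -/V -/W.
move=> /le_trans /(_ (lerD h4 h3)) hb /le_trans /(_ BW) ha.
by move: hb ha; move: (mass _ _) (mass _ _) => a b; lra.
Unshelve. all: by end_near. Qed.

End limits.

Lemma expectation_comp (R : realType) (d : measure_display) (X : measurableType d)
    (m : probability X R) (V : X -> R) (g : R -> R) :
  measurable_fun setT V -> bounded_measurable g ->
  'E_m[g \o V]%E = (law_mean m V g)%:E.
Proof.
move=> mV bg; rewrite unlock /law_mean /Rintegral fineK//.
by apply: integrable_fin_num => //; exact: bounded_measurable_comp.
Qed.

Theorem theorem1 (R : realType) (d : measure_display) (X : measurableType d)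
    (m : probability X R) (T : X -> X)
    (hstd : standard_probability_space m)
    (hT : measure_preserving m T)
    (haper : aperiodic m T)
    (herg : ergodic m T)
    (alpha sigma : R) (halpha0 : 0 < alpha) (halpha2 : alpha < 2)
    (hsigma : 0 < sigma) :
  exists f : X -> R,
    measurable_fun [set: X] f /\
    exists (d' : measure_display) (W : measurableType d')
           (P : probability W R) (Y : {RV P >-> R}),
      SaS alpha sigma Y /\
      cvg_in_distribution m P
        (fun n x => (n%:R `^ alpha^-1)^-1 * birkhoff_sum T f n x) Y.
Proof.
pose g := alpha^-1.
have g1 : 1 < 2 * g by rewrite /g ltr_pdivlMr// mul1r.
have kap0 := stable_const_gt0 g1.
(* Solves [2 * stable_const g * c ^ alpha = sigma ^ alpha]. *)
pose c : R := (sigma `^ alpha / (2 * stable_const g)) `^ g.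
have c0 : 0 < c by rewrite powR_gt0// divr_gt0 ?powR_gt0// mulr_gt0.
have exponentE theta :
    stable_exponent g c theta = sigma `^ alpha * `|theta| `^ alpha.
  rewrite /stable_exponent /g invrK powRM ?(ltW c0)// /c -powRrM mulVf ?gt_eqF//.
  rewrite powRr1; last by rewrite divr_ge0 ?powR_ge0// mulr_ge0// ltW.
  by rewrite -/g; field; rewrite gt_eqF.
have [E [mE hE]] := exists_almost_independent_events hstd hT haper
  lag_window (jump_prob01 R).
have [K [K_le K_gt]] := exists_first_lag.
pose Z := normalized_sum T g c E.
have mZ n : measurable_fun setT (Z n).
  exact: (measurable_normalized_sum g c0 hT mE).
have Zcos theta s :
    law_mean m (Z n) (fun y => cos (theta * y + s)) @[n --> \oo] -->
    cos s * expR (- stable_exponent g c theta).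
  exact: (normalized_sum_cos_cvg g1 c0 K_le K_gt hT mE hE).
have [P PE] := levy_continuity mZ
  (normalized_sum_tight g1 c0 K_le K_gt hT mE hE)
  (fun theta s => cvgP _ (Zcos theta s)).
exists (stable_fun T g c E); split; first exact: (measurable_stable_fun hT g c0 mE).
pose idR : measurableTypeR R -> R := idfun.
have midR : measurable_fun setT idR by exact: measurable_id.
pose Y : {RV P >-> R} := mfun_Sub (mem_set midR).
exists _, (measurableTypeR R), P, Y; split.
  move=> theta.
  have cosE s : law_mean P idR
      (fun y => cos (theta * y + s)) = cos s * expR (- stable_exponent g c theta).
    apply: (cvg_unique _ (PE _ _ _) (Zcos theta s)).
    - by [].
    - exact: continuous_cos_affine.
    - exact: bounded_cos_affine.
  rewrite /char_fun unlock -exponentE; congr Complex.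
    transitivity (law_mean P idR
        (fun y => cos (theta * y + 0))).
      by apply: eq_Rintegral => y _; rewrite addr0.
    by rewrite cosE cos0 mul1r.
  (* The sine is the cosine with phase [- pi / 2], whose limit carries the factor
     [cos (- pi / 2) = 0]; for this a phase is kept throughout. *)
  transitivity (law_mean P idR
      (fun y => cos (theta * y + - (pi / 2)))).
    by apply: eq_Rintegral => y _; rewrite cosBpihalf.
  by rewrite cosE cosN cos_pihalf mul0r.
move=> h ch bh; have bm := continuous_bounded_measurable ch bh.
rewrite (expectation_comp P midR bm).
under eq_fun do rewrite (expectation_comp m (mZ _) bm).
by apply/cvg_EFin; [exact: nearW|exact: PE].
Qed.
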